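(* For every real $\alpha > 0$, $$\int_0^1 \frac{\mathbf{E}\left(\sqrt{1-x}\right)\, \mathbf{K}^2\left(\sqrt{\frac12 - \frac{1}{\sqrt2}\sqrt{\frac{1-\sqrt{1-\alpha x}}{\alpha x}}}\right)}{\sqrt[4]{2\sqrt{1-\alpha x} - \alpha x + 2}}\, dx$$ equals $$\frac{\pi^2\left(36\alpha + 2\sqrt{1-\alpha} - 15\sqrt2\,\sqrt{\frac{\sqrt{1-\alpha}+1}{\alpha}}\;\alpha\,\coth^{-1}\left(\frac{\sqrt2\,\sqrt{\sqrt{1-\alpha}+1}}{\sqrt\alpha}\right) - 2\right)}{60\,\alpha\,\sqrt{\sqrt{1-\alpha}+1}}.$$
   Context: The complete elliptic integrals of the first and second kind, as functions of the modulus $k$, are $\mathbf{K}(k) = \int_0^{\pi/2} (1 - k^2\sin^2\theta)^{-1/2}\, d\theta$ and $\mathbf{E}(k) = \int_0^{\pi/2} \sqrt{1-k^2\sin^2\theta}\, d\theta$; they depend only on $k^2$, and the same integrals (with principal square roots) define them for complex $k$ with $k^2 \notin [1,\infty)$. $\mathbf{K}^2(\cdot)$ denotes the square of $\mathbf{K}(\cdot)$. When $\alpha > 1$ some of the radicands are negative or complex; all square roots and fourth roots are then principal values (so $\sqrt{-t} = i\sqrt{t}$ for $t>0$), and $\coth^{-1}(w) = \tanh^{-1}(1/w) = \frac12\left[\ln(1+1/w) - \ln(1-1/w)\right]$ with principal logarithms. *)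

(* Defs.v *)
From Stdlib Require Import Reals.
From Coquelicot Require Import Coquelicot.
Local Open Scope R_scope.

(* Principal argument, with values in (-PI, PI]; the value PI / 2 at z = 0 is
   a dummy that the two roots below do not see. *)
Definition Carg (z : C) : R :=
  if Rle_dec 0 (Im z) then acos (Re z / Cmod z) else - acos (Re z / Cmod z).

Definition Cpolar (r t : R) : C := (r * cos t, r * sin t).

(* Principal roots, cut along the negative axis and continuous onto it from
   above, so that Csqrt (- t) = i sqrt t for t > 0. *)
Definition Csqrt (z : C) : C := Cpolar (sqrt (Cmod z)) (Carg z / 2).

Definition Croot4 (z : C) : C := Cpolar (sqrt (sqrt (Cmod z))) (Carg z / 4).

(* Meaningful only for z <> 0. *)
Definition Cln (z : C) : C := (ln (Cmod z), Carg z).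

Definition Cacoth (w : C) : C := ((Cln (1 + / w) - Cln (1 - / w)) / 2)%C.

(* The argument of both functions is the modulus k, not the parameter k^2. *)
Definition EllipticK (k : C) : C :=
  RInt (V := C_R_CompleteNormedModule)
    (fun th : R => (/ Csqrt (1 - k * k * RtoC (sin th ^ 2)))%C) 0 (PI / 2).

Definition EllipticE (k : C) : C :=
  RInt (V := C_R_CompleteNormedModule)
    (fun th : R => Csqrt (1 - k * k * RtoC (sin th ^ 2))%C) 0 (PI / 2).

(* Main.v *)
Require Import Defs.
From Stdlib Require Import Reals Lra Lia Psatz.
From Coquelicot Require Import Coquelicot.
Open Scope R_scope.

(** For 0 < x < 1 put s = sqrt (1 - alpha x), y = (1 - s)/(1 + s) and eta = -y. Then |y| <= 1 and
    alpha x = 4y/(1 + y)^2; for alpha x > 1 the point y lies on the unit circle. The parameter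
    m = k^2 satisfies 4m(1 - m) = eta, the fourth root is sqrt (1 + s), and
    1 / sqrt (1 + s) = sqrt ((1 + y)/2).

    The quadratic transformation F(1/2,1/2;1;m) = F(1/4,1/4;1;eta) and the formula of Clausen give
    K^2 = (pi^2/4) sum c_n^3 (-y)^n with c_n = (1/2)_n / n! ([EllipticK_sqr]). Both are proved
    coefficientwise, and absolute convergence makes them hold on the closed disc. So up to a
    constant the integrand is E(sqrt (1 - x)) Phi(y) with Phi(y) = sqrt (1 + y) sum c_n^3 (-y)^n.

    The dependence on x is disentangled by Legendre polynomials. The function
    sqrt (1 + y) sum P_2n(u) y^n depends only on 4y u^2/(1 + y)^2 = alpha x u^2
    ([leg_norm_homogeneous]), so it equals sqrt (1 + y0) sum P_2n(u sqrt x) y0^n, where y0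
    belongs to x = 1. Averaging u^2 over the product of two arcsine variables turns P_2n(u) into
    (-1)^n c_n^3 ([leg_evenc_invsqrtc_sum]); hence Phi(y) = sqrt (1 + y0) sum y0^n T_n(x) with
    polynomials T_n independent of alpha ([leg_avg_ser_homogeneous], [leg_avg_ser_Ksq]).

    The moments of E(sqrt (1 - x)) are quotients of gamma values ([ellE_moment]). Against T_n they
    give rational numbers that are, up to the terms n = 0 and n = 1, differences of Wallis
    integrals ([leg_evenc_moment_sum]), so the series in y0 is an elementary integral
    ([leg_moment_series], [wallis_odd_ser_integral]), which is the inverse hyperbolic cotangent
    ([is_RInt_Cacoth]).

    The expansion in y0 needs |y0| < 1, that is, Re s0 > 0 where s0 = sqrt (1 - alpha). For alpha >= 1 the
    point s0 is on the imaginary axis; it is the limit of s0 + e as e tends to 0 from above, and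
    both sides are continuous there ([K2_kernel_integral]). *)

(** * Finite sums and three coefficient sequences *)

Lemma sum_telescope_le (f G : nat -> R) (n : nat) :
  (forall j, (j <= n)%nat -> f j = G (S j) - G j) ->
  sum_f_R0 f n = G (S n) - G 0%nat.
Proof.
  intros H; induction n as [|n IH]; simpl; [now apply H|].
  rewrite IH, H by (intros; try apply H; lia). ring.
Qed.

Lemma sum_telescope (f G : nat -> R) (n : nat) :
  (forall j, f j = G (S j) - G j) -> sum_f_R0 f n = G (S n) - G 0%nat.
Proof. intros H. apply sum_telescope_le. auto. Qed.

Lemma sum_scal_l (x : R) (f : nat -> R) (n : nat) :
  sum_f_R0 (fun k => x * f k) n = x * sum_f_R0 f n.
Proof. rewrite scal_sum. apply sum_eq; intros; ring. Qed.

(** The form in which a Zeilberger certificate proves a convolution identity: indices i and j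
    with i + j fixed replace a truncated subtraction. *)
Lemma conv_telescope (f G : nat -> nat -> R) (n : nat) :
  (forall i j, (i + j = n)%nat -> f i j = G (S i) j - G i (S j)) ->
  sum_f_R0 (fun k => f k (n - k)%nat) n = G (S n) 0%nat - G 0%nat (S n).
Proof.
  intros H.
  assert (Hk : forall k, (k <= n)%nat ->
     sum_f_R0 (fun k => f k (n - k)%nat) k = G (S k) (n - k)%nat - G 0%nat (S n)).
  { induction k as [|k IH]; intros Hk.
    - simpl. rewrite H by lia. now replace (S (n - 0)) with (S n) by lia.
    - rewrite tech5, IH by lia. rewrite H by lia.
      replace (S (n - S k)) with (n - k)%nat by lia. ring. }
  rewrite Hk by lia. now rewrite Nat.sub_diag.
Qed.

Lemma conv_last (f : nat -> nat -> R) (n : nat) :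
  sum_f_R0 (fun k => f k (S n - k)%nat) (S n) =
  sum_f_R0 (fun k => f k (S (n - k))) n + f (S n) 0%nat.
Proof.
  rewrite tech5. f_equal.
  - apply sum_eq. intros k Hk. f_equal. lia.
  - f_equal. lia.
Qed.

(** The Taylor coefficients of (1 - t)^(-1/2), that is, the central binomial coefficients over
    4^n. *)
Fixpoint invsqrtc (n : nat) : R :=
  match n with
  | O => 1
  | S m => invsqrtc m * ((2 * INR m + 1) / (2 * INR m + 2))
  end.

Lemma invsqrtc_gt0 n : 0 < invsqrtc n.
Proof.
  induction n as [|n IH]; simpl; [lra|].
  apply Rmult_lt_0_compat; [exact IH|].
  generalize (pos_INR n); intros. apply Rdiv_lt_0_compat; lra.
Qed.

Lemma invsqrtc_decr n : invsqrtc (S n) <= invsqrtc n.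
Proof.
  simpl. generalize (pos_INR n) (invsqrtc_gt0 n); intros.
  rewrite <- (Rmult_1_r (invsqrtc n)) at 2.
  apply Rmult_le_compat_l; [lra|].
  apply Rmult_le_reg_r with (2 * INR n + 2); [lra|]. field_simplify; lra.
Qed.

Lemma invsqrtc_le1 n : invsqrtc n <= 1.
Proof. induction n; [simpl; lra|]. generalize (invsqrtc_decr n); lra. Qed.

Lemma invsqrtc_sq_le n : invsqrtc n ^ 2 <= / (2 * INR n + 1).
Proof.
  induction n as [|n IH]; [simpl; lra|].
  rewrite S_INR. simpl invsqrtc. generalize (pos_INR n); intros.
  rewrite Rpow_mult_distr.
  apply Rle_trans with (/ (2 * INR n + 1) * ((2 * INR n + 1) / (2 * INR n + 2)) ^ 2).
  - apply Rmult_le_compat_r; [apply pow2_ge_0|exact IH].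
  - apply Rmult_le_reg_r with ((2 * INR n + 2)^2 * (2 * (INR n + 1) + 1)); [nra|].
    field_simplify; [nra|lra|lra].
Qed.

(** The square of (1 - t)^(-1/2) is the geometric series. *)
Lemma invsqrtc_conv n : sum_f_R0 (fun k => invsqrtc k * invsqrtc (n - k)) n = 1.
Proof.
  induction n as [|n IH]; [simpl; lra|].
  rewrite (conv_last (fun i j => invsqrtc i * invsqrtc j)).
  set (G := fun i j => - INR i / (INR n + 1) * (invsqrtc i * invsqrtc j)).
  assert (H : sum_f_R0 (fun k => invsqrtc k * invsqrtc (S (n - k)) - invsqrtc k * invsqrtc (n - k)) n
      = G (S n) 0%nat - G 0%nat (S n)).
  { apply (conv_telescope (fun i j => invsqrtc i * invsqrtc (S j) - invsqrtc i * invsqrtc j) G).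
    intros i j Hij. unfold G. rewrite <- Hij, plus_INR, S_INR. simpl invsqrtc.
    generalize (pos_INR i) (pos_INR j); intros. field. lra. }
  rewrite minus_sum, IH in H. unfold G in H.
  rewrite S_INR in H. change (INR 0) with 0 in H.
  generalize (pos_INR n); intros.
  replace (- (INR n + 1) / (INR n + 1)) with (-1) in H by (field; lra).
  unfold Rdiv in H. lra.
Qed.

(** The Taylor coefficients of (1 - t)^(1/2) = (1 - t) (1 - t)^(-1/2). *)
Definition sqrtc (n : nat) : R :=
  match n with O => 1 | S m => invsqrtc (S m) - invsqrtc m end.

Lemma sqrtc_S n : sqrtc (S n) = - (invsqrtc n / (2 * INR n + 2)).
Proof. simpl. generalize (pos_INR n); intros. field. lra. Qed.

Lemma sqrtc_le0 n : sqrtc (S n) <= 0.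
Proof. simpl sqrtc. generalize (invsqrtc_decr n); simpl; lra. Qed.

Lemma sqrtc_conv n :
  sum_f_R0 (fun k => sqrtc k * sqrtc (n - k)) n =
  match n with 0%nat => 1 | 1%nat => -1 | _ => 0 end.
Proof.
  (* The product of sqrt (1 - t) and its inverse is 1. *)
  assert (Hsb : forall n, sum_f_R0 (fun k => sqrtc k * invsqrtc (n - k)) n
      = match n with O => 1 | _ => 0 end).
  { intros [|m]; [simpl; lra|].
    rewrite decomp_sum by lia. simpl pred.
    assert (E : sum_f_R0 (fun i => sqrtc (S i) * invsqrtc (S m - S i)) m =
       sum_f_R0 (fun i => invsqrtc (S i) * invsqrtc (S m - S i)) m
       - sum_f_R0 (fun i => invsqrtc i * invsqrtc (m - i)) m).
    { rewrite <- minus_sum. apply sum_eq. intros i Hi.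
      replace (S m - S i)%nat with (m - i)%nat by lia. simpl. ring. }
    rewrite E, invsqrtc_conv.
    generalize (invsqrtc_conv (S m)). rewrite decomp_sum by lia. simpl pred.
    simpl (invsqrtc 0). simpl (sqrtc 0). simpl (S m - 0)%nat. intros; lra. }
  destruct n as [|m]; [simpl; lra|].
  rewrite (conv_last (fun i j => sqrtc i * sqrtc j)).
  assert (E : sum_f_R0 (fun k => sqrtc k * sqrtc (S (m - k))) m =
     sum_f_R0 (fun k => sqrtc k * invsqrtc (S (m - k))) m
     - sum_f_R0 (fun k => sqrtc k * invsqrtc (m - k)) m).
  { rewrite <- minus_sum. apply sum_eq. intros i Hi. simpl. ring. }
  rewrite E, Hsb.
  generalize (Hsb (S m)). rewrite (conv_last (fun i j => sqrtc i * invsqrtc j)).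
  simpl (sqrtc 0). simpl (invsqrtc 0). intros H.
  destruct m as [|m]; lra.
Qed.

(** The coefficients ((1/4)_n / n!)^2 of the hypergeometric series F(1/4, 1/4; 1; t). *)
Fixpoint quarterc (n : nat) : R :=
  match n with
  | O => 1
  | S m => quarterc m * ((4 * INR m + 1) / (4 * INR m + 4)) ^ 2
  end.

Lemma quarterc_gt0 n : 0 < quarterc n.
Proof.
  induction n as [|n IH]; simpl; [lra|].
  generalize (pos_INR n); intros.
  assert (0 < (4 * INR n + 1) / (4 * INR n + 4)) by (apply Rdiv_lt_0_compat; lra).
  apply Rmult_lt_0_compat; [exact IH|nra].
Qed.

(** Clausen: the square of F(1/4, 1/4; 1; t) is a hypergeometric 3F2. The certificate [G] shows
    that the convolutions satisfy the first-order recurrence of the cubes. *)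
Lemma quarterc_conv n :
  sum_f_R0 (fun k => quarterc k * quarterc (n - k)) n = invsqrtc n ^ 3.
Proof.
  induction n as [|n IH]; [simpl; lra|].
  rewrite (conv_last (fun i j => quarterc i * quarterc j)).
  set (G := fun i j => INR i ^ 2 * (2 * INR i - 3 * (INR n + 1)) * (quarterc i * quarterc j)).
  assert (H : sum_f_R0 (fun k => (INR n + 1) ^ 3 * (quarterc k * quarterc (S (n - k)))
         - (INR n + 1/2) ^ 3 * (quarterc k * quarterc (n - k))) n
      = G (S n) 0%nat - G 0%nat (S n)).
  { apply (conv_telescope (fun i j => (INR n + 1) ^ 3 * (quarterc i * quarterc (S j))
         - (INR n + 1/2) ^ 3 * (quarterc i * quarterc j)) G).
    intros i j Hij. unfold G. rewrite <- Hij, plus_INR, S_INR. simpl quarterc.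
    generalize (pos_INR i) (pos_INR j); intros. field. lra. }
  rewrite minus_sum, !sum_scal_l in H.
  rewrite IH in H. unfold G in H. rewrite S_INR in H. change (INR 0) with 0 in H.
  change (quarterc 0) with 1 in *. change (invsqrtc (S n)) with (invsqrtc n * ((2 * INR n + 1) / (2 * INR n + 2))).
  generalize (pos_INR n); intros.
  apply Rmult_eq_reg_l with ((INR n + 1) ^ 3); [|apply pow_nonzero; lra].
  set (X := sum_f_R0 _ n) in *.
  transitivity ((INR n + 1 / 2) ^ 3 * invsqrtc n ^ 3); [lra|].
  field. lra.
Qed.

(** * Ballot numbers *)

Lemma conv_first (f : nat -> nat -> R) (n : nat) :
  sum_f_R0 (fun k => f k (S n - k)%nat) (S n) =
  f 0%nat (S n) + sum_f_R0 (fun k => f (S k) (n - k)%nat) n.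
Proof. rewrite decomp_sum by lia. reflexivity. Qed.

(** With m = (1 - sqrt (1 - t)) / 2, the power m^(l+1) is the sum over N of [ballot N l]
    t^(N+1): the ballot numbers over 4^(N+1). The recursion on [l] makes them vanish for N < l
    without any truncated subtraction. *)
Fixpoint ballot (N l : nat) : R :=
  match l with
  | O => invsqrtc N / (4 * INR N + 4)
  | S m => ballot N m *
     ((INR m + 2) * (INR N - INR m) / ((INR m + 1) * (2 * INR N - INR m)))
  end.

Lemma ballot_out N l : (N < l)%nat -> ballot N l = 0.
Proof.
  induction l as [|l IH]; [lia|]. intros H. simpl.
  destruct (Nat.eq_dec l N) as [->|Hne].
  - unfold Rdiv. ring.
  - rewrite IH by lia. ring.
Qed.

Lemma ballot_ge0 N l : 0 <= ballot N l.
Proof.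
  destruct (Nat.le_gt_cases l N) as [Hl|Hl]; [|rewrite ballot_out by lia; lra].
  induction l as [|l IH].
  - simpl. generalize (pos_INR N) (invsqrtc_gt0 N); intros.
    apply Rlt_le, Rdiv_lt_0_compat; lra.
  - simpl. apply Rmult_le_pos; [apply IH; lia|].
    assert (H := Hl). apply le_INR in H. rewrite S_INR in H.
    generalize (pos_INR l); intros.
    apply Rmult_le_pos; [nra|]. apply Rlt_le, Rinv_0_lt_compat. nra.
Qed.

Lemma ballot_S N l : (l <= N)%nat ->
  ballot (S N) l * (4 * (INR N + 2) * (INR N + 1 - INR l)) =
  ballot N l * ((2 * INR N + 1 - INR l) * (2 * INR N + 2 - INR l)).
Proof.
  induction l as [|l IH]; intros Hl.
  - cbn [ballot invsqrtc]. rewrite S_INR. change (INR 0) with 0.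
    generalize (pos_INR N); intros. field. lra.
  - cbn [ballot]. specialize (IH ltac:(lia)).
    assert (H := Hl). apply le_INR in H. rewrite S_INR in H. rewrite !S_INR.
    generalize (pos_INR l); intros.
    apply Rmult_eq_reg_r with ((2 * INR N + 1 - INR l) * (INR N + 1 - INR l));
      [|apply Rmult_integral_contrapositive_currified; lra].
    transitivity ((ballot (S N) l * (4 * (INR N + 2) * (INR N + 1 - INR l)))
       * ((INR l + 2) / (INR l + 1) * (INR N - INR l) * (2 * INR N + 1 - INR l)
          / (2 * INR N + 2 - INR l) * (INR N + 1 - INR l))).
    { field. lra. }
    rewrite IH. field. lra.
Qed.

(** This is m^2 = m - t/4 read off coefficientwise. *)
Lemma ballot_rec N l :
  ballot (S N) (S (S l)) = ballot (S N) (S l) - ballot N l / 4.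
Proof.
  destruct (Nat.le_gt_cases l N) as [Hl|Hl].
  2:{ rewrite !ballot_out by lia. lra. }
  generalize (ballot_S N l Hl). cbn [ballot].
  assert (H := Hl). apply le_INR in H. rewrite !S_INR.
  generalize (pos_INR l); intros Hp E.
  apply Rmult_eq_reg_r with ((2 * INR N + 1 - INR l) * (2 * INR N + 2 - INR l));
      [|apply Rmult_integral_contrapositive_currified; lra].
  transitivity (ballot (S N) l * ((INR l + 2) * (INR N + 1 - INR l) / (INR l + 1))
    * ((INR l + 3) * (INR N - INR l) / (INR l + 2)) ).
  { field. lra. }
  transitivity (ballot (S N) l * ((INR l + 2) * (INR N + 1 - INR l) / (INR l + 1))
      * (2 * INR N + 1 - INR l)
    - ballot (S N) l * (4 * (INR N + 2) * (INR N + 1 - INR l)) / 4).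
  { field. lra. }
  rewrite E. field. lra.
Qed.

Lemma ballot_rec0 N : ballot N 1 = ballot N 0 - match N with O => 1 / 4 | _ => 0 end.
Proof.
  cbn [ballot]. destruct N as [|N]; [simpl; lra|].
  rewrite S_INR. change (INR 0) with 0. generalize (pos_INR N); intros. field. lra.
Qed.

(** The quadratic transformation F(1/2, 1/2; 1; m) = F(1/4, 1/4; 1; 4m(1 - m)) read off
    coefficientwise; [G] is its Zeilberger certificate. *)
Lemma ballot_sum N :
  sum_f_R0 (fun l => invsqrtc (S l) ^ 2 * ballot N l) N = quarterc (S N).
Proof.
  induction N as [|N IH]; [simpl; lra|].
  set (G := fun l => - (INR N + 2) * (INR l + 1) * INR l / (2 * INR N + 2 - INR l)
     * (invsqrtc (S l) ^ 2 * ballot (S N) l)).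
  assert (H : sum_f_R0 (fun l => (INR N + 2) ^ 2 * (invsqrtc (S l) ^ 2 * ballot (S N) l)
         - (INR N + 5 / 4) ^ 2 * (invsqrtc (S l) ^ 2 * ballot N l)) N
      = G (S N) - G 0%nat).
  { apply sum_telescope_le. intros l Hl. unfold G.
    generalize (ballot_S N l Hl); intros E. cbn [ballot].
    change (invsqrtc (S (S l))) with (invsqrtc (S l) * ((2 * INR (S l) + 1) / (2 * INR (S l) + 2))).
    generalize (pos_INR l) (le_INR _ _ Hl); intros. rewrite !S_INR.
    assert (E' : ballot N l = ballot (S N) l * (4 * (INR N + 2) * (INR N + 1 - INR l))
       / ((2 * INR N + 1 - INR l) * (2 * INR N + 2 - INR l))).
    { rewrite E. field. lra. }
    rewrite E'. generalize (ballot (S N) l) (invsqrtc (S l)). intros. field. lra. }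
  rewrite minus_sum, !sum_scal_l, IH in H. rewrite tech5.
  generalize (pos_INR N); intros.
  change (quarterc (S (S N))) with
    (quarterc (S N) * ((4 * INR (S N) + 1) / (4 * INR (S N) + 4)) ^ 2).
  apply Rmult_eq_reg_l with ((INR N + 2) ^ 2); [|apply pow_nonzero; lra].
  rewrite Rmult_plus_distr_l.
  assert (HG : G (S N) = - ((INR N + 2) ^ 2 * (invsqrtc (S (S N)) ^ 2 * ballot (S N) (S N)))).
  { unfold G. rewrite S_INR. field. lra. }
  assert (HG0 : G 0%nat = 0).
  { unfold G. change (INR 0) with 0. unfold Rdiv; ring. }
  rewrite S_INR.
  transitivity ((INR N + 5 / 4) ^ 2 * quarterc (S N)); [lra|]. field. lra.
Qed.

(** * Legendre polynomials: coefficients and hypergeometric sums *)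

(** Coefficients of the Legendre polynomials of even degree, P_2n(u) being the sum of [leg_evenc
    n j] u^(2j), and of odd degree, where P_(2n+1)(u) is u times a polynomial in u^2. The
    recursion on [j] is the Legendre equation; it makes the coefficients vanish for j > n. *)
Fixpoint leg_evenc (n j : nat) : R :=
  match j with
  | O => (-1) ^ n * invsqrtc n
  | S i => leg_evenc n i * - ((2 * INR n + 2 * INR i + 1) * (INR n - INR i)
                        / ((INR i + 1) * (2 * INR i + 1)))
  end.
Fixpoint leg_oddc (n j : nat) : R :=
  match j with
  | O => (-1) ^ n * invsqrtc n * (2 * INR n + 1)
  | S i => leg_oddc n i * - ((2 * INR n + 2 * INR i + 3) * (INR n - INR i)
                        / ((INR i + 1) * (2 * INR i + 3)))
  end.

Lemma leg_evenc_out n j : (n < j)%nat -> leg_evenc n j = 0.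
Proof.
  induction j as [|j IH]; [lia|]. intros H. cbn [leg_evenc].
  destruct (Nat.eq_dec j n) as [->|Hne]; [unfold Rdiv; ring|].
  rewrite IH by lia. ring.
Qed.
Lemma leg_oddc_leg_evenc n j : leg_oddc n j * (2 * INR j + 1) = leg_evenc n j * (2 * INR n + 2 * INR j + 1).
Proof.
  induction j as [|j IH]; [simpl; ring|].
  cbn [leg_evenc leg_oddc]. rewrite S_INR. generalize (pos_INR j) (pos_INR n); intros.
  apply Rmult_eq_reg_r with (2 * INR j + 1); [|lra].
  transitivity ((leg_oddc n j * (2 * INR j + 1)) * - ((2 * INR n + 2 * INR j + 3) * (INR n - INR j)
                        / ((INR j + 1) ))).
  { field; lra. }
  rewrite IH. field. lra.
Qed.
Lemma leg_oddc_out n j : (n < j)%nat -> leg_oddc n j = 0.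
Proof.
  intros H. generalize (leg_oddc_leg_evenc n j) (pos_INR j). rewrite leg_evenc_out by lia. intros.
  apply Rmult_eq_reg_r with (2 * INR j + 1); lra.
Qed.
(** Together with [leg_oddc_leg_evenc], this expresses all neighbours by one coefficient, so
    that recurrences and certificates reduce to rational identities. *)
Lemma leg_evenc_S n j : leg_evenc (S n) j * (2 * (INR n + 1 - INR j)) = - leg_evenc n j * (2 * INR n + 2 * INR j + 1).
Proof.
  induction j as [|j IH].
  - simpl leg_evenc. change (INR 0) with 0. generalize (pos_INR n); intros. field. lra.
  - cbn [leg_evenc]. rewrite !S_INR. generalize (pos_INR j) (pos_INR n); intros.
    transitivity ((leg_evenc (S n) j * (2 * (INR n + 1 - INR j))) *
       - ((2 * INR n + 2 * INR j + 3) * (INR n - INR j)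
                        / ((INR j + 1) * (2 * INR j + 1)))).
    { field. lra. }
    rewrite IH. field. lra.
Qed.
Lemma leg_oddc_leg_evenc_S n j : leg_oddc n j * (2 * INR j + 1) = - 2 * (INR n + 1 - INR j) * leg_evenc (S n) j.
Proof. rewrite leg_oddc_leg_evenc. generalize (leg_evenc_S n j). lra. Qed.

Lemma leg_oddc_rec n j :
  (2 * INR n + 3) * leg_oddc (S n) j = (4 * INR n + 5) * leg_evenc (S n) j - (2 * INR n + 2) * leg_oddc n j.
Proof.
  generalize (pos_INR j) (pos_INR n); intros.
  apply Rmult_eq_reg_r with (2 * INR j + 1); [|lra].
  transitivity ((2 * INR n + 3) * (leg_oddc (S n) j * (2 * INR j + 1))); [ring|].
  rewrite leg_oddc_leg_evenc, S_INR.
  transitivity ((4 * INR n + 5) * leg_evenc (S n) j * (2 * INR j + 1)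
     - (2 * INR n + 2) * (leg_oddc n j * (2 * INR j + 1))); [|ring].
  rewrite leg_oddc_leg_evenc_S. ring.
Qed.

Lemma leg_evenc_rec n j :
  (2 * INR n + 2) * leg_evenc (S n) (S j) = (4 * INR n + 3) * leg_oddc n j - (2 * INR n + 1) * leg_evenc n (S j).
Proof.
  generalize (pos_INR j) (pos_INR n); intros.
  cbn [leg_evenc]. rewrite S_INR.
  apply Rmult_eq_reg_r with ((2 * INR j + 1) * (INR j + 1)); [|nra].
  transitivity (- (INR n + 1) * (2 * INR n + 2 * INR j + 3) * (leg_evenc (S n) j * (2 * (INR n + 1 - INR j)))).
  { field. lra. }
  rewrite leg_evenc_S.
  transitivity ((4 * INR n + 3) * (INR j + 1) * (leg_oddc n j * (2 * INR j + 1)) +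
    (2 * INR n + 1) * leg_evenc n j * ((2 * INR n + 2 * INR j + 1) * (INR n - INR j))).
  { rewrite leg_oddc_leg_evenc. ring. }
  field. lra.
Qed.

Lemma leg_evenc_rec0 n : (2 * INR n + 2) * leg_evenc (S n) 0 = - (2 * INR n + 1) * leg_evenc n 0.
Proof. simpl. generalize (pos_INR n); intros. field. lra. Qed.

Definition leg_even n t := sum_f_R0 (fun j => leg_evenc n j * t ^ j) n.
Definition leg_odd n t := sum_f_R0 (fun j => leg_oddc n j * t ^ j) n.

Lemma leg_odd_rec n t :
  (2 * INR n + 3) * leg_odd (S n) t = (4 * INR n + 5) * leg_even (S n) t - (2 * INR n + 2) * leg_odd n t.
Proof.
  unfold leg_odd, leg_even.
  replace (sum_f_R0 (fun j => leg_oddc n j * t ^ j) n) with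
    (sum_f_R0 (fun j => leg_oddc n j * t ^ j) (S n)) by (rewrite tech5, leg_oddc_out by lia; ring).
  rewrite <- !sum_scal_l, <- minus_sum. apply sum_eq. intros j _.
  rewrite <- !Rmult_assoc, leg_oddc_rec. ring.
Qed.

Lemma leg_even_rec n t :
  (2 * INR n + 2) * leg_even (S n) t = (4 * INR n + 3) * (t * leg_odd n t) - (2 * INR n + 1) * leg_even n t.
Proof.
  unfold leg_odd, leg_even.
  replace (sum_f_R0 (fun j => leg_evenc n j * t ^ j) n) with
    (sum_f_R0 (fun j => leg_evenc n j * t ^ j) (S n)) by (rewrite tech5, leg_evenc_out by lia; ring).
  rewrite (decomp_sum (fun j => leg_evenc (S n) j * t ^ j)) by lia.
  rewrite (decomp_sum (fun j => leg_evenc n j * t ^ j) (S n)) by lia. cbn [pred].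
  assert (E : (2 * INR n + 2) * sum_f_R0 (fun j => leg_evenc (S n) (S j) * t ^ S j) n =
    (4 * INR n + 3) * (t * sum_f_R0 (fun j => leg_oddc n j * t ^ j) n)
    - (2 * INR n + 1) * sum_f_R0 (fun j => leg_evenc n (S j) * t ^ S j) n).
  { rewrite <- !sum_scal_l, <- minus_sum. apply sum_eq. intros j _.
    rewrite <- Rmult_assoc, leg_evenc_rec. simpl. ring. }
  rewrite Rmult_plus_distr_l, E, <- Rmult_assoc, leg_evenc_rec0. ring.
Qed.

(** Replacing u^2 by the product of two independent arcsine variables multiplies the coefficient
    of u^(2j) by [invsqrtc j ^ 2]. The average of P_2n is then (-1)^n times a cube: Zeilberger,
    with certificate [G]. *)
Lemma leg_evenc_invsqrtc_sum n :
  sum_f_R0 (fun j => leg_evenc n j * invsqrtc j ^ 2) n = (-1) ^ n * invsqrtc n ^ 3.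
Proof.
  induction n as [|n IH]; [simpl; lra|].
  generalize (pos_INR n); intros Hn.
  set (G := fun j => - 8 * (4 * INR n + 3) * INR j ^ 3 / (2 * INR n + 2 * INR j + 1)
     * (leg_evenc (S n) j * invsqrtc j ^ 2)).
  assert (H : sum_f_R0 (fun j => 8 * (INR n + 1) ^ 3 * (leg_evenc (S n) j * invsqrtc j ^ 2)
        + (2 * INR n + 1) ^ 3 * (leg_evenc n j * invsqrtc j ^ 2)) (S n) = G (S (S n)) - G 0%nat).
  { apply sum_telescope. intros j. unfold G. generalize (leg_evenc_S n j); intros E.
    generalize (pos_INR j); intros.
    assert (E' : leg_evenc n j = leg_evenc (S n) j * - (2 * (INR n + 1 - INR j)) / (2 * INR n + 2 * INR j + 1)).
    { apply Rmult_eq_reg_r with (2 * INR n + 2 * INR j + 1); [|lra].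
      transitivity (- (leg_evenc (S n) j * (2 * (INR n + 1 - INR j)))); [lra|]. field. lra. }
    rewrite E'. cbn [leg_evenc invsqrtc]. rewrite !S_INR. field. lra. }
  rewrite plus_sum, !sum_scal_l in H. unfold G in H.
  rewrite (leg_evenc_out (S n) (S (S n))) in H by lia.
  rewrite (tech5 (fun j => leg_evenc n j * invsqrtc j ^ 2)), (leg_evenc_out n (S n)), IH in H by lia.
  change (INR 0) with 0 in H.
  apply Rmult_eq_reg_l with (8 * (INR n + 1) ^ 3); [|apply Rmult_integral_contrapositive_currified; [lra|apply pow_nonzero; lra]].
  transitivity (- (2 * INR n + 1) ^ 3 * ((-1) ^ n * invsqrtc n ^ 3)).
  { unfold Rdiv in H. rewrite !Rmult_0_l, Rmult_0_r in H.
    replace (0 ^ 3) with 0 in H by ring. lra. }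
  cbn [invsqrtc]. simpl ((-1) ^ S n). field. lra.
Qed.

(** The integral of (1 - k^2)^n over [0, 1]. *)
Fixpoint wallis_odd (n : nat) : R :=
  match n with O => 1 | S m => wallis_odd m * ((2 * INR m + 2) / (2 * INR m + 3)) end.

(** The integral of P_(2n+2) over [0, 1] vanishes. *)
Lemma leg_evenc_sum1 n : sum_f_R0 (fun j => leg_evenc (S n) j / (2 * INR j + 1)) (S n) = 0.
Proof.
  generalize (pos_INR n); intros Hn.
  set (G := fun j => - (2 * INR j) * leg_evenc (S n) j).
  assert (H : sum_f_R0 (fun j => (2 * INR n + 2) * (2 * INR n + 3) * (leg_evenc (S n) j / (2 * INR j + 1))) (S n)
     = G (S (S n)) - G 0%nat).
  { apply sum_telescope. intros j. unfold G. cbn [leg_evenc]. rewrite !S_INR.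
    generalize (pos_INR j); intros. field. lra. }
  rewrite sum_scal_l in H. unfold G in H. rewrite leg_evenc_out in H by lia.
  change (INR 0) with 0 in H.
  apply Rmult_eq_reg_l with ((2 * INR n + 2) * (2 * INR n + 3)); [lra|nra].
Qed.

(** P_(2n+4) is orthogonal to u^2; the certificate combines this with the previous sum. *)
Lemma leg_evenc_sum3 n : sum_f_R0 (fun j => leg_evenc (S (S n)) j / (2 * INR j + 3)) (S (S n)) = 0.
Proof.
  generalize (pos_INR n); intros Hn.
  set (G := fun j => - (2 * INR j) * (2 * INR j - 1) / (2 * INR j + 1) * leg_evenc (S (S n)) j).
  assert (H : sum_f_R0 (fun j => (2 * INR n + 2) * (2 * INR n + 7) * (leg_evenc (S (S n)) j / (2 * INR j + 3))
     + 2 * (leg_evenc (S (S n)) j / (2 * INR j + 1))) (S (S n))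
     = G (S (S (S n))) - G 0%nat).
  { apply sum_telescope. intros j. unfold G. cbn [leg_evenc]. rewrite !S_INR.
    generalize (pos_INR j); intros. field. lra. }
  rewrite plus_sum, !sum_scal_l, leg_evenc_sum1 in H. unfold G in H. rewrite leg_evenc_out in H by lia.
  change (INR 0) with 0 in H.
  apply Rmult_eq_reg_l with ((2 * INR n + 2) * (2 * INR n + 7)); [|nra].
  unfold Rdiv in *. lra.
Qed.

(** Up to sign, the integral of P_(2n+2)(u) ln u over [0, 1]. *)
Lemma leg_evenc_sum_sq n :
  sum_f_R0 (fun j => leg_evenc (S n) j / (2 * INR j + 1) ^ 2) (S n) = (-1) ^ S n * (wallis_odd n - wallis_odd (S n)).
Proof.
  induction n as [|n IH]; [simpl; field; lra|].
  generalize (pos_INR n); intros Hn.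
  (* Gosper summation in [j] yields the linear factor of the certificate, here with N = n + 1. *)
  set (N := INR n + 1).
  set (G := fun j => INR j * (INR j - (2 * N ^ 2 + 3 * N + 2) / 2)
      * ((4 * N + 3) / ((N + 1) * (2 * N + 1) * N * (2 * N + 3) / 2))
      * (leg_evenc (S (S n)) j / (2 * N + 2 * INR j + 1))).
  assert (H : sum_f_R0 (fun j => (2 * N + 3) * (leg_evenc (S (S n)) j / (2 * INR j + 1) ^ 2)
     + 2 * N * (leg_evenc (S n) j / (2 * INR j + 1) ^ 2)) (S (S n))
     = G (S (S (S n))) - G 0%nat).
  { apply sum_telescope. intros j. unfold G. generalize (leg_evenc_S (S n) j); intros E.
    generalize (pos_INR j); intros. rewrite S_INR in E. fold N in E.
    assert (HN : 0 < N) by (unfold N; lra).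
    assert (E' : leg_evenc (S n) j = leg_evenc (S (S n)) j * - (2 * (N + 1 - INR j)) / (2 * N + 2 * INR j + 1)).
    { apply Rmult_eq_reg_r with (2 * N + 2 * INR j + 1); [|lra].
      transitivity (- (leg_evenc (S (S n)) j * (2 * (N + 1 - INR j)))); [lra|]. field. lra. }
    rewrite E'. cbn [leg_evenc]. rewrite !S_INR. fold N. field. lra. }
  rewrite plus_sum, !sum_scal_l in H. unfold G in H.
  rewrite (leg_evenc_out (S (S n)) (S (S (S n)))) in H by lia.
  rewrite (tech5 (fun j => leg_evenc (S n) j / _)), (leg_evenc_out (S n) (S (S n))), IH in H by lia.
  change (INR 0) with 0 in H.
  apply Rmult_eq_reg_l with (2 * N + 3); [|unfold N; lra].
  transitivity (- (2 * N) * ((-1) ^ S n * (wallis_odd n - wallis_odd (S n)))).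
  { unfold Rdiv in *. rewrite ?Rmult_0_l, ?Rmult_0_r in H. lra. }
  cbn [wallis_odd]. rewrite !S_INR. unfold N. simpl ((-1) ^ _). field. lra.
Qed.

(** The integral of the twice averaged P_2n against E(sqrt (1 - x)), see [ellE_leg_avg]. *)
Definition leg_moment (n : nat) : R :=
  match n with
  | 0%nat => 4 / 3
  | 1%nat => - 2 / 5
  | S m => (-1) ^ n * (wallis_odd m - wallis_odd n)
  end.

(** In partial fractions, 4(j+1)/((2j+1)^2 (2j+3)) = 1/(2j+1)^2 + 1/(2(2j+1)) - 1/(2(2j+3)), and
    the three sums are known. *)
Lemma leg_evenc_moment_sum n :
  sum_f_R0 (fun j => leg_evenc n j * (4 * (INR j + 1) / ((2 * INR j + 1) ^ 2 * (2 * INR j + 3)))) n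
  = leg_moment n.
Proof.
  destruct n as [|[|n]]; [simpl; field|simpl; field|].
  rewrite (sum_eq _ (fun j => leg_evenc (S (S n)) j / (2 * INR j + 1) ^ 2
     + 1/2 * (leg_evenc (S (S n)) j / (2 * INR j + 1)) - 1/2 * (leg_evenc (S (S n)) j / (2 * INR j + 3)))).
  2:{ intros j _. generalize (pos_INR j); intros. field. lra. }
  rewrite minus_sum, plus_sum, !sum_scal_l, leg_evenc_sum1, leg_evenc_sum3, leg_evenc_sum_sq.
  unfold leg_moment. ring.
Qed.

(** * Legendre polynomials as cosine sums *)

(** The polynomial P_n (cos th), as the coefficient of v^n in (1 - v exp(i th))^(-1/2) (1 - v
    exp(-i th))^(-1/2). *)
Definition leg_cos (n : nat) (th : R) : R :=
  sum_f_R0 (fun k => invsqrtc k * invsqrtc (n - k) * cos ((INR k - INR (n - k)) * th)) n.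

(** With [d] the coefficients of t (1 - t)^(-1/2), all four sums range over the same pairs (i,
    j), and the recurrence then holds term by term. *)
Lemma leg_cos_rec n th :
  (INR n + 2) * leg_cos (S (S n)) th =
  (2 * INR n + 3) * (cos th * leg_cos (S n) th) - (INR n + 1) * leg_cos n th.
Proof.
  set (d := fun i => invsqrtc i * (2 * INR i / (2 * INR i - 1))).
  assert (dS : forall i, d (S i) = invsqrtc i).
  { intros i. unfold d. cbn [invsqrtc]. rewrite S_INR. generalize (pos_INR i); intros. field. lra. }
  assert (d0 : d 0%nat = 0) by (unfold d; simpl; unfold Rdiv; ring).
  set (Cn := fun i j => cos ((INR i - INR j) * th)).
  assert (H0 : leg_cos (S (S n)) th = sum_f_R0 (fun k => (fun i j => invsqrtc i * invsqrtc j * Cn i j) k (S (S n) - k)%nat) (S (S n)))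
    by reflexivity.
  assert (H1 : cos th * leg_cos (S n) th =
    / 2 * (sum_f_R0 (fun k => (fun i j => d i * invsqrtc j * Cn i j) k (S (S n) - k)%nat) (S (S n))
    + sum_f_R0 (fun k => (fun i j => invsqrtc i * d j * Cn i j) k (S (S n) - k)%nat) (S (S n)))).
  { rewrite (conv_first (fun i j => d i * invsqrtc j * Cn i j)).
    rewrite (conv_last (fun i j => invsqrtc i * d j * Cn i j)). rewrite d0.
    unfold leg_cos.
    rewrite <- sum_scal_l.
    match goal with |- _ = / 2 * (0 * _ * _ + ?A + (?B + _)) =>
      transitivity (/2 * (A + B)); [|ring] end.
    rewrite <- plus_sum, <- sum_scal_l. apply sum_eq. intros k Hk.
    rewrite !dS. unfold Cn. rewrite !S_INR.
    replace ((INR k + 1 - INR (S n - k)) * th) with ((INR k - INR (S n - k)) * th + th) by ring.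
    replace ((INR k - (INR (S n - k) + 1)) * th) with ((INR k - INR (S n - k)) * th - th) by ring.
    rewrite cos_plus, cos_minus. field. }
  assert (H2 : leg_cos n th =
    sum_f_R0 (fun k => (fun i j => d i * d j * Cn i j) k (S (S n) - k)%nat) (S (S n))).
  { rewrite (conv_first (fun i j => d i * d j * Cn i j)).
    rewrite (conv_last (fun i j => d (S i) * d j * Cn (S i) j)). rewrite d0.
    unfold leg_cos.
    match goal with |- _ = 0 * _ * _ + (?A + _) => transitivity A; [|ring] end.
    apply sum_eq. intros k Hk. rewrite !dS. unfold Cn. rewrite !S_INR.
    f_equal. f_equal. ring. }
  rewrite H0, H1, H2. rewrite <- plus_sum, <- !sum_scal_l, <- minus_sum.
  apply sum_eq. intros k Hk.
  assert (E : INR (S (S n) - k) = INR n + 2 - INR k).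
  { rewrite minus_INR by lia. rewrite !S_INR. ring. }
  unfold d. rewrite !E.
  assert (forall m, 2 * INR m - 1 <> 0).
  { intros [|m]; [simpl; lra|]. rewrite S_INR. generalize (pos_INR m). lra. }
  generalize (H k) (H (S (S n) - k)%nat). rewrite E. intros. field. split; lra.
Qed.

Lemma leg_cos_legendre n th :
  leg_cos (2 * n) th = leg_even n (cos th ^ 2) /\
  leg_cos (2 * n + 1) th = cos th * leg_odd n (cos th ^ 2).
Proof.
  induction n as [|n [IH1 IH2]].
  - split; unfold leg_cos, leg_even, leg_odd; simpl.
    + replace ((0 - 0) * th) with 0 by ring. rewrite cos_0. ring.
    + replace ((1 - 0) * th) with th by ring. replace ((0 - 1) * th) with (- th) by ring.
      rewrite cos_neg. field.
  - assert (E1 : leg_cos (2 * S n) th = leg_even (S n) (cos th ^ 2)).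
    { generalize (leg_cos_rec (2 * n) th).
      replace (S (S (2 * n))) with (2 * S n)%nat by lia.
      replace (S (2 * n)) with (2 * n + 1)%nat by lia.
      rewrite IH1, IH2, mult_INR. change (INR 2) with 2. intros E.
      generalize (leg_even_rec n (cos th ^ 2)) (pos_INR n); intros E' Hn.
      apply Rmult_eq_reg_l with (2 * INR n + 2); [|lra].
      rewrite E', E. ring. }
    split; [exact E1|].
    generalize (leg_cos_rec (2 * n + 1) th).
    replace (S (S (2 * n + 1))) with (2 * S n + 1)%nat by lia.
    replace (S (2 * n + 1)) with (2 * S n)%nat by lia.
    rewrite E1, IH2, plus_INR, mult_INR. change (INR 2) with 2. change (INR 1) with 1. intros E.
    generalize (leg_odd_rec n (cos th ^ 2)) (pos_INR n); intros E' Hn.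
    apply Rmult_eq_reg_l with (2 * INR n + 3); [|lra].
    transitivity (cos th * ((2 * INR n + 3) * leg_odd (S n) (cos th ^ 2))); [|ring].
    rewrite E'. lra.
Qed.

(** The coefficients of the cosine sum are positive and add up to 1. *)
Lemma leg_cos_bound n th : Rabs (leg_cos n th) <= 1.
Proof.
  unfold leg_cos. rewrite <- (invsqrtc_conv n).
  eapply Rle_trans; [apply sum_f_R0_triangle|].
  apply sum_Rle. intros k _. rewrite !Rabs_mult.
  rewrite (Rabs_pos_eq (invsqrtc k)), (Rabs_pos_eq (invsqrtc (n - k))) by (apply Rlt_le, invsqrtc_gt0).
  rewrite <- (Rmult_1_r (invsqrtc k * invsqrtc (n - k))) at 2.
  apply Rmult_le_compat_l.
  - apply Rmult_le_pos; apply Rlt_le, invsqrtc_gt0.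
  - apply Rabs_le, COS_bound.
Qed.

(** * Principal roots *)

Lemma C_ext (z w : C) : Re z = Re w -> Im z = Im w -> z = w.
Proof. destruct z, w; simpl; congruence. Qed.

Lemma Cmod_sq (z : C) : Cmod z * Cmod z = Re z * Re z + Im z * Im z.
Proof. generalize (Cmod2_alt z). intros; nra. Qed.

Lemma re_minus (a b : C) : Re (a - b) = Re a - Re b.
Proof. unfold Cminus. rewrite re_plus, re_opp. ring. Qed.
Lemma im_minus (a b : C) : Im (a - b) = Im a - Im b.
Proof. unfold Cminus. rewrite im_plus, im_opp. ring. Qed.

Lemma RtoC_neq0 (x : R) : x <> 0 -> RtoC x <> 0%C.
Proof. intros H E. apply (f_equal Re) in E. simpl in E. lra. Qed.
Lemma C_neq0_Re (z : C) : Re z <> 0 -> z <> 0%C.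
Proof. intros H E. apply H. now rewrite E. Qed.

Lemma Re_le_Cmod (z : C) : - Cmod z <= Re z <= Cmod z.
Proof. apply Rabs_le_between, re_le_Cmod. Qed.
Lemma Im_le_Cmod (z : C) : - Cmod z <= Im z <= Cmod z.
Proof.
  apply Rabs_le_between.
  generalize (Rmax_Cmod z) (Rmax_r (Rabs (fst z)) (Rabs (snd z))). unfold Im. lra.
Qed.
Lemma Carg_polar (r t : R) : 0 < r -> - PI < t <= PI -> Carg (Cpolar r t) = t.
Proof.
  intros Hr Ht. generalize PI_RGT_0; intros Hpi.
  assert (HM : Cmod (Cpolar r t) = r).
  { assert (E : Cmod (Cpolar r t) ^ 2 = r ^ 2).
    { rewrite Cmod2_alt. simpl. generalize (sin2_cos2 t). unfold Rsqr; intros; nra. }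
    generalize (Cmod_ge_0 (Cpolar r t)); intros; nra. }
  unfold Carg. rewrite HM.
  replace (Re (Cpolar r t) / r) with (cos t) by (simpl; field; lra).
  simpl Im. destruct (Rle_dec 0 (r * sin t)) as [H|H].
  - apply acos_cos. split; [|lra].
    destruct (Rle_lt_dec 0 t) as [|Hlt]; [lra|].
    assert (sin t < 0) by (apply sin_lt_0_var; lra). nra.
  - replace (cos t) with (cos (- t)) by apply cos_neg.
    rewrite acos_cos; [lra|]. split; [|lra].
    destruct (Rle_lt_dec t 0) as [|Hlt]; [lra|].
    assert (0 <= sin t) by (apply sin_ge_0; lra). nra.
Qed.

Lemma Carg_bound (z : C) : - PI <= Carg z <= PI.
Proof.
  unfold Carg. generalize (acos_bound (Re z / Cmod z)) PI_RGT_0.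
  destruct Rle_dec; intros; lra.
Qed.

Lemma polar_Carg (z : C) : z <> 0%C ->
  z = Cpolar (Cmod z) (Carg z) /\ - PI < Carg z <= PI.
Proof.
  intros Hz. apply Cmod_gt_0 in Hz.
  generalize (Cmod_sq z) (Re_le_Cmod z); intros Hs Hr.
  assert (Hb : -1 <= Re z / Cmod z <= 1).
  { split; [apply Rmult_le_reg_r with (Cmod z)|apply Rmult_le_reg_r with (Cmod z)];
    try lra; unfold Rdiv; rewrite Rmult_assoc, Rinv_l; lra. }
  generalize (acos_bound (Re z / Cmod z)) PI_RGT_0; intros Ha Hpi.
  assert (Hsin : Cmod z * sin (acos (Re z / Cmod z)) = Rabs (Im z)).
  { rewrite sin_acos by exact Hb.
    rewrite <- (sqrt_Rsqr (Cmod z)) at 1 by lra.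
    rewrite <- sqrt_mult_alt by (unfold Rsqr; nra).
    rewrite <- sqrt_Rsqr_abs. f_equal. unfold Rsqr. field_simplify; [|lra]. nra. }
  unfold Carg. destruct (Rle_dec 0 (Im z)) as [H|H].
  - split; [|lra]. apply C_ext; simpl.
    + rewrite cos_acos by exact Hb. field. lra.
    + rewrite Hsin, Rabs_pos_eq by lra. reflexivity.
  - split.
    + apply C_ext; simpl.
      * rewrite cos_neg, cos_acos by exact Hb. field. lra.
      * rewrite sin_neg. rewrite Rabs_left in Hsin by lra. lra.
    + destruct (Req_dec (acos (Re z / Cmod z)) PI) as [E|E]; [|lra].
      rewrite E, sin_PI, Rabs_left in Hsin by lra. lra.
Qed.

Lemma Cpolar_mult r t r' t' :
  (Cpolar r t * Cpolar r' t')%C = Cpolar (r * r') (t + t').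
Proof.
  apply C_ext; simpl; rewrite ?cos_plus, ?sin_plus; ring.
Qed.

Lemma Csqrt_0 : Csqrt 0 = 0%C.
Proof. unfold Csqrt. rewrite Cmod_0, sqrt_0. apply C_ext; simpl; ring. Qed.

Lemma Csqrt_sqr (w : C) : (Csqrt w * Csqrt w)%C = w.
Proof.
  destruct (Ceq_dec w 0) as [->|Hw]; [rewrite Csqrt_0; ring|].
  unfold Csqrt. rewrite Cpolar_mult, sqrt_sqrt by apply Cmod_ge_0.
  destruct (polar_Carg w Hw) as [E _].
  transitivity (Cpolar (Cmod w) (Carg w)); [f_equal; lra|now symmetry].
Qed.

Lemma Csqrt_Re (w : C) : 0 <= Re (Csqrt w).
Proof.
  simpl. apply Rmult_le_pos; [apply sqrt_pos|].
  generalize (Carg_bound w); intros. apply cos_ge_0; lra.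
Qed.

(** The tool by which every principal root below is identified. *)
Lemma Csqrt_unique (z w : C) :
  (z * z)%C = w -> 0 < Re z \/ (Re z = 0 /\ 0 <= Im z) -> Csqrt w = z.
Proof.
  intros <- Hz. destruct (Ceq_dec z 0) as [->|Hz0].
  { replace (0 * 0)%C with (RtoC 0) by ring. apply Csqrt_0. }
  destruct (polar_Carg z Hz0) as [E Hb]. apply Cmod_gt_0 in Hz0.
  generalize PI_RGT_0; intros Hpi.
  assert (Ht : - (PI / 2) < Carg z <= PI / 2).
  { assert (HRe : Re z = Cmod z * cos (Carg z)) by (rewrite E at 1; reflexivity).
    assert (HIm : Im z = Cmod z * sin (Carg z)) by (rewrite E at 1; reflexivity).
    split.
    - destruct (Rlt_le_dec (- (PI / 2)) (Carg z)) as [|H]; [assumption|exfalso].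
      assert (cos (Carg z) <= 0).
      { rewrite <- cos_neg. apply cos_le_0; lra. }
      assert (sin (Carg z) < 0) by (apply sin_lt_0_var; lra).
      nra.
    - destruct (Rle_lt_dec (Carg z) (PI / 2)) as [|H]; [assumption|exfalso].
      assert (cos (Carg z) < 0) by (apply cos_lt_0; lra). nra. }
  unfold Csqrt.
  replace (Carg (z * z)) with (2 * Carg z).
  - rewrite Cmod_mult, sqrt_square by lra. rewrite E at 3. f_equal. lra.
  - rewrite E at 2 3. rewrite Cpolar_mult, Carg_polar; [ring|nra|lra].
Qed.

Lemma Csqrt_Re0 (w : C) : Re (Csqrt w) = 0 -> 0 <= Im (Csqrt w).
Proof.
  intros H. simpl in *. generalize (Carg_bound w) PI_RGT_0 (sqrt_pos (Cmod w)); intros Hb Hpi Hs.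
  destruct (Rmult_integral _ _ H) as [E|E]; [rewrite E; lra|].
  apply Rmult_le_pos; [exact Hs|].
  destruct (Ceq_dec w 0) as [->|Hw].
  { unfold Carg. simpl Im. destruct Rle_dec; [|lra].
    generalize (acos_bound (Re 0 / Cmod 0)); intros. apply sin_ge_0; lra. }
  destruct (polar_Carg w Hw) as [_ Hb'].
  destruct (Rle_lt_dec 0 (Carg w)) as [|Hn]; [apply sin_ge_0; lra|].
  assert (0 < cos (Carg w / 2)) by (apply cos_gt_0; lra). lra.
Qed.

Lemma Csqrt_real (t : R) : 0 <= t -> Csqrt (RtoC t) = RtoC (sqrt t).
Proof.
  intros Ht. apply Csqrt_unique.
  - rewrite <- RtoC_mult, sqrt_sqrt by assumption. reflexivity.
  - simpl. generalize (sqrt_pos t). lra.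
Qed.

Lemma Csqrt_quadrant (w : C) : 0 <= Im w -> 0 <= Im (Csqrt w).
Proof.
  intros H. destruct (Csqrt_Re w) as [HR|HR]; [|now apply Csqrt_Re0].
  rewrite <- (Csqrt_sqr w) in H. rewrite im_mult in H. nra.
Qed.

Lemma Croot4_Csqrt (w : C) : w <> 0%C -> Croot4 w = Csqrt (Csqrt w).
Proof.
  intros Hw. destruct (polar_Carg w Hw) as [_ Hb]. apply Cmod_gt_0 in Hw.
  generalize PI_RGT_0; intros Hpi.
  assert (HM : Cmod (Csqrt w) = sqrt (Cmod w)).
  { apply Rsqr_inj; [apply Cmod_ge_0|apply sqrt_pos|].
    rewrite Rsqr_sqrt by lra. unfold Rsqr. rewrite <- Cmod_mult, Csqrt_sqr. reflexivity. }
  unfold Croot4. unfold Csqrt at 1. rewrite HM.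
  unfold Csqrt. rewrite Carg_polar.
  - f_equal. field.
  - now apply sqrt_lt_R0.
  - lra.
Qed.
(** Two points of the first quadrant are no farther apart than their sum is long; hence the
    principal root is Hoelder continuous on the closed upper half plane. *)
Lemma quadrant_diff (a b : C) :
  0 <= Re a -> 0 <= Im a -> 0 <= Re b -> 0 <= Im b ->
  Cmod (a - b) * Cmod (a - b) <= Cmod (a * a - b * b).
Proof.
  intros. replace (a * a - b * b)%C with ((a - b) * (a + b))%C by ring.
  rewrite Cmod_mult. apply Rmult_le_compat_l; [apply Cmod_ge_0|].
  apply Rsqr_incr_0; [|apply Cmod_ge_0|apply Cmod_ge_0].
  unfold Rsqr. rewrite !Cmod_sq. simpl.
  unfold Re, Im in *. nra.
Qed.

(** One [e] serves both factors: the shape in which products enter limits. *)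
Lemma Cmult_close (l m : C) (eps : R) : 0 < eps ->
  exists e, 0 < e /\ forall p q, Cmod (p - l) < e -> Cmod (q - m) < e ->
    Cmod (p * q - l * m) < eps.
Proof.
  intros He. assert (Hl0 := Cmod_ge_0 l). assert (Hm0 := Cmod_ge_0 m).
  set (K := 1 + Cmod l + Cmod m).
  assert (HK : 1 <= K) by (unfold K; lra).
  set (e := Rmin 1 (eps / (2 * K))).
  assert (He' : 0 < e) by (apply Rmin_glb_lt; [lra|apply Rdiv_lt_0_compat; lra]).
  assert (He1 : e <= 1) by apply Rmin_l.
  assert (He2 : e * (2 * K) <= eps).
  { apply Rmult_le_reg_r with (/ (2 * K)); [apply Rinv_0_lt_compat; lra|].
    rewrite Rmult_assoc, Rinv_r, Rmult_1_r by lra. apply Rmin_r. }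
  exists e. split; [exact He'|]. intros p q Hp Hq.
  replace (p * q - l * m)%C with ((p - l) * (q - m) + ((p - l) * m + l * (q - m)))%C by ring.
  eapply Rle_lt_trans; [apply Cmod_triangle|].
  assert (H3 := Cmod_triangle ((p - l) * m) (l * (q - m))).
  rewrite !Cmod_mult in *.
  assert (A1 := Cmod_ge_0 (p - l)). assert (A2 := Cmod_ge_0 (q - m)).
  set (u := Cmod (p - l)) in *. set (v := Cmod (q - m)) in *.
  assert (u * v <= e * 1) by nra.
  assert (u * Cmod m <= e * Cmod m) by nra.
  assert (Cmod l * v <= e * Cmod l) by nra.
  unfold K in *. nra.
Qed.

(** * Complex series *)

Lemma pow_unit (x : R) (n : nat) : 0 <= x <= 1 -> 0 <= x ^ n <= 1.
Proof.
  intros H. split; [apply pow_le; lra|]. rewrite <- (pow1 n). now apply pow_incr.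
Qed.

Lemma is_RInt_ext_R (f g : R -> R) a b (l : R) :
  (forall x, f x = g x) -> is_RInt f a b l -> is_RInt g a b l.
Proof. intros H. apply is_RInt_ext. intros; apply H. Qed.

(** Convergence is taken by components, which makes the theory of real series available. *)
Definition is_cseries (a : nat -> C) (l : C) : Prop :=
  is_series (fun n => Re (a n)) (Re l) /\ is_series (fun n => Im (a n)) (Im l).

Definition CSeries (a : nat -> C) : C :=
  (Series (fun n => Re (a n)), Series (fun n => Im (a n))).

Lemma is_cseries_unique a l : is_cseries a l -> CSeries a = l.
Proof.
  intros [H1 H2]. apply C_ext; simpl; now apply is_series_unique.
Qed.

Lemma is_cseries_eq a l l' : is_cseries a l -> is_cseries a l' -> l = l'.
Proof. intros H H'. rewrite <- (is_cseries_unique _ _ H). now apply is_cseries_unique. Qed.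

Lemma is_cseries_ext a b l :
  (forall n, a n = b n) -> is_cseries a l -> is_cseries b l.
Proof.
  intros E [H1 H2]; split; eapply is_series_ext; eauto; intros n; simpl; now rewrite E.
Qed.

Lemma ex_series_Re a : ex_series (fun n => Cmod (a n)) -> ex_series (fun n => Rabs (Re (a n))).
Proof.
  apply (ex_series_le (K := R_AbsRing) (V := R_CompleteNormedModule)). intros n.
  change (Rabs (Rabs (Re (a n))) <= Cmod (a n)). rewrite Rabs_Rabsolu. apply re_le_Cmod.
Qed.
Lemma ex_series_Im a : ex_series (fun n => Cmod (a n)) -> ex_series (fun n => Rabs (Im (a n))).
Proof.
  apply (ex_series_le (K := R_AbsRing) (V := R_CompleteNormedModule)). intros n.
  change (Rabs (Rabs (Im (a n))) <= Cmod (a n)). rewrite Rabs_Rabsolu.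
  apply Rabs_le, Im_le_Cmod.
Qed.

Lemma CSeries_correct a : ex_series (fun n => Cmod (a n)) -> is_cseries a (CSeries a).
Proof.
  intros H; split; simpl; apply Series_correct, ex_series_Rabs;
  [now apply ex_series_Re|now apply ex_series_Im].
Qed.

Lemma ex_series_dom (a : nat -> R) (M : nat -> R) :
  (forall n, Rabs (a n) <= M n) -> ex_series M -> ex_series a.
Proof.
  intros H. apply (ex_series_le (K := R_AbsRing) (V := R_CompleteNormedModule)). exact H.
Qed.

Lemma is_cseries_plus a b la lb :
  is_cseries a la -> is_cseries b lb -> is_cseries (fun n => a n + b n)%C (la + lb)%C.
Proof.
  intros [H1 H2] [H3 H4]; split; simpl; now apply (is_series_plus (V := R_NormedModule)).
Qed.

Lemma is_cseries_scal (c : C) a l :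
  is_cseries a l -> is_cseries (fun n => c * a n)%C (c * l)%C.
Proof.
  intros [H1 H2]; split; simpl.
  - apply (is_series_minus (V := R_NormedModule) (fun n => Re c * Re (a n)) (fun n => Im c * Im (a n)));
    now apply (is_series_scal (V := R_NormedModule)).
  - apply (is_series_plus (V := R_NormedModule) (fun n => Re c * Im (a n)) (fun n => Im c * Re (a n)));
    now apply (is_series_scal (V := R_NormedModule)).
Qed.

Lemma is_cseries_mult (a b : nat -> C) la lb :
  is_cseries a la -> is_cseries b lb ->
  ex_series (fun n => Cmod (a n)) -> ex_series (fun n => Cmod (b n)) ->
  is_cseries
    (fun n => (sum_f_R0 (fun k => Re (a k * b (n - k)%nat)%C) n,
               sum_f_R0 (fun k => Im (a k * b (n - k)%nat)%C) n)) (la * lb)%C.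
Proof.
  intros [Ha1 Ha2] [Hb1 Hb2] Ha Hb.
  assert (Xa := ex_series_Re _ Ha). assert (Ya := ex_series_Im _ Ha).
  assert (Xb := ex_series_Re _ Hb). assert (Yb := ex_series_Im _ Hb).
  split; simpl.
  - eapply is_series_ext.
    2:{ apply (is_series_minus (V := R_NormedModule)).
        - exact (is_series_mult _ _ _ _ Ha1 Hb1 Xa Xb).
        - exact (is_series_mult _ _ _ _ Ha2 Hb2 Ya Yb). }
    intros n. simpl. symmetry. apply minus_sum.
  - eapply is_series_ext.
    2:{ apply (is_series_plus (V := R_NormedModule)).
        - exact (is_series_mult _ _ _ _ Ha1 Hb2 Xa Yb).
        - exact (is_series_mult _ _ _ _ Ha2 Hb1 Ya Xb). }
    intros n. simpl. symmetry. apply plus_sum.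
Qed.

Lemma Cmod_le_of_rotations (l : C) (S : R) :
  0 <= S -> (forall u : C, Cmod u <= 1 -> Re (u * l) <= S) -> Cmod l <= S.
Proof.
  intros HS H. destruct (Ceq_dec l 0) as [->|Hl]; [now rewrite Cmod_0|].
  apply Cmod_gt_0 in Hl.
  specialize (H (Cconj l / RtoC (Cmod l))%C).
  assert (Hn : RtoC (Cmod l) <> 0%C) by (intros E; apply (f_equal Re) in E; simpl in E; lra).
  rewrite Cmod_div, Cmod_conj, Cmod_R, Rabs_pos_eq in H by (try assumption; lra).
  assert (E : (Cconj l / Cmod l * l)%C = RtoC (Cmod l)).
  { replace (Cconj l / Cmod l * l)%C with ((l * Cconj l) / Cmod l)%C by (field; exact Hn).
    rewrite <- Cmod2_conj. rewrite RtoC_pow. field. exact Hn. }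
  rewrite E in H. simpl in H. apply H. apply Req_le. field. lra.
Qed.

Lemma is_series_le (a b : nat -> R) la lb :
  (forall n, a n <= b n) -> is_series a la -> is_series b lb -> la <= lb.
Proof.
  intros H Ha Hb.
  refine (is_lim_seq_le (fun n => sum_n a n) (fun n => sum_n b n) la lb _ Ha Hb).
  intros n. rewrite !sum_n_Reals. apply sum_Rle. auto.
Qed.

Lemma is_series_finite (k : nat -> R) (N : nat) :
  (forall n, (N < n)%nat -> k n = 0) -> is_series k (sum_n k N).
Proof.
  intros H. change (is_lim_seq (sum_n k) (sum_n k N)).
  apply is_lim_seq_ext_loc with (fun _ => sum_n k N); [|apply is_lim_seq_const].
  exists N. intros n Hn. rewrite !sum_n_Reals.
  induction Hn as [|n Hn IH]; [reflexivity|].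
  rewrite tech5, <- IH, H by lia. ring.
Qed.

Lemma is_series_zero : is_series (fun _ => 0) 0.
Proof.
  generalize (is_series_finite (fun _ => 0) 0 ltac:(reflexivity)). now rewrite sum_O.
Qed.

Lemma series_nonneg (M : nat -> R) S : (forall n, 0 <= M n) -> is_series M S -> 0 <= S.
Proof. intros H HS. exact (is_series_le _ _ _ _ H is_series_zero HS). Qed.

(** After a rotation the sum is real and positive, and real parts compare termwise. *)
Lemma is_cseries_Cmod_le (a : nat -> C) (M : nat -> R) l S :
  is_cseries a l -> (forall n, Cmod (a n) <= M n) -> is_series M S -> Cmod l <= S.
Proof.
  intros Hl HM HS. apply Cmod_le_of_rotations.
  - refine (series_nonneg M S _ HS).
    intros n. generalize (HM n) (Cmod_ge_0 (a n)); lra.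
  - intros u Hu. destruct (is_cseries_scal u _ _ Hl) as [HR _].
    refine (is_series_le _ _ _ _ _ HR HS).
    intros n. apply Rle_trans with (Cmod (u * a n)); [apply Re_le_Cmod|].
    rewrite Cmod_mult. generalize (HM n) (Cmod_ge_0 (a n)); intros; nra.
Qed.

Lemma is_series_shift (a : nat -> R) (l : R) :
  is_series a l -> is_series (fun n => a (S n)) (l - a O).
Proof.
  intros H. apply (is_series_incr_1 (V := R_NormedModule) a).
  match goal with |- is_series _ ?x => replace x with l; [exact H|] end.
  unfold plus; simpl; ring.
Qed.

Lemma is_cseries_shift a l :
  is_cseries a l -> is_cseries (fun n => a (S n)) (l - a O)%C.
Proof.
  intros [H1 H2]; split;
  [exact (is_series_shift (fun n => Re (a n)) _ H1)|exact (is_series_shift (fun n => Im (a n)) _ H2)].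
Qed.

Lemma is_series_unshift (a : nat -> R) (l : R) :
  is_series (fun n => a (S n)) l -> is_series a (a O + l).
Proof.
  intros H. apply (is_series_decr_1 (V := R_NormedModule) a).
  match goal with |- is_series _ ?x => replace x with l; [exact H|] end.
  unfold plus, opp; simpl; ring.
Qed.

Lemma is_cseries_unshift a l :
  is_cseries (fun n => a (S n)) l -> is_cseries a (a O + l)%C.
Proof.
  intros [H1 H2]; split;
  [exact (is_series_unshift (fun n => Re (a n)) _ H1)|exact (is_series_unshift (fun n => Im (a n)) _ H2)].
Qed.

Lemma is_cseries_two (a : nat -> C) :
  (forall n, a (S (S n)) = 0%C) -> is_cseries a (a 0%nat + a 1%nat)%C.
Proof.
  intros H. apply is_cseries_unshift.
  replace (a 1%nat) with (a 1%nat + 0)%C by ring.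
  apply (is_cseries_unshift (fun n => a (S n))).
  split; eapply is_series_ext; try exact is_series_zero; intros n; now rewrite H.
Qed.

Lemma is_series_even (a : nat -> R) l :
  (forall n, a (2 * n + 1)%nat = 0) -> is_series a l -> is_series (fun n => a (2 * n)%nat) l.
Proof.
  intros H Hl. change (is_lim_seq (sum_n (fun n => a (2 * n)%nat)) l).
  apply (is_lim_seq_ext (fun n => sum_n a (2 * n))).
  - intros n. rewrite !sum_n_Reals. induction n as [|n IH]; [reflexivity|].
    replace (2 * S n)%nat with (S (S (2 * n))) at 1 by lia.
    rewrite !tech5, IH. replace (S (2 * n)) with (2 * n + 1)%nat by lia. rewrite H.
    replace (S (2 * n + 1)) with (2 * S n)%nat by lia. ring.
  - apply (is_lim_seq_subseq (sum_n a) l (fun n => (2 * n)%nat)); [|exact Hl].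
    apply eventually_subseq. intros; lia.
Qed.

Lemma is_cseries_even (a : nat -> C) l :
  (forall n, a (2 * n + 1)%nat = 0%C) -> is_cseries a l -> is_cseries (fun n => a (2 * n)%nat) l.
Proof.
  intros H [H1 H2].
  split; [apply (is_series_even (fun n => Re (a n)))|apply (is_series_even (fun n => Im (a n)))];
  auto; intros n; cbv beta; now rewrite H.
Qed.

Lemma Cpow_diff (y z : C) n : Cmod y <= 1 -> Cmod z <= 1 ->
  Cmod (y ^ n - z ^ n) <= INR n * Cmod (y - z).
Proof.
  intros Hy Hz. induction n as [|n IH].
  - simpl. replace (1 - 1)%C with (RtoC 0) by ring. rewrite Cmod_0. lra.
  - replace (y ^ S n - z ^ S n)%C with (y ^ n * (y - z) + z * (y ^ n - z ^ n))%C by (simpl; ring).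
    eapply Rle_trans; [apply Cmod_triangle|]. rewrite !Cmod_mult, S_INR.
    assert (Cmod (y ^ n) <= 1).
    { rewrite Cmod_pow. rewrite <- (pow1 n). apply pow_incr. split; [apply Cmod_ge_0|exact Hy]. }
    generalize (Cmod_ge_0 (y - z)) (Cmod_ge_0 (y ^ n - z ^ n)) (Cmod_ge_0 z). intros; nra.
Qed.

Lemma Cmod_pow_le1 y n : Cmod y <= 1 -> Cmod (y ^ n) <= 1.
Proof.
  intros. rewrite Cmod_pow, <- (pow1 n). apply pow_incr. split; [apply Cmod_ge_0|assumption].
Qed.

Lemma ex_series_pow (a : nat -> C) (y : C) :
  ex_series (fun n => Cmod (a n)) -> Cmod y <= 1 -> ex_series (fun n => Cmod (a n * y ^ n)%C).
Proof.
  intros H Hy. revert H. apply ex_series_dom. intros n.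
  rewrite Rabs_pos_eq by apply Cmod_ge_0. rewrite Cmod_mult.
  generalize (Cmod_pow_le1 y n Hy) (Cmod_ge_0 (a n)); intros; nra.
Qed.

(** * Power series on the closed unit disc *)

Definition CPSeries (a : nat -> C) (y : C) : C := CSeries (fun n => a n * y ^ n)%C.

Lemma CPSeries_correct a y : ex_series (fun n => Cmod (a n)) -> Cmod y <= 1 ->
  is_cseries (fun n => a n * y ^ n)%C (CPSeries a y).
Proof. intros. now apply CSeries_correct, ex_series_pow. Qed.

Lemma series_tail_small (M : nat -> R) (eps : R) : ex_series M -> 0 < eps ->
  exists N S, is_series (fun n => if Nat.leb n N then 0 else M n) S /\ Rabs S < eps.
Proof.
  intros [S HS] He.
  destruct (HS _ (locally_ball S (mkposreal eps He))) as [N HN].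
  exists N, (S - sum_n M N). split.
  - set (f := fun n => if Nat.leb n N then M n else 0).
    assert (Hf : is_series f (sum_n M N)).
    { replace (sum_n M N) with (sum_n f N).
      - apply is_series_finite. intros n Hn. unfold f. now rewrite (proj2 (Nat.leb_gt n N)).
      - apply sum_n_ext_loc. intros k Hk. unfold f. now rewrite (proj2 (Nat.leb_le k N)). }
    eapply is_series_ext.
    2:{ apply (is_series_minus (V := R_NormedModule)); [exact HS|exact Hf]. }
    intros n. unfold f. destruct (Nat.leb n N); unfold minus, plus, opp; simpl; ring.
  - specialize (HN N (Nat.le_refl N)).
    rewrite Rabs_minus_sym. exact HN.
Qed.

(** The index [N] depends on the majorant only, which gives uniformity in [f]. *)
Lemma series_tail_unif (M : nat -> R) (eps : R) : ex_series M -> 0 < eps ->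
  exists N, forall (f : nat -> R) (l : R) m,
    (forall n, Rabs (f n) <= M n) -> is_series f l -> (N <= m)%nat ->
    Rabs (sum_n f m - l) < eps.
Proof.
  intros HM He.
  destruct (series_tail_small M eps HM He) as (N & T & HT & HTe).
  exists N. intros f l m Hf Hl Hm.
  apply Rle_lt_trans with T; [|now apply Rabs_lt_between in HTe].
  set (k := fun n => if Nat.leb n m then f n else 0).
  assert (Hk : is_series k (sum_n f m)).
  { replace (sum_n f m) with (sum_n k m).
    - apply is_series_finite. intros n Hn. unfold k. now rewrite (proj2 (Nat.leb_gt n m)).
    - apply sum_n_ext_loc. intros i Hi. unfold k. now rewrite (proj2 (Nat.leb_le i m)). }
  assert (Hd := is_series_minus (V := R_NormedModule) _ _ _ _ Hk Hl).
  assert (HB : forall n, Rabs (k n - f n) <= if Nat.leb n N then 0 else M n).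
  { intros n. unfold k. destruct (Nat.leb_spec n m).
    - rewrite Rminus_diag, Rabs_R0. destruct (Nat.leb n N); [lra|].
      generalize (Hf n) (Rabs_pos (f n)); lra.
    - rewrite (proj2 (Nat.leb_gt n N)) by lia. rewrite Rminus_0_l, Rabs_Ropp. apply Hf. }
  apply Rabs_le. split.
  - apply Ropp_le_cancel. rewrite Ropp_involutive.
    refine (is_series_le _ _ _ _ _ (is_series_opp _ _ Hd) HT).
    intros n. generalize (HB n). intros HBn. apply Rabs_le_between in HBn.
    change (- (k n - f n) <= if Nat.leb n N then 0 else M n). lra.
  - refine (is_series_le _ _ _ _ _ Hd HT).
    intros n. generalize (HB n). intros HBn. apply Rabs_le_between in HBn. exact (proj2 HBn).
Qed.

(** A finite part is Lipschitz and the tails are uniformly small. *)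
Lemma CPSeries_unif_cont (a : nat -> C) (eps : R) :
  ex_series (fun n => Cmod (a n)) -> 0 < eps ->
  exists delta, 0 < delta /\ forall y z, Cmod y <= 1 -> Cmod z <= 1 ->
    Cmod (y - z) < delta -> Cmod (CPSeries a y - CPSeries a z) < eps.
Proof.
  intros Ha He.
  destruct (series_tail_small _ (eps / 4) Ha ltac:(lra)) as (N & T & HT & HTe).
  destruct Ha as [A HA].
  assert (HA0 : 0 <= A).
  { refine (series_nonneg _ A _ HA). intros; apply Cmod_ge_0. }
  assert (HN := pos_INR N).
  assert (HD : 0 < 2 * (INR N * A + 1)) by nra.
  exists (eps / (2 * (INR N * A + 1))). split; [now apply Rdiv_lt_0_compat|].
  intros y z Hy Hz Hyz.
  assert (Ha : ex_series (fun n => Cmod (a n))) by now exists A.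
  assert (Hd : is_cseries (fun n => a n * y ^ n + (-1) * (a n * z ^ n))%C
     (CPSeries a y + (-1) * CPSeries a z)%C).
  { apply is_cseries_plus; [now apply CPSeries_correct|].
    apply is_cseries_scal. now apply CPSeries_correct. }
  replace (CPSeries a y - CPSeries a z)%C with (CPSeries a y + (-1) * CPSeries a z)%C by ring.
  set (d := Cmod (y - z)) in *.
  apply Rle_lt_trans with (INR N * d * A + 2 * T).
  - refine (is_cseries_Cmod_le _ (fun n => INR N * d * Cmod (a n)
        + 2 * (if Nat.leb n N then 0 else Cmod (a n))) _ _ Hd _ _).
    + intros n.
      replace (a n * y ^ n + -1 * (a n * z ^ n))%C with (a n * (y ^ n - z ^ n))%C by ring.
      rewrite Cmod_mult. assert (H0 := Cmod_ge_0 (a n)).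
      assert (Hd0 : 0 <= d) by apply Cmod_ge_0.
      destruct (Nat.leb_spec n N) as [Hn|Hn].
      * apply Rle_trans with (Cmod (a n) * (INR n * d)).
        { apply Rmult_le_compat_l; [exact H0|]. now apply Cpow_diff. }
        apply le_INR in Hn. assert (INR n * d <= INR N * d) by nra. nra.
      * assert (Cmod (y ^ n - z ^ n) <= 2).
        { unfold Cminus. eapply Rle_trans; [apply Cmod_triangle|].
          rewrite Cmod_opp. generalize (Cmod_pow_le1 y n Hy) (Cmod_pow_le1 z n Hz). lra. }
        assert (0 <= INR N * d * Cmod (a n)) by (apply Rmult_le_pos; nra). nra.
    + apply (is_series_plus (V := R_NormedModule)
        (fun n => INR N * d * Cmod (a n)) (fun n => 2 * (if Nat.leb n N then 0 else Cmod (a n))));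
      now apply (is_series_scal (V := R_NormedModule)).
  - apply Rabs_lt_between in HTe.
    assert (d * (2 * (INR N * A + 1)) < eps).
    { apply Rmult_lt_reg_r with (/ (2 * (INR N * A + 1))); [now apply Rinv_0_lt_compat|].
      rewrite Rmult_assoc, Rinv_r by lra. rewrite Rmult_1_r. exact Hyz. }
    assert (0 <= d) by apply Cmod_ge_0. nra.
Qed.

(** * Term-by-term integration *)

(** Uniform convergence in the sense of the function space is required on all of R; cutting off
    outside [a, b] reduces it to the interval. *)
Lemma is_RInt_clamp (f : R -> R) a b l : a <= b ->
  is_RInt f a b l ->
  is_RInt (fun x => if Rle_dec a x then if Rle_dec x b then f x else 0 else 0) a b l.
Proof.
  intros Hab. apply is_RInt_ext. intros x. rewrite Rmin_left, Rmax_right by lra. intros Hx.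
  destruct (Rle_dec a x); [|lra]. destruct (Rle_dec x b); lra.
Qed.

Lemma is_RInt_series (f : nat -> R -> R) (g : R -> R) (M I : nat -> R) (a b : R) :
  a <= b ->
  (forall n x, a <= x <= b -> Rabs (f n x) <= M n) -> ex_series M ->
  (forall x, a <= x <= b -> is_series (fun n => f n x) (g x)) ->
  (forall n, is_RInt (f n) a b (I n)) ->
  exists S : R, is_RInt g a b S /\ is_series I S.
Proof.
  intros Hab HM HMs Hg HI.
  set (cl := fun (h : R -> R) x => if Rle_dec a x then if Rle_dec x b then h x else 0 else 0).
  assert (Hsum : forall N, is_RInt (fun x => sum_n (fun n => f n x) N) a b (sum_n I N)).
  { induction N as [|N IH].
    - rewrite sum_O. eapply is_RInt_ext; [|apply HI]. intros; now rewrite sum_O.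
    - rewrite sum_Sn. eapply is_RInt_ext.
      2:{ apply (is_RInt_plus (V := R_NormedModule)); [exact IH|apply HI]. }
      intros; now rewrite sum_Sn. }
  destruct (filterlim_RInt (V := R_CompleteNormedModule)
     (fun N => cl (fun x => sum_n (fun n => f n x) N)) a b eventually _
     (cl g) (fun N => sum_n I N)) as [S [HS1 HS2]].
  - intros N. now apply is_RInt_clamp.
  - apply filterlim_locally. intros eps.
    destruct (series_tail_unif M eps HMs (cond_pos eps)) as (N & HN).
    exists N. intros m Hm x. unfold cl.
    destruct (Rle_dec a x) as [Ha|]; [|apply ball_center].
    destruct (Rle_dec x b) as [Hb|]; [|apply ball_center].
    apply (HN (fun n => f n x)); [intros n; now apply HM|now apply Hg|exact Hm].
  - exists S. split; [|exact HS1].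
    eapply is_RInt_ext; [|exact HS2]. intros x. rewrite Rmin_left, Rmax_right by lra. intros Hx.
    unfold cl. destruct (Rle_dec a x); [|lra]. destruct (Rle_dec x b); [reflexivity|lra].
Qed.

Lemma is_RInt_pair (f : R -> C) a b (l : C) :
  is_RInt (fun x => Re (f x)) a b (Re l) -> is_RInt (fun x => Im (f x)) a b (Im l) ->
  is_RInt (V := C_R_NormedModule) f a b l.
Proof.
  intros H1 H2. destruct l as [u v].
  exact (is_RInt_fct_extend_pair (U := R_NormedModule) (V := R_NormedModule) f a b u v H1 H2).
Qed.

Lemma is_RInt_Re (f : R -> C) a b (l : C) :
  is_RInt (V := C_R_NormedModule) f a b l -> is_RInt (fun x => Re (f x)) a b (Re l).
Proof.
  exact (is_RInt_fct_extend_fst (U := R_NormedModule) (V := R_NormedModule) f a b l).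
Qed.
Lemma is_RInt_Im (f : R -> C) a b (l : C) :
  is_RInt (V := C_R_NormedModule) f a b l -> is_RInt (fun x => Im (f x)) a b (Im l).
Proof.
  exact (is_RInt_fct_extend_snd (U := R_NormedModule) (V := R_NormedModule) f a b l).
Qed.

Lemma is_RInt_cscal (c : C) (f : R -> C) a b (l : C) :
  is_RInt (V := C_R_NormedModule) f a b l ->
  is_RInt (V := C_R_NormedModule) (fun x => c * f x)%C a b (c * l)%C.
Proof.
  intros H. assert (H1 := is_RInt_Re _ _ _ _ H). assert (H2 := is_RInt_Im _ _ _ _ H).
  apply is_RInt_pair; simpl.
  - apply (is_RInt_minus (V := R_NormedModule) (fun x => Re c * Re (f x)) (fun x => Im c * Im (f x)));
    now apply (is_RInt_scal (V := R_NormedModule)).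
  - apply (is_RInt_plus (V := R_NormedModule) (fun x => Re c * Im (f x)) (fun x => Im c * Re (f x)));
    now apply (is_RInt_scal (V := R_NormedModule)).
Qed.

Lemma is_RInt_RtoC (f : R -> R) a b (l : R) :
  is_RInt f a b l -> is_RInt (V := C_R_NormedModule) (fun x => RtoC (f x)) a b (RtoC l).
Proof.
  intros H. apply is_RInt_pair; simpl; [exact H|].
  generalize (is_RInt_const (V := R_NormedModule) a b 0).
  change (scal (b - a) (0 : R_NormedModule)) with ((b - a) * 0). now rewrite Rmult_0_r.
Qed.

Lemma is_RInt_cseries (f : nat -> R -> C) (g : R -> C) (M : nat -> R) (I : nat -> C) (a b : R) :
  a <= b ->
  (forall n x, a <= x <= b -> Cmod (f n x) <= M n) -> ex_series M ->
  (forall x, a <= x <= b -> is_cseries (fun n => f n x) (g x)) ->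
  (forall n, is_RInt (V := C_R_NormedModule) (f n) a b (I n)) ->
  exists S : C, is_RInt (V := C_R_NormedModule) g a b S /\ is_cseries I S.
Proof.
  intros Hab HM HMs Hg HI.
  destruct (is_RInt_series (fun n x => Re (f n x)) (fun x => Re (g x)) M (fun n => Re (I n)) a b)
    as [SR [HR1 HR2]]; auto.
  { intros n x Hx. eapply Rle_trans; [apply re_le_Cmod|now apply HM]. }
  { intros x Hx. now apply Hg. }
  { intros n. now apply is_RInt_Re. }
  destruct (is_RInt_series (fun n x => Im (f n x)) (fun x => Im (g x)) M (fun n => Im (I n)) a b)
    as [SI [HI1 HI2]]; auto.
  { intros n x Hx. apply Rle_trans with (Cmod (f n x)); [apply Rabs_le, Im_le_Cmod|now apply HM]. }
  { intros x Hx. now apply Hg. }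
  { intros n. now apply is_RInt_Im. }
  exists (SR, SI). split; [now apply is_RInt_pair|now split].
Qed.

Lemma RInt_C_unique (f : R -> C) a b (l : C) :
  is_RInt (V := C_R_NormedModule) f a b l -> RInt (V := C_R_CompleteNormedModule) f a b = l.
Proof. intros H. now apply (is_RInt_unique (V := C_R_CompleteNormedModule)). Qed.

(** * The series of the square root and of its inverse *)

Lemma is_lim_invsqrtc : is_lim_seq invsqrtc 0.
Proof.
  apply is_lim_seq_spec. intros eps.
  assert (He := cond_pos eps).
  destruct (nfloor_ex (/ (eps * eps)) ltac:(apply Rlt_le, Rinv_0_lt_compat; nra)) as [N HN].
  exists N. intros n Hn. rewrite Rminus_0_r, Rabs_pos_eq by apply Rlt_le, invsqrtc_gt0.
  generalize (invsqrtc_sq_le n) (invsqrtc_gt0 n) (le_INR _ _ Hn) (pos_INR n); intros H1 H2 H3 H4.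
  assert (H5 : / (2 * INR n + 1) < eps * eps).
  { rewrite <- (Rinv_inv (eps * eps)). destruct (Req_dec (INR n) 0) as [E|E].
    - rewrite E. apply Rinv_lt_contravar; [|lra].
      apply Rmult_lt_0_compat; [apply Rinv_0_lt_compat; nra|lra].
    - apply Rinv_lt_contravar; [|lra].
      apply Rmult_lt_0_compat; [apply Rinv_0_lt_compat; nra|lra]. }
  nra.
Qed.

Lemma is_series_sqrtc_tail : is_series (fun n => sqrtc (S n)) (-1).
Proof.
  change (is_lim_seq (sum_n (fun n => sqrtc (S n))) (-1)).
  apply is_lim_seq_ext with (fun n => invsqrtc (S n) - 1).
  - intros n. rewrite sum_n_Reals. rewrite (sum_telescope _ invsqrtc) by reflexivity.
    reflexivity.
  - replace (Finite (-1)) with (Finite (0 - 1)) by (f_equal; lra).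
    apply is_lim_seq_minus'; [|apply is_lim_seq_const].
    apply -> is_lim_seq_incr_1. exact is_lim_invsqrtc.
Qed.

Lemma ex_series_sqrtc : ex_series (fun n => Rabs (sqrtc n)).
Proof.
  apply ex_series_incr_1. exists (- -1).
  apply is_series_ext with (fun n => - sqrtc (S n)).
  - intros n. rewrite Rabs_left1; [reflexivity|apply sqrtc_le0].
  - apply (is_series_opp (V := R_NormedModule)). exact is_series_sqrtc_tail.
Qed.

Lemma ex_series_sqrtcC : ex_series (fun n => Cmod (RtoC (sqrtc n))).
Proof.
  eapply ex_series_ext; [|exact ex_series_sqrtc]. intros n. simpl. now rewrite Cmod_R.
Qed.

(** The square root of 1 - eta, converging on the closed disc since the coefficients are
    summable. *)
Definition sqrt_ser (eta : C) : C := CPSeries (fun n => RtoC (sqrtc n)) eta.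

Lemma sqrt_ser_correct eta : Cmod eta <= 1 ->
  is_cseries (fun n => sqrtc n * eta ^ n)%C (sqrt_ser eta).
Proof. intros H. apply CPSeries_correct; [exact ex_series_sqrtcC|exact H]. Qed.

Lemma conv_RtoC (a b : nat -> R) (w : C) n :
  (sum_f_R0 (fun k => Re (RtoC (a k) * w ^ k * (RtoC (b (n - k)%nat) * w ^ (n - k)))%C) n,
   sum_f_R0 (fun k => Im (RtoC (a k) * w ^ k * (RtoC (b (n - k)%nat) * w ^ (n - k)))%C) n)
  = (RtoC (sum_f_R0 (fun k => a k * b (n - k)%nat)%R n) * w ^ n)%C.
Proof.
  apply C_ext; match goal with
    |- Re (?A, ?B) = _ => change (Re (A, B)) with A
    | |- Im (?A, ?B) = _ => change (Im (A, B)) with B end.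
  - rewrite (sum_eq _ (fun k => Re (w ^ n)%C * (a k * b (n - k)%nat))).
    + rewrite sum_scal_l. rewrite re_scal_l. ring.
    + intros k Hk.
      replace (RtoC (a k) * w ^ k * (RtoC (b (n - k)%nat) * w ^ (n - k)))%C
        with (RtoC (a k * b (n - k)%nat) * w ^ n)%C.
      2:{ replace n with (k + (n - k))%nat at 2 by lia. rewrite Cpow_add_r, RtoC_mult. ring. }
      rewrite re_scal_l. ring.
  - rewrite (sum_eq _ (fun k => Im (w ^ n)%C * (a k * b (n - k)%nat))).
    + rewrite sum_scal_l. rewrite im_scal_l. ring.
    + intros k Hk.
      replace (RtoC (a k) * w ^ k * (RtoC (b (n - k)%nat) * w ^ (n - k)))%C
        with (RtoC (a k * b (n - k)%nat) * w ^ n)%C.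
      2:{ replace n with (k + (n - k))%nat at 2 by lia. rewrite Cpow_add_r, RtoC_mult. ring. }
      rewrite im_scal_l. ring.
Qed.

Lemma is_cseries_pmult (a b : nat -> R) (w la lb : C) :
  is_cseries (fun n => a n * w ^ n)%C la -> is_cseries (fun n => b n * w ^ n)%C lb ->
  ex_series (fun n => Cmod (a n * w ^ n)%C) -> ex_series (fun n => Cmod (b n * w ^ n)%C) ->
  is_cseries (fun n => RtoC (sum_f_R0 (fun k => a k * b (n - k)%nat)%R n) * w ^ n)%C (la * lb)%C.
Proof.
  intros Ha Hb Ea Eb.
  eapply is_cseries_ext; [|exact (is_cseries_mult _ _ _ _ Ha Hb Ea Eb)].
  intros n. apply (conv_RtoC a b).
Qed.

Lemma sqrt_ser_sqr eta : Cmod eta <= 1 -> (sqrt_ser eta * sqrt_ser eta)%C = (1 - eta)%C.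
Proof.
  intros H. assert (H1 := sqrt_ser_correct eta H).
  assert (H2 : ex_series (fun n => Cmod (sqrtc n * eta ^ n)%C))
    by (now apply (ex_series_pow (fun n => RtoC (sqrtc n))), H; exact ex_series_sqrtcC).
  apply (is_cseries_eq _ _ _ (is_cseries_pmult _ _ _ _ _ H1 H1 H2 H2)).
  set (f := fun n => match n with 0%nat => RtoC 1 | 1%nat => (- eta)%C | _ => 0%C end).
  apply is_cseries_ext with f.
  { intros n. rewrite sqrtc_conv. destruct n as [|[|n]]; simpl; ring. }
  apply (is_cseries_two f). reflexivity.
Qed.

(** The coefficients beyond the first are negative and add up to -1, against the first one,
    which is 1. *)
Lemma sqrt_ser_Re eta : Cmod eta <= 1 -> 0 <= Re (sqrt_ser eta).
Proof.
  intros H. destruct (is_cseries_shift _ _ (sqrt_ser_correct eta H)) as [H1 _].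
  assert (H2 : -1 <= Re (sqrt_ser eta - sqrtc 0 * eta ^ 0)%C).
  { refine (is_series_le _ _ _ _ _ is_series_sqrtc_tail H1).
    intros n. cbv beta. rewrite re_scal_l.
    generalize (sqrtc_le0 n) (Re_le_Cmod (eta ^ S n)) (Cmod_pow_le1 eta (S n) H); intros; nra. }
  simpl in H2. simpl. lra.
Qed.

Lemma sqrt_ser_Csqrt eta : Cmod eta <= 1 -> sqrt_ser eta = Csqrt (1 - eta).
Proof.
  intros H. symmetry. apply Csqrt_unique; [now apply sqrt_ser_sqr|].
  destruct (sqrt_ser_Re eta H) as [HR|HR]; [now left|right]. split; [easy|].
  assert (E := f_equal Re (sqrt_ser_sqr eta H)). rewrite re_mult, <- HR in E.
  rewrite re_minus, re_RtoC in E.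
  generalize (Re_le_Cmod eta). intros; nra.
Qed.

Definition invsqrt_ser (w : C) : C := CSeries (fun n => invsqrtc n * w ^ n)%C.

Lemma ex_series_invsqrt_ser w : Cmod w < 1 -> ex_series (fun n => Cmod (invsqrtc n * w ^ n)%C).
Proof.
  intros H. apply ex_series_dom with (fun n => Cmod w ^ n).
  - intros n. rewrite Rabs_pos_eq by apply Cmod_ge_0.
    rewrite Cmod_mult, Cmod_R, Cmod_pow, Rabs_pos_eq by apply Rlt_le, invsqrtc_gt0.
    generalize (invsqrtc_le1 n) (invsqrtc_gt0 n) (pow_le (Cmod w) n (Cmod_ge_0 w)); intros; nra.
  - apply ex_series_geom. now rewrite Rabs_pos_eq by apply Cmod_ge_0.
Qed.

Lemma invsqrt_ser_correct w : Cmod w < 1 -> is_cseries (fun n => invsqrtc n * w ^ n)%C (invsqrt_ser w).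
Proof. intros H. now apply CSeries_correct, ex_series_invsqrt_ser. Qed.

Lemma invsqrt_ser_sqr w : Cmod w < 1 -> (invsqrt_ser w * invsqrt_ser w * (1 - w))%C = 1%C.
Proof.
  intros H. assert (H1 := invsqrt_ser_correct w H). assert (H2 := ex_series_invsqrt_ser w H).
  assert (H3 := is_cseries_pmult _ _ _ _ _ H1 H1 H2 H2).
  assert (H4 := is_cseries_scal w _ _ H3).
  assert (H5 := is_cseries_shift _ _ H3).
  assert (E := fun E => is_cseries_eq _ _ _ (is_cseries_ext _ _ _ E H5) H4).
  cbv beta in E. specialize (E ltac:(intros n; rewrite !invsqrtc_conv; simpl; ring)).
  rewrite invsqrtc_conv in E. simpl in E.
  replace (invsqrt_ser w * invsqrt_ser w * (1 - w))%C with (invsqrt_ser w * invsqrt_ser w - w * (invsqrt_ser w * invsqrt_ser w))%C by ring.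
  rewrite <- E. ring.
Qed.

(** On this disc the terms beyond the first add up to at most 1/2. *)
Lemma invsqrt_ser_Re w : Cmod w <= 1 / 2 -> 0 < Re (invsqrt_ser w).
Proof.
  intros H. assert (H' : Cmod w < 1) by lra.
  assert (H1 := is_cseries_shift _ _ (invsqrt_ser_correct w H')).
  assert (H2 : Cmod (invsqrt_ser w - invsqrtc 0 * w ^ 0)%C <= 1 / 4 * / (1 - 1 / 2)).
  { refine (is_cseries_Cmod_le _ (fun n => 1 / 4 * (1 / 2) ^ n) _ _ H1 _ _).
    - intros n. rewrite Cmod_mult, Cmod_R, Cmod_pow, Rabs_pos_eq by apply Rlt_le, invsqrtc_gt0.
      assert (invsqrtc (S n) <= 1 / 2).
      { induction n as [|n IH]; [simpl; lra|]. generalize (invsqrtc_decr (S n)); lra. }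
      assert (Cmod w ^ S n <= (1 / 2) ^ S n).
      { apply pow_incr. split; [apply Cmod_ge_0|exact H]. }
      replace (1 / 4 * (1 / 2) ^ n) with (1 / 2 * (1 / 2) ^ S n) by (simpl; field).
      apply Rmult_le_compat; auto; [apply Rlt_le, invsqrtc_gt0|apply pow_le, Cmod_ge_0].
    - apply (is_series_scal (V := R_NormedModule)). apply is_series_geom. rewrite Rabs_pos_eq; lra. }
  replace (1 / 4 * / (1 - 1 / 2)) with (1 / 2) in H2 by field.
  generalize (Re_le_Cmod (invsqrt_ser w - invsqrtc 0 * w ^ 0)%C).
  replace (invsqrt_ser w - invsqrtc 0 * w ^ 0)%C with (invsqrt_ser w - 1)%C in * by (simpl; ring).
  unfold Cminus. rewrite re_plus, re_opp, re_RtoC. unfold Cminus in H2. lra.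
Qed.

(** * The elliptic integrals as series *)

Lemma is_RInt_sin_pow n :
  is_RInt (fun t => sin t ^ (2 * n)) 0 (PI / 2) (PI / 2 * invsqrtc n).
Proof.
  induction n as [|n IH].
  - simpl. rewrite Rmult_1_r.
    generalize (is_RInt_const (V := R_NormedModule) 0 (PI / 2) 1).
    change (scal (PI / 2 - 0) (1 : R_NormedModule)) with ((PI / 2 - 0) * 1).
    replace ((PI / 2 - 0) * 1) with (PI / 2) by ring. auto.
  - assert (Hn := pos_INR n).
    assert (HD : is_RInt (fun t => (2 * INR n + 1) * sin t ^ (2 * n) - (2 * INR n + 2) * sin t ^ (2 * S n))
       0 (PI / 2) (sin (PI / 2) ^ (2 * n + 1) * cos (PI / 2) - sin 0 ^ (2 * n + 1) * cos 0)).
    { apply (is_RInt_derive (V := R_CompleteNormedModule)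
         (fun t => sin t ^ (2 * n + 1) * cos t)).
      - intros t _.
        assert (H1 : is_derive (fun t => sin t ^ (2 * n + 1)) t
          (INR (2 * n + 1) * cos t * sin t ^ pred (2 * n + 1))).
        { apply is_derive_pow. auto_derive; [easy|ring]. }
        assert (H2 : is_derive cos t (- sin t)) by (auto_derive; [easy|ring]).
        evar_last; [exact (is_derive_mult _ _ _ _ _ H1 H2 Rmult_comm)|].
        replace (pred (2 * n + 1)) with (2 * n)%nat by lia.
        replace (2 * S n)%nat with (2 * n + 2)%nat by lia.
        rewrite !pow_add, plus_INR, mult_INR. change (INR 2) with 2. change (INR 1) with 1.
        unfold plus, mult; simpl plus; simpl mult.
        assert (E' : cos t * cos t = 1 - sin t * sin t).
        { generalize (sin2_cos2 t). unfold Rsqr. lra. }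
        transitivity ((2 * INR n + 1) * sin t ^ (2 * n) * (cos t * cos t)
           - sin t ^ (2 * n) * (sin t * sin t)); [simpl; ring|]. rewrite E'. simpl. ring.
      - intros t _.
        apply (ex_derive_continuous (V := R_NormedModule)). auto_derive. easy. }
    rewrite cos_PI2, sin_0, (pow_i (2 * n + 1)) in HD by lia.
    eapply is_RInt_ext.
    2:{ replace (PI / 2 * invsqrtc (S n)) with
          (/ (2 * INR n + 2) * ((2 * INR n + 1) * (PI / 2 * invsqrtc n)
             - (sin (PI / 2) ^ (2 * n + 1) * 0 - 0 * cos 0))).
        2:{ cbn [invsqrtc]. field. lra. }
        apply (is_RInt_scal (V := R_NormedModule)).
        apply (is_RInt_minus (V := R_NormedModule)).
        - apply (is_RInt_scal (V := R_NormedModule)). exact IH.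
        - exact HD. }
    intros t _. unfold scal, minus, plus, opp, mult; simpl. unfold mult; simpl. field. lra.
Qed.

Lemma sin_sq_bound t : 0 <= sin t ^ 2 <= 1.
Proof.
  generalize (SIN_bound t); intros. split; [apply pow2_ge_0|]. nra.
Qed.

(** Termwise integration of the binomial series of the integrand. *)
Lemma EllipticK_series (k m : C) : (k * k)%C = m -> Cmod m <= 1 / 2 ->
  is_cseries (fun n => RtoC (invsqrtc n ^ 2) * m ^ n)%C (RtoC (2 / PI) * EllipticK k)%C.
Proof.
  intros Hk Hm. assert (Hpi := PI_RGT_0).
  destruct (is_RInt_cseries
    (fun n t => RtoC (invsqrtc n * sin t ^ (2 * n)) * m ^ n)%C
    (fun t => / Csqrt (1 - k * k * RtoC (sin t ^ 2)))%C
    (fun n => (1 / 2) ^ n)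
    (fun n => RtoC (PI / 2 * invsqrtc n ^ 2) * m ^ n)%C 0 (PI / 2)) as [S [HS1 HS2]].
  - lra.
  - intros n t _. rewrite Cmod_mult, Cmod_R, Cmod_pow.
    assert (0 <= invsqrtc n * sin t ^ (2 * n) <= 1).
    { rewrite pow_mult. assert (0 <= (sin t ^ 2) ^ n <= 1).
      { split; [apply pow_le, pow2_ge_0|]. rewrite <- (pow1 n). apply pow_incr, sin_sq_bound. }
      generalize (invsqrtc_gt0 n) (invsqrtc_le1 n); intros; nra. }
    rewrite Rabs_pos_eq by lra.
    assert (Cmod m ^ n <= (1 / 2) ^ n) by (apply pow_incr; split; [apply Cmod_ge_0|lra]).
    generalize (pow_le (Cmod m) n (Cmod_ge_0 m)); intros; nra.
  - apply ex_series_geom. rewrite Rabs_pos_eq; lra.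
  - intros t _. rewrite Hk.
    assert (Hw : Cmod (m * RtoC (sin t ^ 2)) <= 1 / 2).
    { rewrite Cmod_mult, Cmod_R. generalize (sin_sq_bound t) (Cmod_ge_0 m); intros.
      rewrite Rabs_pos_eq; [|lra]. nra. }
    set (w := (m * RtoC (sin t ^ 2))%C) in *.
    assert (E := invsqrt_ser_sqr w ltac:(lra)). assert (HR := invsqrt_ser_Re w Hw).
    assert (Hn : invsqrt_ser w <> 0%C) by (apply C_neq0_Re; lra).
    assert (Hn1 : (1 - w)%C <> 0%C).
    { intros E0. rewrite E0 in E. apply (f_equal Re) in E. simpl in E. lra. }
    assert (ES : Csqrt (1 - w) = (/ invsqrt_ser w)%C).
    { apply Csqrt_unique.
      - transitivity (invsqrt_ser w * invsqrt_ser w * (1 - w) * / (invsqrt_ser w * invsqrt_ser w))%C;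
          [rewrite E|]; field; exact Hn.
      - left. change (0 < Re (invsqrt_ser w) / (Re (invsqrt_ser w) ^ 2 + Im (invsqrt_ser w) ^ 2)).
        apply Rdiv_lt_0_compat; [exact HR|]. nra. }
    rewrite ES.
    replace (/ / invsqrt_ser w)%C with (invsqrt_ser w) by (field; exact Hn).
    eapply is_cseries_ext; [|apply invsqrt_ser_correct; lra].
    intros n. unfold w. rewrite Cpow_mult_l, <- RtoC_pow, <- pow_mult, RtoC_mult. ring.
  - intros n.
    apply is_RInt_ext with (fun t => m ^ n * RtoC (invsqrtc n * sin t ^ (2 * n)))%C.
    { intros; apply Cmult_comm. }
    rewrite Cmult_comm. apply is_RInt_cscal, is_RInt_RtoC.
    replace (PI / 2 * invsqrtc n ^ 2) with (invsqrtc n * (PI / 2 * invsqrtc n)) by ring.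
    apply (is_RInt_scal (V := R_NormedModule)), is_RInt_sin_pow.
  - assert (E : EllipticK k = S) by (now apply RInt_C_unique).
    rewrite E. eapply is_cseries_ext; [|exact (is_cseries_scal (RtoC (2 / PI)) _ _ HS2)].
    intros n. cbv beta. rewrite Cmult_assoc, <- RtoC_mult. f_equal. f_equal. field. lra.
Qed.

(** The series of E(sqrt (1 - x)) in powers of 1 - x; it converges on [0, 1]. *)
Definition ellE (x : R) : R := Series (fun n => PI / 2 * (sqrtc n * invsqrtc n) * (1 - x) ^ n).

Lemma ex_series_sqrtc_invsqrtc : ex_series (fun n => Rabs (PI / 2 * (sqrtc n * invsqrtc n))).
Proof.
  assert (Hpi := PI_RGT_0).
  apply ex_series_dom with (fun n => PI / 2 * Rabs (sqrtc n)).
  - intros n. rewrite Rabs_Rabsolu, !Rabs_mult, (Rabs_pos_eq (PI / 2)) by lra.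
    rewrite (Rabs_pos_eq (invsqrtc n)) by apply Rlt_le, invsqrtc_gt0.
    generalize (invsqrtc_le1 n) (invsqrtc_gt0 n) (Rabs_pos (sqrtc n)); intros.
    apply Rmult_le_compat_l; nra.
  - apply (ex_series_scal (V := R_NormedModule)). exact ex_series_sqrtc.
Qed.

Lemma ellE_series x : 0 <= x <= 1 ->
  is_series (fun n => PI / 2 * (sqrtc n * invsqrtc n) * (1 - x) ^ n) (ellE x).
Proof.
  intros Hx. apply Series_correct, ex_series_Rabs.
  refine (ex_series_dom _ _ _ ex_series_sqrtc_invsqrtc).
  intros n. rewrite Rabs_Rabsolu, Rabs_mult.
  assert (0 <= (1 - x) ^ n <= 1).
  { apply pow_unit; lra. }
  rewrite (Rabs_pos_eq ((1 - x) ^ n)) by lra.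
  generalize (Rabs_pos (PI / 2 * (sqrtc n * invsqrtc n))); intros; nra.
Qed.

Lemma EllipticE_ellE x : 0 <= x <= 1 -> EllipticE (RtoC (sqrt (1 - x))) = RtoC (ellE x).
Proof.
  intros Hx. assert (Hpi := PI_RGT_0).
  destruct (is_RInt_cseries
    (fun n t => RtoC (sqrtc n * ((1 - x) * sin t ^ 2) ^ n))
    (fun t => Csqrt (1 - RtoC (sqrt (1 - x)) * RtoC (sqrt (1 - x)) * RtoC (sin t ^ 2)))%C
    (fun n => Rabs (sqrtc n))
    (fun n => RtoC (PI / 2 * (sqrtc n * invsqrtc n) * (1 - x) ^ n)) 0 (PI / 2)) as [S [HS1 HS2]].
  - lra.
  - intros n t _. rewrite Cmod_R, Rabs_mult.
    generalize (sin_sq_bound t); intros.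
    assert (0 <= ((1 - x) * sin t ^ 2) ^ n <= 1).
    { apply pow_unit; nra. }
    rewrite (Rabs_pos_eq (_ ^ n)) by lra. generalize (Rabs_pos (sqrtc n)); intros; nra.
  - exact ex_series_sqrtc.
  - intros t _. rewrite <- RtoC_mult, sqrt_sqrt by lra.
    generalize (sin_sq_bound t); intros.
    rewrite <- RtoC_mult, <- sqrt_ser_Csqrt.
    2:{ rewrite Cmod_R, Rabs_pos_eq; nra. }
    eapply is_cseries_ext; [|apply sqrt_ser_correct].
    2:{ rewrite Cmod_R, Rabs_pos_eq; nra. }
    intros n. cbv beta. rewrite <- RtoC_pow, <- RtoC_mult. reflexivity.
  - intros n. apply is_RInt_RtoC.
    apply is_RInt_ext_R with (fun t => sqrtc n * (1 - x) ^ n * sin t ^ (2 * n)).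
    { intros t. rewrite Rpow_mult_distr, pow_mult. ring. }
    replace (PI / 2 * (sqrtc n * invsqrtc n) * (1 - x) ^ n) with
      (sqrtc n * (1 - x) ^ n * (PI / 2 * invsqrtc n)) by ring.
    apply (is_RInt_scal (V := R_NormedModule)), is_RInt_sin_pow.
  - assert (E : EllipticE (RtoC (sqrt (1 - x))) = S) by (now apply RInt_C_unique).
    rewrite E. apply (is_cseries_eq _ _ _ HS2).
    split; simpl; [now apply ellE_series|exact is_series_zero].
Qed.

(** * Moments of the complementary integral of the second kind *)

Fixpoint beta_val (j n : nat) : R :=
  match n with
  | O => / (INR j + 1)
  | S m => beta_val j m * ((INR m + 1) / (INR j + INR m + 2))
  end.

Lemma is_RInt_beta j n : is_RInt (fun x => x ^ j * (1 - x) ^ n) 0 1 (beta_val j n).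
Proof.
  assert (Hj := pos_INR j).
  induction n as [|n IH].
  - simpl. replace (/ (INR j + 1)) with (1 ^ (S j) / (INR j + 1) - 0 ^ (S j) / (INR j + 1)).
    2:{ rewrite pow1, pow_i by lia. field. lra. }
    apply (is_RInt_derive (V := R_CompleteNormedModule) (fun x => x ^ (S j) / (INR j + 1))).
    + intros x _. auto_derive; [easy|]. destruct j; simpl; [field|]. simpl in Hj. field. lra.
    + intros x _. apply (ex_derive_continuous (V := R_NormedModule)). auto_derive. easy.
  - assert (Hn := pos_INR n).
    assert (HD : is_RInt (fun x => (INR j + INR n + 2) * (x ^ j * (1 - x) ^ S n)
        - (INR n + 1) * (x ^ j * (1 - x) ^ n)) 0 1 (1 ^ S j * (1 - 1) ^ S n - 0 ^ S j * (1 - 0) ^ S n)).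
    { apply (is_RInt_derive (V := R_CompleteNormedModule) (fun x => x ^ S j * (1 - x) ^ S n)).
      - intros x _. auto_derive; [easy|].
        assert (E : forall m, match m with O => 1 | S _ => INR m + 1 end = INR m + 1)
          by exact S_INR.
        rewrite !E. replace (1 + - x) with (1 - x) by ring. simpl. ring.
      - intros x _. apply (ex_derive_continuous (V := R_NormedModule)). auto_derive. easy. }
    eapply is_RInt_ext.
    2:{ replace (beta_val j (S n)) with
          (/ (INR j + INR n + 2) * ((1 ^ S j * (1 - 1) ^ S n - 0 ^ S j * (1 - 0) ^ S n)
             + (INR n + 1) * beta_val j n)).
        2:{ cbn [beta_val]. simpl. field. lra. }
        apply (is_RInt_scal (V := R_NormedModule)).
        apply (is_RInt_plus (V := R_NormedModule)); [exact HD|].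
        apply (is_RInt_scal (V := R_NormedModule)). exact IH. }
    intros t _. unfold scal, plus, mult; simpl. unfold mult; simpl. field. lra.
Qed.

Lemma beta_val_pos j n : 0 < beta_val j n <= 1.
Proof.
  assert (Hj := pos_INR j). induction n as [|n IH]; cbn [beta_val].
  - split; [apply Rinv_0_lt_compat; lra|]. rewrite <- Rinv_1. apply Rinv_le_contravar; lra.
  - assert (Hn := pos_INR n).
    assert (0 < (INR n + 1) / (INR j + INR n + 2) <= 1).
    { split; [apply Rdiv_lt_0_compat; lra|].
      apply Rmult_le_reg_r with (INR j + INR n + 2); [lra|]. field_simplify; lra. }
    split; [apply Rmult_lt_0_compat; lra|]. nra.
Qed.

Lemma beta_val_S j n : beta_val (S j) n * (INR j + INR n + 2) = beta_val j n * (INR j + 1).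
Proof.
  assert (Hj := pos_INR j). induction n as [|n IH]; cbn [beta_val]; rewrite ?S_INR.
  - change (INR 0) with 0. field. lra.
  - assert (Hn := pos_INR n).
    transitivity (beta_val (S j) n * (INR j + INR n + 2) * ((INR n + 1) / (INR j + INR n + 2))).
    + field. lra.
    + rewrite IH. field. lra.
Qed.

Lemma ellE_moment_ex j :
  exists S : R, is_RInt (fun x => x ^ j * ellE x) 0 1 S /\
    is_series (fun n => PI / 2 * (sqrtc n * invsqrtc n) * beta_val j n) S.
Proof.
  apply (is_RInt_series (fun n x => PI / 2 * (sqrtc n * invsqrtc n) * (x ^ j * (1 - x) ^ n))
    (fun x => x ^ j * ellE x) (fun n => Rabs (PI / 2 * (sqrtc n * invsqrtc n)))
    (fun n => PI / 2 * (sqrtc n * invsqrtc n) * beta_val j n)).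
  - lra.
  - intros n x Hx. rewrite Rabs_mult.
    assert (0 <= x ^ j * (1 - x) ^ n <= 1).
    { assert (0 <= x ^ j <= 1).
      { apply pow_unit; lra. }
      assert (0 <= (1 - x) ^ n <= 1).
      { apply pow_unit; lra. }
      nra. }
    rewrite (Rabs_pos_eq (x ^ j * _)) by lra.
    generalize (Rabs_pos (PI / 2 * (sqrtc n * invsqrtc n))); intros; nra.
  - exact ex_series_sqrtc_invsqrtc.
  - intros x Hx. eapply is_series_ext.
    2:{ apply (is_series_scal (V := R_NormedModule)). exact (ellE_series x Hx). }
    intros n. unfold scal; simpl; unfold mult; simpl. ring.
  - intros n. apply (is_RInt_scal (V := R_NormedModule)), is_RInt_beta.
Qed.

Lemma is_lim_sqrtc_n : is_lim_seq (fun n => INR n * (sqrtc n * invsqrtc n)) 0.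
Proof.
  apply <- is_lim_seq_incr_1.
  apply (is_lim_seq_le_le (fun n => - invsqrtc n) _ invsqrtc).
  - intros n. rewrite sqrtc_S, S_INR. assert (Hn := pos_INR n).
    replace ((INR n + 1) * (- (invsqrtc n / (2 * INR n + 2)) * invsqrtc (S n)))
      with (- (invsqrtc n / 2 * invsqrtc (S n))) by (field; lra).
    generalize (invsqrtc_gt0 n) (invsqrtc_gt0 (S n)) (invsqrtc_le1 (S n)); intros; nra.
  - replace (Finite 0) with (Rbar_opp 0) by (simpl; f_equal; ring).
    apply -> is_lim_seq_opp. exact is_lim_invsqrtc.
  - exact is_lim_invsqrtc.
Qed.

Lemma is_series_telescope (f G : nat -> R) : (forall n, f n = G (S n) - G n) ->
  is_lim_seq G 0 -> is_series f (- G O).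
Proof.
  intros H HG. change (is_lim_seq (sum_n f) (- G O)).
  apply is_lim_seq_ext with (fun n => G (S n) - G O).
  - intros n. rewrite sum_n_Reals. symmetry. now apply sum_telescope.
  - replace (- G O) with (0 - G O) by ring.
    apply is_lim_seq_minus'; [|apply is_lim_seq_const].
    now apply -> is_lim_seq_incr_1.
Qed.

(** E(1) is the integral of the cosine. *)
Lemma ellE_0 : ellE 0 = 1.
Proof.
  assert (Hpi := PI_RGT_0).
  assert (E := EllipticE_ellE 0 ltac:(lra)).
  assert (H : is_RInt (V := C_R_NormedModule)
    (fun th : R => Csqrt (1 - RtoC (sqrt (1 - 0)) * RtoC (sqrt (1 - 0)) * RtoC (sin th ^ 2))%C)
    0 (PI / 2) (RtoC 1)).
  { apply is_RInt_ext with (fun t => RtoC (cos t)).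
    - intros t. rewrite Rmin_left, Rmax_right by lra. intros Ht.
      rewrite <- RtoC_mult, sqrt_sqrt by lra. symmetry. apply Csqrt_unique.
      + apply C_ext; simpl; generalize (sin2_cos2 t); unfold Rsqr; intros; nra.
      + left. simpl. apply cos_gt_0; lra.
    - apply is_RInt_RtoC.
      replace 1 with (sin (PI / 2) - sin 0) by (rewrite sin_PI2, sin_0; ring).
      apply (is_RInt_derive (V := R_CompleteNormedModule) sin cos).
      + intros; auto_derive; [easy|ring].
      + intros. apply (ex_derive_continuous (V := R_NormedModule)). auto_derive. easy. }
  apply RInt_C_unique in H. unfold EllipticE in E. rewrite E in H.
  now apply (f_equal Re) in H.
Qed.

Lemma sqrtc_invsqrtc_ratio n : sqrtc (S n) * invsqrtc (S n) * (INR n + 1) ^ 2 = sqrtc n * invsqrtc n * (INR n ^ 2 - 1 / 4).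
Proof.
  destruct n as [|n]; [simpl; lra|].
  rewrite !sqrtc_S. cbn [invsqrtc]. rewrite !S_INR. assert (Hn := pos_INR n). field. lra.
Qed.

(** The moments satisfy (j + 5/2)(j + 3/2) m_(j+1) = (j + 1)(j + 2) m_j because the difference
    of the two series telescopes, [G] being the certificate. *)
Lemma ellE_moment j :
  is_RInt (fun x => x ^ j * ellE x) 0 1
    (4 * (INR j + 1) / ((2 * INR j + 1) ^ 2 * (2 * INR j + 3)) / invsqrtc j ^ 2).
Proof.
  assert (Hpi := PI_RGT_0).
  destruct (ellE_moment_ex j) as [S [H1 H2]].
  replace (4 * (INR j + 1) / ((2 * INR j + 1) ^ 2 * (2 * INR j + 3)) / invsqrtc j ^ 2) with S; [exact H1|].
  clear H1. revert S H2. induction j as [|j IH]; intros S H2.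
  - (* The recurrence at j = -1, where the term in the divergent moment drops out and E(1) = 1 remains. *)
    assert (H3 : is_series (fun n => 3 / 4 * (PI / 2 * (sqrtc n * invsqrtc n) * beta_val 0 n)
        - PI / 2 * (sqrtc n * invsqrtc n) * (1 - 0) ^ n) (3 / 4 * S - 1)).
    { apply (is_series_minus (V := R_NormedModule)
        (fun n => 3 / 4 * (PI / 2 * (sqrtc n * invsqrtc n) * beta_val 0 n))
        (fun n => PI / 2 * (sqrtc n * invsqrtc n) * (1 - 0) ^ n)).
      - now apply (is_series_scal (V := R_NormedModule)).
      - assert (Hc := ellE_series 0 ltac:(lra)). rewrite ellE_0 in Hc. exact Hc. }
    assert (H4 : is_series (fun n => 3 / 4 * (PI / 2 * (sqrtc n * invsqrtc n) * beta_val 0 n)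
        - PI / 2 * (sqrtc n * invsqrtc n) * (1 - 0) ^ n) (- (PI / 2 * (INR 0 * (sqrtc 0 * invsqrtc 0))))).
    { apply (is_series_telescope _ (fun n => PI / 2 * (INR n * (sqrtc n * invsqrtc n)))).
      - intros n. assert (Hn := pos_INR n). rewrite Rminus_0_r, pow1.
        assert (E : sqrtc (Datatypes.S n) * invsqrtc (Datatypes.S n) = sqrtc n * invsqrtc n * (INR n ^ 2 - 1 / 4) / (INR n + 1) ^ 2).
        { rewrite <- sqrtc_invsqrtc_ratio. field. lra. }
        rewrite E, S_INR.
        assert (Eb : beta_val 0 n = / (INR n + 1)).
        { clear. induction n as [|n IH]; [simpl; field|]. cbn [beta_val].
          rewrite IH, S_INR. change (INR 0) with 0. assert (Hn := pos_INR n). field. lra. }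
        rewrite Eb. field. lra.
      - replace (Finite 0) with (Rbar_mult (PI / 2) 0) by (simpl; f_equal; ring).
        apply is_lim_seq_scal_l. exact is_lim_sqrtc_n. }
    apply is_series_unique in H3. apply is_series_unique in H4. rewrite H3 in H4.
    simpl in H4. simpl. field_simplify. lra.
  - destruct (ellE_moment_ex j) as [T [_ HT]].
    specialize (IH T HT). assert (Hj := pos_INR j).
    assert (H3 : is_series (fun n => (INR j + 5 / 2) * (INR j + 3 / 2) * (PI / 2 * (sqrtc n * invsqrtc n) * beta_val (Datatypes.S j) n)
        - (INR j + 1) * (INR j + 2) * (PI / 2 * (sqrtc n * invsqrtc n) * beta_val j n))
        ((INR j + 5 / 2) * (INR j + 3 / 2) * S - (INR j + 1) * (INR j + 2) * T)).
    { apply (is_series_minus (V := R_NormedModule)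
        (fun n => (INR j + 5 / 2) * (INR j + 3 / 2) * (PI / 2 * (sqrtc n * invsqrtc n) * beta_val (Datatypes.S j) n))
        (fun n => (INR j + 1) * (INR j + 2) * (PI / 2 * (sqrtc n * invsqrtc n) * beta_val j n)));
      now apply (is_series_scal (V := R_NormedModule)). }
    set (G := fun n => (INR j + 1) * (PI / 2) * (INR n * (sqrtc n * invsqrtc n)) * beta_val j n).
    assert (H4 : is_series (fun n => (INR j + 5 / 2) * (INR j + 3 / 2) * (PI / 2 * (sqrtc n * invsqrtc n) * beta_val (Datatypes.S j) n)
        - (INR j + 1) * (INR j + 2) * (PI / 2 * (sqrtc n * invsqrtc n) * beta_val j n)) (- G O)).
    { apply is_series_telescope.
      - intros n. assert (Hn := pos_INR n). unfold G.
        assert (E : sqrtc (Datatypes.S n) * invsqrtc (Datatypes.S n) = sqrtc n * invsqrtc n * (INR n ^ 2 - 1 / 4) / (INR n + 1) ^ 2).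
        { rewrite <- sqrtc_invsqrtc_ratio. field. lra. }
        rewrite E, S_INR.
        assert (Eb : beta_val (Datatypes.S j) n = beta_val j n * (INR j + 1) / (INR j + INR n + 2)).
        { rewrite <- beta_val_S. field. lra. }
        rewrite Eb. cbn [beta_val]. field. lra.
      - apply is_lim_seq_abs_0.
        apply (is_lim_seq_le_le (fun _ => 0) _ (fun n => (INR j + 1) * (PI / 2) * Rabs (INR n * (sqrtc n * invsqrtc n)))).
        + intros n. split; [apply Rabs_pos|]. unfold G. rewrite Rabs_mult, (Rabs_mult ((INR j + 1) * (PI / 2))).
          rewrite (Rabs_pos_eq ((INR j + 1) * (PI / 2))) by nra.
          destruct (beta_val_pos j n). rewrite (Rabs_pos_eq (beta_val j n)) by lra.
          generalize (Rabs_pos (INR n * (sqrtc n * invsqrtc n))); intros.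
          assert (0 <= (INR j + 1) * (PI / 2) * Rabs (INR n * (sqrtc n * invsqrtc n))) by (apply Rmult_le_pos; nra).
          nra.
        + apply is_lim_seq_const.
        + replace (Finite 0) with (Rbar_mult ((INR j + 1) * (PI / 2)) 0) by (simpl; f_equal; ring).
          apply is_lim_seq_scal_l. apply -> is_lim_seq_abs_0. exact is_lim_sqrtc_n. }
    apply is_series_unique in H3. apply is_series_unique in H4. rewrite H3 in H4.
    unfold G in H4. change (INR 0) with 0 in H4. rewrite IH in H4.
    assert (Hb := invsqrtc_gt0 j). cbn [invsqrtc]. rewrite !S_INR.
    apply Rmult_eq_reg_l with ((INR j + 5 / 2) * (INR j + 3 / 2)); [|nra].
    transitivity ((INR j + 1) * (INR j + 2) *
     (4 * (INR j + 1) / ((2 * INR j + 1) ^ 2 * (2 * INR j + 3)) / invsqrtc j ^ 2)); [lra|].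
    field. repeat split; lra.
Qed.

(** * The square of the integral of the first kind *)

Lemma sum_swap (f : nat -> nat -> R) n m :
  sum_f_R0 (fun i => sum_f_R0 (fun j => f i j) m) n =
  sum_f_R0 (fun j => sum_f_R0 (fun i => f i j) n) m.
Proof.
  induction n as [|n IH]; [reflexivity|].
  rewrite tech5, IH, <- plus_sum. apply sum_eq. intros j _. now rewrite tech5.
Qed.

Lemma sum_extend (f : nat -> R) n m :
  (forall k, (n < k)%nat -> f k = 0) -> (n <= m)%nat -> sum_f_R0 f m = sum_f_R0 f n.
Proof.
  intros H Hm. induction Hm as [|m Hm IH]; [reflexivity|].
  rewrite tech5, IH, H by lia. ring.
Qed.

Lemma is_lim_sum (f : nat -> nat -> R) (L : nat -> R) T :
  (forall l, is_lim_seq (f l) (L l)) ->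
  is_lim_seq (fun n => sum_f_R0 (fun l => f l n) T) (sum_f_R0 L T).
Proof.
  intros H. induction T as [|T IH]; [apply H|].
  rewrite tech5. apply is_lim_seq_plus'; [exact IH|apply H].
Qed.

(** Dominated convergence for double series: summing first over [N] and first over [l] gives the
    same. *)
Lemma tannery_triangle (A : nat -> R) (b : nat -> nat -> R) (B X L : nat -> R) :
  (forall l, 0 <= A l) -> (forall N l, 0 <= b N l) ->
  (forall N l, (N < l)%nat -> b N l = 0) ->
  (forall l, is_series (fun N => b N l) (B l)) ->
  ex_series (fun l => A l * B l) ->
  (forall N, Rabs (X N) <= 1) ->
  (forall l, is_series (fun N => b N l * X N) (L l)) ->
  is_series (fun N => sum_f_R0 (fun l => A l * b N l) N * X N) (Series (fun l => A l * L l)).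
Proof.
  intros HA Hb Hb0 HB HAB HX HL.
  set (sg := fun l n => sum_f_R0 (fun N => b N l * X N) n).
  assert (Hsg : forall l n, Rabs (sg l n) <= B l).
  { intros l n. unfold sg. eapply Rle_trans; [apply sum_f_R0_triangle|].
    apply Rle_trans with (sum_f_R0 (fun N => b N l) n).
    - apply sum_Rle. intros N _. rewrite Rabs_mult, (Rabs_pos_eq (b N l)) by apply Hb.
      generalize (HX N) (Hb N l); intros; nra.
    - rewrite <- sum_n_Reals.
      apply (is_lim_seq_incr_compare (sum_n (fun N => b N l)) (B l)); [exact (HB l)|].
      intros k. rewrite sum_Sn. unfold plus; simpl. generalize (Hb (S k) l); lra. }
  assert (Hsg0 : forall l n, (n < l)%nat -> sg l n = 0).
  { intros l n Hn. unfold sg. rewrite (sum_eq _ (fun _ => 0 * 0)).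
    - rewrite sum_scal_l. ring.
    - intros N HN. rewrite Hb0 by lia. ring. }
  assert (Hpart : forall n, sum_n (fun N => sum_f_R0 (fun l => A l * b N l) N * X N) n
      = sum_f_R0 (fun l => A l * sg l n) n).
  { intros n. rewrite sum_n_Reals.
    rewrite (sum_eq _ (fun N => sum_f_R0 (fun l => A l * (b N l * X N)) n)).
    - rewrite sum_swap. apply sum_eq. intros l _. unfold sg. now rewrite sum_scal_l.
    - intros N HN. rewrite <- (sum_extend (fun l => A l * b N l) N n) by
        (try assumption; intros; rewrite Hb0 by assumption; ring).
      rewrite Rmult_comm, <- sum_scal_l. apply sum_eq. intros; ring. }
  assert (HLs : is_lim_seq (fun T => sum_f_R0 (fun l => A l * L l) T) (Series (fun l => A l * L l))).
  { assert (Hex : is_series (fun l => A l * L l) (Series (fun l => A l * L l))).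
    { apply Series_correct. refine (ex_series_dom _ _ _ HAB). intros l.
      rewrite Rabs_mult, Rabs_pos_eq by apply HA. apply Rmult_le_compat_l; [apply HA|].
      assert (Hl : is_lim_seq (fun n => Rabs (sg l n)) (Rabs (L l))).
      { apply (is_lim_seq_abs _ (L l)). apply is_lim_seq_ext with (2 := HL l).
        intros n. now rewrite sum_n_Reals. }
      exact (is_lim_seq_le _ (fun _ => B l) _ _ (Hsg l) Hl (is_lim_seq_const _)). }
    apply is_lim_seq_ext with (2 := Hex). intros n. now rewrite sum_n_Reals. }
  destruct (filterlim_switch (U := R_CompleteSpace) eventually _ eventually _
     (fun T n => sum_f_R0 (fun l => A l * sg l n) T)
     (fun n => sum_f_R0 (fun l => A l * sg l n) n)
     (fun T => sum_f_R0 (fun l => A l * L l) T)) as [z [Hz1 Hz2]].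
  - apply filterlim_locally. intros eps.
    destruct (series_tail_unif _ eps HAB (cond_pos eps)) as [N HN].
    exists N. intros T HT n.
    change (Rabs (sum_f_R0 (fun l => A l * sg l n) T - sum_f_R0 (fun l => A l * sg l n) n) < eps).
    rewrite <- !sum_n_Reals. apply (HN (fun l => A l * sg l n)); [| |exact HT].
    + intros l. rewrite Rabs_mult, Rabs_pos_eq by apply HA.
      apply Rmult_le_compat_l; [apply HA|apply Hsg].
    + apply is_series_finite. intros l Hl. rewrite Hsg0 by exact Hl. ring.
  - intros T. apply (is_lim_sum (fun l n => A l * sg l n)). intros l.
    apply (is_lim_seq_scal_l _ (A l) (L l)).
    apply is_lim_seq_ext with (2 := HL l). intros n. now rewrite sum_n_Reals.
  - assert (E : z = Series (fun l => A l * L l)).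
    { apply is_lim_seq_unique in HLs. change (is_lim_seq (fun T => sum_f_R0 (fun l => A l * L l) T) z) in Hz1.
      apply is_lim_seq_unique in Hz1. rewrite Hz1 in HLs. now injection HLs. }
    subst z.
    change (is_lim_seq (sum_n (fun N => sum_f_R0 (fun l => A l * b N l) N * X N))
       (Series (fun l => A l * L l))).
    eapply is_lim_seq_ext; [|exact Hz2]. intros n. now rewrite Hpart.
Qed.

Lemma tannery_triangle_C (A : nat -> R) (b : nat -> nat -> R) (B : nat -> R) (X L : nat -> C) (T : C) :
  (forall l, 0 <= A l) -> (forall N l, 0 <= b N l) ->
  (forall N l, (N < l)%nat -> b N l = 0) ->
  (forall l, is_series (fun N => b N l) (B l)) ->
  ex_series (fun l => A l * B l) ->
  (forall N, Cmod (X N) <= 1) ->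
  (forall l, is_cseries (fun N => b N l * X N)%C (L l)) ->
  is_cseries (fun l => A l * L l)%C T ->
  is_cseries (fun N => RtoC (sum_f_R0 (fun l => (A l * b N l)%R) N) * X N)%C T.
Proof.
  intros HA Hb Hb0 HB HAB HX HL [HR HI].
  split.
  - rewrite <- (is_series_unique _ _ HR). erewrite Series_ext by (intros; apply re_scal_l).
    eapply is_series_ext; [intros N; symmetry; apply re_scal_l|].
    apply (tannery_triangle A b B); try assumption.
    + intros N. eapply Rle_trans; [apply re_le_Cmod|apply HX].
    + intros l. destruct (HL l) as [Hl _].
      eapply is_series_ext; [|exact Hl]. intros N. apply re_scal_l.
  - rewrite <- (is_series_unique _ _ HI). erewrite Series_ext by (intros; apply im_scal_l).
    eapply is_series_ext; [intros N; symmetry; apply im_scal_l|].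
    apply (tannery_triangle A b B); try assumption.
    + intros N. apply Rle_trans with (Cmod (X N)); [apply Rabs_le, Im_le_Cmod|apply HX].
    + intros l. destruct (HL l) as [_ Hl].
      eapply is_series_ext; [|exact Hl]. intros N. apply im_scal_l.
Qed.

(** The root m of 4m(1 - m) = eta that vanishes at 0. *)
Definition halfroot (eta : C) : C := ((1 - sqrt_ser eta) / 2)%C.

Lemma halfroot_sqr eta : Cmod eta <= 1 ->
  (halfroot eta * halfroot eta = halfroot eta - eta / 4)%C.
Proof.
  intros H. unfold halfroot.
  replace ((1 - sqrt_ser eta) / 2 * ((1 - sqrt_ser eta) / 2))%C with
    ((1 - 2 * sqrt_ser eta + sqrt_ser eta * sqrt_ser eta) / 4)%C by field.
  rewrite sqrt_ser_sqr by exact H. field.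
Qed.

Lemma ballot_series l eta : Cmod eta <= 1 ->
  is_cseries (fun N => ballot N l * eta ^ S N)%C (halfroot eta ^ S l)%C.
Proof.
  intros H.
  assert (H0 : is_cseries (fun N => ballot N 0 * eta ^ S N)%C (halfroot eta)).
  { assert (H1 := is_cseries_scal (RtoC (- / 2)) _ _ (is_cseries_shift _ _ (sqrt_ser_correct eta H))).
    replace (halfroot eta) with (RtoC (- / 2) * (sqrt_ser eta - sqrtc 0 * eta ^ 0))%C.
    - eapply is_cseries_ext; [|exact H1]. intros N. cbv beta.
      rewrite sqrtc_S, Cmult_assoc, <- RtoC_mult. f_equal. f_equal. cbn [ballot].
      assert (HN := pos_INR N). field. lra.
    - unfold halfroot. rewrite RtoC_opp, RtoC_inv by lra. simpl. field. }
  assert (Hl : is_cseries (fun N => ballot N l * eta ^ S N)%C (halfroot eta ^ S l)%C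
     /\ is_cseries (fun N => ballot N (S l) * eta ^ S N)%C (halfroot eta ^ S (S l))%C).
  { induction l as [|l [IH1 IH2]].
    - split; [simpl; now rewrite Cmult_1_r|].
      set (f := fun N => match N with O => (- eta / 4)%C | _ => RtoC 0 end).
      assert (Hf : is_cseries f (- eta / 4)%C).
      { replace (- eta / 4)%C with (f 0%nat + f 1%nat)%C by (simpl; ring).
        apply is_cseries_two. reflexivity. }
      assert (H1 := is_cseries_plus _ _ _ _ H0 Hf).
      replace (halfroot eta ^ 2)%C with (halfroot eta + - eta / 4)%C.
      2:{ simpl. rewrite Cmult_1_r, halfroot_sqr by exact H. field. }
      eapply is_cseries_ext; [|exact H1]. intros N. cbv beta. rewrite ballot_rec0.
      destruct N as [|N]; unfold f.
      + rewrite RtoC_minus, RtoC_div by lra. simpl. field.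
      + rewrite Rminus_0_r. ring.
    - split; [exact IH2|].
      assert (H1 := is_cseries_shift _ _ IH2). cbv beta in H1.
      assert (H2 := is_cseries_plus _ _ _ _ H1 (is_cseries_scal (- eta / 4)%C _ _ IH1)).
      rewrite (ballot_out 0 (S l)) in H2 by lia.
      replace (halfroot eta ^ S (S (S l)))%C with
        ((halfroot eta ^ S (S l) - 0 * eta ^ 1) + - eta / 4 * halfroot eta ^ S l)%C.
      2:{ change (halfroot eta ^ S (S (S l)))%C with
            (halfroot eta * (halfroot eta * halfroot eta ^ S l))%C.
          rewrite Cmult_assoc, halfroot_sqr by exact H.
          change (halfroot eta ^ S (S l))%C with (halfroot eta * halfroot eta ^ S l)%C.
          field. }
      set (g := fun N => (ballot N (S (S l)) * eta ^ S N)%C).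
      assert (Hg0 : g O = 0%C) by (unfold g; rewrite ballot_out by lia; ring).
      assert (Hg : is_cseries (fun N => g (S N)) (halfroot eta ^ S (S l) - 0 * eta ^ 1 + - eta / 4 * halfroot eta ^ S l)%C).
      { eapply is_cseries_ext; [|exact H2]. intros N. unfold g. cbv beta.
        rewrite ballot_rec, RtoC_minus, RtoC_div by lra. simpl. field. }
      apply is_cseries_unshift in Hg. rewrite Hg0 in Hg.
      now rewrite Cplus_0_l in Hg. }
  apply Hl.
Qed.

Lemma sqrt_ser_1 : sqrt_ser 1 = 0%C.
Proof.
  assert (H : Cmod 1 <= 1) by (rewrite Cmod_1; lra).
  rewrite (sqrt_ser_Csqrt 1 H). replace (1 - 1)%C with (RtoC 0) by ring. apply Csqrt_0.
Qed.

Lemma ballot_total l : is_series (fun N => ballot N l) ((1 / 2) ^ S l).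
Proof.
  destruct (ballot_series l 1) as [H _]; [rewrite Cmod_1; lra|].
  unfold halfroot in H. rewrite sqrt_ser_1 in H.
  replace ((1 - 0) / 2)%C with (RtoC (1 / 2)) in H by (rewrite RtoC_div by lra; field).
  rewrite <- RtoC_pow in H. simpl Re in H at 2.
  eapply is_series_ext; [|exact H]. intros N. cbv beta. rewrite Cpow_1_l, Cmult_1_r. reflexivity.
Qed.

Lemma halfroot_bound eta : Cmod eta <= 1 -> Cmod (halfroot eta) <= 1 / 2.
Proof.
  intros H. assert (Hs := ballot_series 0 eta H).
  assert (HT := ballot_total 0). rewrite !pow_1 in HT.
  replace (halfroot eta ^ 1)%C with (halfroot eta) in Hs by (simpl; ring).
  refine (is_cseries_Cmod_le _ _ _ _ Hs _ HT). intros N.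
  rewrite Cmod_mult, Cmod_R, Rabs_pos_eq by apply ballot_ge0.
  generalize (Cmod_pow_le1 eta (S N) H) (ballot_ge0 N 0); intros; nra.
Qed.

Lemma ex_series_invsqrtc2_half : ex_series (fun l => invsqrtc (S l) ^ 2 * (1 / 2) ^ S l).
Proof.
  apply ex_series_dom with (fun l => (1 / 2) ^ l).
  - intros l. assert (Hb : 0 <= invsqrtc (S l) ^ 2 <= 1).
    { apply pow_unit. split; [apply Rlt_le, invsqrtc_gt0|apply invsqrtc_le1]. }
    assert (Hp : 0 < (1 / 2) ^ l) by (apply pow_lt; lra).
    rewrite Rabs_pos_eq by (simpl ((1 / 2) ^ S l); nra). simpl ((1 / 2) ^ S l). nra.
  - apply ex_series_geom. rewrite Rabs_pos_eq; lra.
Qed.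

Lemma ex_series_quarterc : ex_series quarterc.
Proof.
  apply ex_series_incr_1. eexists.
  eapply is_series_ext; [|apply (tannery_triangle (fun l => invsqrtc (S l) ^ 2) ballot
     (fun l => (1 / 2) ^ S l) (fun _ => 1) (fun l => (1 / 2) ^ S l))].
  - intros N. cbv beta. rewrite ballot_sum. apply Rmult_1_r.
  - intros l. apply pow2_ge_0.
  - exact ballot_ge0.
  - exact ballot_out.
  - exact ballot_total.
  - exact ex_series_invsqrtc2_half.
  - intros. rewrite Rabs_R1. lra.
  - intros l. eapply is_series_ext; [|exact (ballot_total l)]. intros; symmetry; apply Rmult_1_r.
Qed.

Lemma ex_series_quartercC : ex_series (fun n => Cmod (RtoC (quarterc n))).
Proof.
  eapply ex_series_ext; [|exact ex_series_quarterc]. intros n. rewrite Cmod_R, Rabs_pos_eq; [easy|].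
  apply Rlt_le, quarterc_gt0.
Qed.

(** Re-expanding in eta is legitimate up to the boundary because the ballot numbers are
    nonnegative and the double series converges at eta = 1. *)
Lemma quadratic_transformation eta S : Cmod eta <= 1 ->
  is_cseries (fun n => RtoC (invsqrtc n ^ 2) * halfroot eta ^ n)%C S ->
  is_cseries (fun n => quarterc n * eta ^ n)%C S.
Proof.
  intros H HS. assert (HS1 := is_cseries_shift _ _ HS). cbv beta in HS1.
  replace (RtoC (invsqrtc 0 ^ 2) * halfroot eta ^ 0)%C with (RtoC 1) in HS1.
  2:{ simpl. rewrite !Rmult_1_r. ring. }
  assert (HB : forall N, Cmod (eta ^ Datatypes.S N) <= 1) by (intros; now apply Cmod_pow_le1).
  assert (HT : is_cseries (fun n => quarterc (Datatypes.S n) * eta ^ Datatypes.S n)%C (S - 1)%C).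
  { eapply is_cseries_ext.
    2:{ apply (tannery_triangle_C (fun l => invsqrtc (Datatypes.S l) ^ 2) ballot
          (fun l => (1 / 2) ^ Datatypes.S l) (fun N => eta ^ Datatypes.S N)%C
          (fun l => halfroot eta ^ Datatypes.S l)%C); [| | | | | | |exact HS1].
        - intros l. apply pow2_ge_0.
        - exact ballot_ge0.
        - exact ballot_out.
        - exact ballot_total.
        - exact ex_series_invsqrtc2_half.
        - exact HB.
        - intros l. exact (ballot_series l eta H). }
    intros N. cbv beta. now rewrite ballot_sum. }
  apply (is_cseries_unshift (fun n => quarterc n * eta ^ n)%C) in HT.
  replace S with (quarterc 0 * eta ^ 0 + (S - 1))%C; [exact HT|simpl; ring].
Qed.

Lemma ex_series_invsqrtc3 : ex_series (fun n => Cmod (RtoC (invsqrtc n ^ 3))).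
Proof.
  destruct ex_series_quarterc as [q Hq]. exists (q * q).
  eapply is_series_ext; [|apply (is_series_mult_pos quarterc quarterc q q Hq Hq);
    intros; apply Rlt_le, quarterc_gt0].
  intros n. cbv beta. rewrite quarterc_conv, Cmod_R, Rabs_pos_eq; [easy|].
  apply pow_le, Rlt_le, invsqrtc_gt0.
Qed.

(** The hypergeometric 3F2(1/2, 1/2, 1/2; 1, 1; eta), which is the square of 2K/pi. *)
Definition Ksq (eta : C) : C := CPSeries (fun n => RtoC (invsqrtc n ^ 3)) eta.

(** The quadratic transformation followed by the formula of Clausen. *)
Lemma EllipticK_sqr (k eta : C) : Cmod eta <= 1 -> (k * k)%C = halfroot eta ->
  (EllipticK k ^ 2)%C = (RtoC (PI ^ 2 / 4) * Ksq eta)%C.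
Proof.
  intros H Hk. assert (Hpi := PI_RGT_0).
  assert (HK := EllipticK_series k (halfroot eta) Hk (halfroot_bound eta H)).
  apply (quadratic_transformation eta _ H) in HK.
  set (S := (RtoC (2 / PI) * EllipticK k)%C) in *.
  assert (He : ex_series (fun n => Cmod (quarterc n * eta ^ n)%C))
    by exact (ex_series_pow (fun n => RtoC (quarterc n)) eta ex_series_quartercC H).
  assert (HP := is_cseries_pmult _ _ _ _ _ HK HK He He).
  assert (E : (S * S)%C = Ksq eta).
  { refine (is_cseries_eq _ _ _ HP _).
    eapply is_cseries_ext; [|exact (CPSeries_correct _ _ ex_series_invsqrtc3 H)].
    intros n. cbv beta. now rewrite quarterc_conv. }
  rewrite <- E. unfold S. simpl Cpow.
  transitivity (RtoC (PI ^ 2 / 4) * (RtoC (2 / PI) * RtoC (2 / PI)) * (EllipticK k * EllipticK k))%C.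
  - rewrite <- !RtoC_mult. replace (PI ^ 2 / 4 * (2 / PI * (2 / PI))) with 1 by (field; lra). ring.
  - ring.
Qed.

(** * The Legendre generating function *)

Definition cis (t : R) : C := (cos t, sin t).

Lemma cis_mult s t : (cis s * cis t)%C = cis (s + t).
Proof. apply C_ext; simpl; rewrite ?cos_plus, ?sin_plus; ring. Qed.

Lemma cis_pow t n : (cis t ^ n)%C = cis (INR n * t).
Proof.
  induction n as [|n IH].
  - simpl. rewrite Rmult_0_l. unfold cis. now rewrite cos_0, sin_0.
  - rewrite Cpow_S, IH, cis_mult, S_INR. f_equal. ring.
Qed.

Lemma Cmod_cis t : Cmod (cis t) = 1.
Proof.
  assert (E : Cmod (cis t) ^ 2 = 1).
  { rewrite Cmod2_alt. simpl. generalize (sin2_cos2 t). unfold Rsqr. lra. }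
  generalize (Cmod_ge_0 (cis t)); intros; nra.
Qed.

Definition leg_gen (v : C) (t : R) : C := (invsqrt_ser (v * cis t) * invsqrt_ser (v * cis (- t)))%C.

Lemma Cmod_v_cis v t : Cmod (v * cis t) = Cmod v.
Proof. rewrite Cmod_mult, Cmod_cis. ring. Qed.

Lemma sum_mult_RtoC (w : C) (f : nat -> R) n :
  (sum_f_R0 (fun k => Re (w * RtoC (f k))%C) n, sum_f_R0 (fun k => Im (w * RtoC (f k))%C) n)
  = (w * RtoC (sum_f_R0 f n))%C.
Proof.
  apply C_ext; match goal with
    |- Re (?A, ?B) = _ => change (Re (A, B)) with A
    | |- Im (?A, ?B) = _ => change (Im (A, B)) with B end.
  - rewrite re_scal_r, <- sum_scal_l. apply sum_eq; intros. now rewrite re_scal_r.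
  - rewrite im_scal_r, <- sum_scal_l. apply sum_eq; intros. now rewrite im_scal_r.
Qed.

(** The two factors are exchanged by t -> -t; averaging over this symmetry turns exponentials
    into cosines. *)
Lemma leg_gen_series v t : Cmod v < 1 ->
  is_cseries (fun n => RtoC (leg_cos n t) * v ^ n)%C (leg_gen v t).
Proof.
  intros Hv.
  assert (Hp : forall s, is_cseries (fun n =>
     (sum_f_R0 (fun k => Re (invsqrtc k * (v * cis s) ^ k * (invsqrtc (n - k)%nat * (v * cis (- s)) ^ (n - k)))%C) n,
      sum_f_R0 (fun k => Im (invsqrtc k * (v * cis s) ^ k * (invsqrtc (n - k)%nat * (v * cis (- s)) ^ (n - k)))%C) n))
     (invsqrt_ser (v * cis s) * invsqrt_ser (v * cis (- s)))%C).
  { intros s. apply (is_cseries_mult (fun k => invsqrtc k * (v * cis s) ^ k)%C (fun k => invsqrtc k * (v * cis (- s)) ^ k)%C);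
    [apply invsqrt_ser_correct|apply invsqrt_ser_correct|apply ex_series_invsqrt_ser|apply ex_series_invsqrt_ser];
    now rewrite Cmod_v_cis. }
  assert (H := is_cseries_scal (RtoC (/ 2)) _ _ (is_cseries_plus _ _ _ _ (Hp t) (Hp (- t)))).
  rewrite Ropp_involutive in H.
  replace (leg_gen v t) with (RtoC (/ 2) * (invsqrt_ser (v * cis t) * invsqrt_ser (v * cis (- t)) +
     invsqrt_ser (v * cis (- t)) * invsqrt_ser (v * cis t)))%C.
  2:{ unfold leg_gen. rewrite RtoC_inv by lra. field. }
  eapply is_cseries_ext; [|exact H]. intros n. cbv beta. clear H Hp.
  rewrite Cmult_comm with (x := RtoC (leg_cos n t)). unfold leg_cos. rewrite <- sum_mult_RtoC.
  assert (Hk : forall k, (k <= n)%nat ->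
    (RtoC (/ 2) * (invsqrtc k * (v * cis t) ^ k * (invsqrtc (n - k) * (v * cis (- t)) ^ (n - k)) +
       invsqrtc k * (v * cis (- t)) ^ k * (invsqrtc (n - k) * (v * cis t) ^ (n - k))))%C =
    (v ^ n * RtoC (invsqrtc k * invsqrtc (n - k) * cos ((INR k - INR (n - k)) * t)))%C).
  { intros k Hk. rewrite !Cpow_mult_l, !cis_pow.
    transitivity (RtoC (/ 2) * invsqrtc k * invsqrtc (n - k) * (v ^ k * v ^ (n - k)) *
       (cis (INR k * t) * cis (INR (n - k) * - t) + cis (INR k * - t) * cis (INR (n - k) * t)))%C; [ring|].
    rewrite !cis_mult, <- Cpow_add_r. replace (k + (n - k))%nat with n by lia.
    replace (INR k * - t + INR (n - k) * t) with (- ((INR k - INR (n - k)) * t)) by ring.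
    replace (INR k * t + INR (n - k) * - t) with ((INR k - INR (n - k)) * t) by ring.
    set (a := (INR k - INR (n - k)) * t).
    assert (Ec : (cis a + cis (- a))%C = RtoC (2 * cos a)).
    { apply C_ext; simpl; rewrite ?cos_neg, ?sin_neg; ring. }
    rewrite Ec, !RtoC_mult, RtoC_inv by lra. field. }
  apply C_ext.
  - rewrite re_scal_l, re_plus.
    repeat match goal with |- context [Re (?A, ?B)] => change (Re (A, B)) with A end.
    rewrite <- plus_sum, <- sum_scal_l. apply sum_eq. intros k Hkn.
    now rewrite <- re_plus, <- re_scal_l, Hk.
  - rewrite im_scal_l, im_plus.
    repeat match goal with |- context [Im (?A, ?B)] => change (Im (A, B)) with B end.
    rewrite <- plus_sum, <- sum_scal_l. apply sum_eq. intros k Hkn.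
    now rewrite <- im_plus, <- im_scal_l, Hk.
Qed.

(** sqrt (1 + v^2) times the generating function of the P_n (cos t): a square root of 1 / (1 - w
    cos t), where w = 2v / (1 + v^2). *)
Definition leg_norm (v : C) (t : R) : C := (sqrt_ser (- (v * v)) * leg_gen v t)%C.

Lemma Cmod_neg_sq v : Cmod v < 1 -> Cmod (- (v * v)) < 1.
Proof. intros. rewrite Cmod_opp, Cmod_mult. generalize (Cmod_ge_0 v); nra. Qed.

Lemma leg_norm_sqr v t : Cmod v < 1 ->
  (leg_norm v t * leg_norm v t * (1 - 2 * v * RtoC (cos t) + v * v) = 1 + v * v)%C.
Proof.
  intros Hv. assert (Hw := Cmod_neg_sq v Hv).
  assert (H1 : Cmod (v * cis t) < 1) by now rewrite Cmod_v_cis.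
  assert (H2 : Cmod (v * cis (- t)) < 1) by now rewrite Cmod_v_cis.
  assert (E : (1 - 2 * v * RtoC (cos t) + v * v)%C = ((1 - v * cis t) * (1 - v * cis (- t)))%C).
  { transitivity (1 - v * (cis t + cis (- t)) + v * v * (cis t * cis (- t)))%C; [|ring].
    rewrite cis_mult. replace (t + - t) with 0 by ring.
    replace (cis 0) with (RtoC 1) by (unfold cis; now rewrite cos_0, sin_0).
    replace (cis t + cis (- t))%C with (2 * RtoC (cos t))%C; [ring|].
    apply C_ext; simpl; rewrite ?cos_neg, ?sin_neg; ring. }
  rewrite E. unfold leg_norm, leg_gen.
  transitivity ((sqrt_ser (- (v * v)) * sqrt_ser (- (v * v))) *
    (invsqrt_ser (v * cis t) * invsqrt_ser (v * cis t) * (1 - v * cis t)) *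
    (invsqrt_ser (v * cis (- t)) * invsqrt_ser (v * cis (- t)) * (1 - v * cis (- t))))%C; [ring|].
  rewrite !invsqrt_ser_sqr, sqrt_ser_sqr by lra. ring.
Qed.

(** If 1 - w c were negative, v would be a root of v^2 - 2 mu v + 1 with mu real and |mu| < 1,
    hence of modulus 1. *)
Lemma no_real_ratio (v : C) (c x : R) : Cmod v < 1 -> -1 <= c <= 1 ->
  (RtoC (- (x * x)) * (1 - 2 * v * RtoC c + v * v) = 1 + v * v)%C -> False.
Proof.
  intros Hv Hc E. generalize (Cmod_sq v) (Cmod_ge_0 v); intros Hs H0.
  assert (ER := f_equal Re E). assert (EI := f_equal Im E). clear E.
  destruct v as [a b]. simpl in ER, EI, Hs. unfold Re, Im in Hs. simpl in Hs.
  assert (Hab : a * a + b * b < 1) by nra. clear Hs Hv H0.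
  set (l := x * x) in *. assert (Hl : 0 <= l) by (unfold l; nra). clearbody l.
  assert (E1 : (1 + l) * (1 + a * a - b * b) = 2 * l * c * a) by lra.
  assert (E2 : (1 + l) * (2 * (a * b)) = 2 * l * c * b) by lra.
  clear ER EI.
  destruct (Req_dec b 0) as [->|Hb].
  - assert (0 <= l * ((c - a) * (c - a))) by (apply Rmult_le_pos; [exact Hl|apply Rle_0_sqr]).
    assert (0 <= l * (1 - c * c)) by (apply Rmult_le_pos; nra).
    nra.
  - assert (E3 : (1 + l) * a = l * c).
    { apply Rmult_eq_reg_r with b; [lra|exact Hb]. }
    assert (E4 : (1 + l) * (1 - (a * a + b * b)) = 0).
    { transitivity ((1 + l) * (1 + a * a - b * b) - 2 * a * ((1 + l) * a)); [ring|].
      rewrite E1, E3. ring. }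
    nra.
Qed.

Lemma Re_continuity (f : R -> C) (r : R) :
  (forall eps, 0 < eps -> exists delta, 0 < delta /\
     forall s, 0 <= s <= 1 -> Rabs (s - r) < delta -> Cmod (f s - f r) < eps) ->
  forall eps, 0 < eps -> exists delta, 0 < delta /\
     forall s, 0 <= s <= 1 -> Rabs (s - r) < delta -> Rabs (Re (f s) - Re (f r)) < eps.
Proof.
  intros H eps He. destruct (H eps He) as [d [Hd Hd']]. exists d. split; [exact Hd|].
  intros s Hs Hsr. eapply Rle_lt_trans; [|exact (Hd' s Hs Hsr)].
  replace (Re (f s) - Re (f r)) with (Re (f s - f r)%C) by apply re_minus.
  apply re_le_Cmod.
Qed.

(** The intermediate value theorem, for a continuity stated on the interval only. *)
Lemma positive_by_continuity (g : R -> R) :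
  (forall r, 0 <= r <= 1 -> forall eps, 0 < eps -> exists delta, 0 < delta /\
     forall s, 0 <= s <= 1 -> Rabs (s - r) < delta -> Rabs (g s - g r) < eps) ->
  (forall r, 0 <= r <= 1 -> g r <> 0) -> 0 < g 0 -> 0 < g 1.
Proof.
  intros Hc Hn H0.
  destruct (Rlt_le_dec 0 (g 1)) as [|H1]; [assumption|exfalso].
  set (cl := fun x => Rmax 0 (Rmin 1 x)).
  assert (Hcl : forall x, 0 <= cl x <= 1).
  { intros x. unfold cl. split; [apply Rmax_l|].
    apply Rmax_lub; [lra|apply Rmin_l]. }
  assert (Hcl1 : forall x y, Rabs (cl x - cl y) <= Rabs (x - y)).
  { intros x y. unfold cl, Rmax, Rmin.
    repeat destruct Rle_dec; unfold Rabs; repeat destruct Rcase_abs; lra. }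
  assert (Hcont : continuity (fun x => - g (cl x))).
  { intros x. apply continuity_pt_opp. intros eps He.
    destruct (Hc (cl x) (Hcl x) eps He) as [d [Hd Hd']].
    exists d. split; [exact Hd|]. intros y [_ Hy].
    apply Hd'; [apply Hcl|]. eapply Rle_lt_trans; [apply Hcl1|exact Hy]. }
  assert (E0 : cl 0 = 0) by (unfold cl; rewrite Rmin_right by lra; apply Rmax_left; lra).
  assert (E1 : cl 1 = 1) by (unfold cl; rewrite Rmin_left by lra; apply Rmax_right; lra).
  destruct (Req_dec (g 1) 0) as [E|E]; [apply (Hn 1); [lra|exact E]|].
  destruct (IVT _ 0 1 Hcont) as [z [Hz1 Hz2]]; [lra|rewrite E0; lra|rewrite E1; lra|].
  apply (Hn (cl z)); [apply Hcl|lra].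
Qed.

Definition Ccontinuous01 (f : R -> C) : Prop :=
  forall r, 0 <= r <= 1 -> forall eps, 0 < eps -> exists delta, 0 < delta /\
     forall s, 0 <= s <= 1 -> Rabs (s - r) < delta -> Cmod (f s - f r) < eps.

Lemma Ccontinuous01_mult f g : Ccontinuous01 f -> Ccontinuous01 g -> Ccontinuous01 (fun r => f r * g r)%C.
Proof.
  intros Hf Hg r Hr eps He. destruct (Cmult_close (f r) (g r) eps He) as (e & He' & H).
  destruct (Hf r Hr e He') as [d1 [Hd1 H1]]. destruct (Hg r Hr e He') as [d2 [Hd2 H2]].
  exists (Rmin d1 d2). split; [now apply Rmin_glb_lt|].
  intros s Hs Hsr. apply H.
  - exact (H1 s Hs (Rlt_le_trans _ _ _ Hsr (Rmin_l _ _))).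
  - exact (H2 s Hs (Rlt_le_trans _ _ _ Hsr (Rmin_r _ _))).
Qed.

Lemma Ccontinuous01_CPSeries (a : nat -> C) (w : C) (p : nat) :
  ex_series (fun n => Cmod (a n)) -> Cmod w <= 1 -> (1 <= p)%nat ->
  Ccontinuous01 (fun r => CPSeries a (RtoC (r ^ p) * w)%C).
Proof.
  intros Ha Hw Hp r Hr eps He.
  destruct (CPSeries_unif_cont a eps Ha He) as [d [Hd H]].
  assert (HN : 0 < INR p) by (apply lt_0_INR; lia).
  exists (d / INR p). split; [now apply Rdiv_lt_0_compat|].
  assert (Hb : forall s, 0 <= s <= 1 -> Cmod (RtoC (s ^ p) * w) <= 1).
  { intros s Hs. rewrite Cmod_mult, Cmod_R. destruct (pow_unit s p Hs).
    rewrite Rabs_pos_eq by lra. generalize (Cmod_ge_0 w); nra. }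
  intros s Hs Hsr. apply H; [now apply Hb|now apply Hb|].
  replace (RtoC (s ^ p) * w - RtoC (r ^ p) * w)%C with ((RtoC s ^ p - RtoC r ^ p) * w)%C
    by (rewrite !RtoC_pow; ring).
  rewrite Cmod_mult.
  assert (H1 : Cmod (RtoC s ^ p - RtoC r ^ p) <= INR p * Cmod (RtoC s - RtoC r)).
  { apply Cpow_diff; rewrite Cmod_R, Rabs_pos_eq; lra. }
  rewrite <- RtoC_minus, Cmod_R in H1.
  assert (H2 : INR p * Rabs (s - r) < d).
  { apply Rmult_lt_reg_r with (/ INR p); [now apply Rinv_0_lt_compat|].
    rewrite Rmult_comm, <- Rmult_assoc, Rinv_l, Rmult_1_l by lra. exact Hsr. }
  generalize (Cmod_ge_0 (RtoC s ^ p - RtoC r ^ p)) (Cmod_ge_0 w); intros; nra.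
Qed.

Lemma invsqrt_ser_ray (w : C) (r : R) :
  invsqrt_ser (RtoC r * w) = CPSeries (fun n => invsqrtc n * w ^ n)%C (RtoC (r ^ 1) * 1)%C.
Proof.
  unfold invsqrt_ser, CPSeries.
  assert (E : forall n, (invsqrtc n * (RtoC r * w) ^ n)%C = (invsqrtc n * w ^ n * (RtoC (r ^ 1) * 1) ^ n)%C).
  { intros n. rewrite pow_1, !Cpow_mult_l, Cpow_1_l. ring. }
  unfold CSeries. f_equal; apply Series_ext; intros n; now rewrite E.
Qed.

(** Along the ray from 0 to v the real part starts at 1; it could vanish only where the square
    is negative, and [no_real_ratio] excludes that. So [leg_norm v t] is the principal root. *)
Lemma leg_norm_Re v t : Cmod v < 1 -> 0 < Re (leg_norm v t).
Proof.
  intros Hv.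
  set (f := fun r : R => leg_norm (RtoC r * v) t).
  assert (Hb : forall r, 0 <= r <= 1 -> Cmod (RtoC r * v) < 1).
  { intros r Hr. rewrite Cmod_mult, Cmod_R, Rabs_pos_eq by lra. generalize (Cmod_ge_0 v); nra. }
  replace v with (RtoC 1 * v)%C by ring. change (0 < Re (f 1)).
  apply (positive_by_continuity (fun r => Re (f r))).
  - intros r Hr. apply Re_continuity. revert r Hr. change (Ccontinuous01 f).
    assert (Hbin : forall w, Cmod w < 1 -> Ccontinuous01 (fun r => invsqrt_ser (RtoC r * w))).
    { intros w Hw r Hr eps He.
      destruct (Ccontinuous01_CPSeries (fun n => invsqrtc n * w ^ n)%C 1 1 (ex_series_invsqrt_ser w Hw)
        ltac:(rewrite Cmod_1; lra) ltac:(lia) r Hr eps He) as [d [Hd H]].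
      exists d. split; [exact Hd|]. intros s Hs Hsr. rewrite !invsqrt_ser_ray. now apply H. }
    assert (Hroot : Ccontinuous01 (fun r => sqrt_ser (RtoC (r ^ 2) * - (v * v)))).
    { apply Ccontinuous01_CPSeries; [exact ex_series_sqrtcC| |lia].
      apply Rlt_le, Cmod_neg_sq, Hv. }
    assert (H := Ccontinuous01_mult _ _ Hroot (Ccontinuous01_mult _ _
      (Hbin (v * cis t)%C ltac:(now rewrite Cmod_v_cis)) (Hbin (v * cis (- t))%C ltac:(now rewrite Cmod_v_cis)))).
    intros r Hr eps He. destruct (H r Hr eps He) as [d [Hd H']].
    exists d. split; [exact Hd|]. intros s Hs Hsr. specialize (H' s Hs Hsr).
    assert (E : forall r, f r = (sqrt_ser (RtoC (r ^ 2) * - (v * v)) *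
      (invsqrt_ser (RtoC r * (v * cis t)) * invsqrt_ser (RtoC r * (v * cis (- t)))))%C).
    { intros q. unfold f, leg_norm, leg_gen. rewrite RtoC_pow.
      f_equal; [f_equal; ring|f_equal; f_equal; ring]. }
    now rewrite !E.
  - intros r Hr E.
    assert (Hsq := leg_norm_sqr (RtoC r * v) t (Hb r Hr)). fold (f r) in Hsq.
    apply (no_real_ratio (RtoC r * v) (cos t) (Im (f r)) (Hb r Hr)); [apply COS_bound|].
    rewrite <- Hsq. f_equal. apply C_ext; rewrite ?re_mult, ?im_mult, E; simpl; ring.
  - assert (Hf0 : f 0 = 1%C).
    { assert (Hbin : invsqrt_ser 0 = 1%C).
      { assert (H := invsqrt_ser_correct 0 ltac:(rewrite Cmod_0; lra)).
        apply (is_cseries_eq _ _ _ H).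
        apply (is_cseries_ext (fun n => match n with O => RtoC 1 | _ => RtoC 0 end)).
        - intros [|n]; simpl; ring.
        - set (a := fun n => match n with O => RtoC 1 | _ => RtoC 0 end).
          replace (RtoC 1) with (a 0%nat + a 1%nat)%C by (simpl; ring).
          apply is_cseries_two. reflexivity. }
      unfold f, leg_norm, leg_gen.
      replace (0 * v * cis t)%C with (RtoC 0) by ring.
      replace (0 * v * cis (- t))%C with (RtoC 0) by ring.
      replace (- (0 * v * (0 * v)))%C with (RtoC 0) by ring.
      rewrite Hbin, sqrt_ser_Csqrt by (rewrite Cmod_0; lra).
      replace (1 - 0)%C with (RtoC 1) by ring. rewrite Csqrt_real, sqrt_1 by lra. ring. }
    rewrite Hf0. simpl. lra.
Qed.

Lemma root_unique (z w : C) : (z * z = w * w)%C -> 0 < Re z -> 0 < Re w -> z = w.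
Proof.
  intros H Hz Hw. assert (E : ((z - w) * (z + w))%C = 0%C).
  { transitivity (z * z - w * w)%C; [ring|]. rewrite H. ring. }
  destruct (Ceq_dec (z - w) 0) as [E1|E1].
  - transitivity (z - w + w)%C; [ring|]. rewrite E1. ring.
  - exfalso. assert (E2 : (z + w)%C = 0%C).
    { transitivity (/ (z - w) * ((z - w) * (z + w)))%C; [field; exact E1|]. rewrite E. ring. }
    apply (f_equal Re) in E2. rewrite re_plus in E2. simpl in E2. lra.
Qed.

(** Both sides are the principal root of 1 / (1 - w cos t), and the hypothesis says that w cos t
    is the same. *)
Lemma leg_norm_homogeneous (v0 v1 : C) (t0 t1 : R) :
  Cmod v0 < 1 -> Cmod v1 < 1 ->
  (v1 * RtoC (cos t1) * (1 + v0 * v0) = v0 * RtoC (cos t0) * (1 + v1 * v1))%C ->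
  leg_norm v1 t1 = leg_norm v0 t0.
Proof.
  intros H0 H1 E.
  assert (S0 := leg_norm_sqr v0 t0 H0). assert (S1 := leg_norm_sqr v1 t1 H1).
  assert (Hnz : forall v, Cmod v < 1 -> (1 + v * v)%C <> 0%C).
  { intros v Hv Ev. assert (Hs := Cmod_neg_sq v Hv).
    replace (- (v * v))%C with (RtoC 1) in Hs.
    - rewrite Cmod_1 in Hs. lra.
    - transitivity (1 + v * v - v * v)%C; [ring|]. rewrite Ev. ring. }
  assert (N0 := Hnz v0 H0). assert (N1 := Hnz v1 H1).
  apply root_unique; [|now apply leg_norm_Re|now apply leg_norm_Re].
  set (X := (leg_norm v1 t1 * leg_norm v1 t1)%C) in *. set (Y := (leg_norm v0 t0 * leg_norm v0 t0)%C) in *.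
  set (p0 := (1 + v0 * v0)%C) in *. set (p1 := (1 + v1 * v1)%C) in *.
  assert (D0 : (1 - 2 * v0 * RtoC (cos t0) + v0 * v0)%C = (p0 - 2 * (v0 * RtoC (cos t0)))%C) by (unfold p0; ring).
  assert (D1 : (1 - 2 * v1 * RtoC (cos t1) + v1 * v1)%C = (p1 - 2 * (v1 * RtoC (cos t1)))%C) by (unfold p1; ring).
  rewrite D0 in S0. rewrite D1 in S1.
  set (a0 := (v0 * RtoC (cos t0))%C) in *. set (a1 := (v1 * RtoC (cos t1))%C) in *.
  clearbody p0 p1 a0 a1 X Y.
  assert (N2 : (p1 - 2 * a1)%C <> 0%C).
  { intros Z. rewrite Z, Cmult_0_r in S1. now apply N1. }
  assert (A1 : a1 = (a0 * p1 / p0)%C) by (rewrite <- E; field; exact N0).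
  assert (N3 : (p0 - 2 * a0)%C <> 0%C).
  { intros Z. rewrite Z, Cmult_0_r in S0. now apply N0. }
  transitivity (X * (p1 - 2 * a1) / (p1 - 2 * a1))%C; [field; exact N2|].
  transitivity (Y * (p0 - 2 * a0) / (p0 - 2 * a0))%C; [|field; exact N3].
  rewrite S0, S1, A1. field. repeat split; try assumption.
  intros Z. apply N3. 
  assert (Z' : (p1 * (p0 - 2 * a0))%C = 0%C) by (rewrite <- Z; ring).
  transitivity (/ p1 * (p1 * (p0 - 2 * a0)))%C; [field; exact N1|]. rewrite Z'. ring.
Qed.

Lemma leg_norm_even v t : Cmod v < 1 ->
  is_cseries (fun n => sqrt_ser (- (v * v)) * (RtoC (leg_even n (cos t ^ 2)) * (v * v) ^ n))%C
    ((leg_norm v t + leg_norm (- v) t) / 2)%C.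
Proof.
  intros Hv. assert (Hv' : Cmod (- v) < 1) by now rewrite Cmod_opp.
  assert (H := is_cseries_scal (RtoC (/ 2)) _ _
    (is_cseries_plus _ _ _ _ (leg_gen_series v t Hv) (leg_gen_series (- v) t Hv'))).
  apply is_cseries_even in H.
  - apply (is_cseries_scal (sqrt_ser (- (v * v)))) in H.
    replace ((leg_norm v t + leg_norm (- v) t) / 2)%C with
      (sqrt_ser (- (v * v)) * (RtoC (/ 2) * (leg_gen v t + leg_gen (- v) t)))%C.
    + eapply is_cseries_ext; [|exact H]. intros n. cbv beta.
      rewrite (proj1 (leg_cos_legendre n t)).
      rewrite !Cpow_mult_r. replace ((- v) ^ 2)%C with (v * v)%C by (simpl; ring).
      replace (v ^ 2)%C with (v * v)%C by (simpl; ring).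
      rewrite RtoC_inv by lra. field.
    + unfold leg_norm. replace (- v * - v)%C with (v * v)%C by ring.
      rewrite RtoC_inv by lra. field.
  - intros n. cbv beta. rewrite !Cpow_add_r, !Cpow_mult_r.
    replace ((- v) ^ 2)%C with (v ^ 2)%C by (simpl; ring). simpl. ring.
Qed.

Lemma legendre_homogeneous (v0 v1 : C) (t0 t1 : R) (S0 S1 : C) :
  Cmod v0 < 1 -> Cmod v1 < 1 ->
  (v1 * RtoC (cos t1) * (1 + v0 * v0) = v0 * RtoC (cos t0) * (1 + v1 * v1))%C ->
  is_cseries (fun n => sqrt_ser (- (v0 * v0)) * (RtoC (leg_even n (cos t0 ^ 2)) * (v0 * v0) ^ n))%C S0 ->
  is_cseries (fun n => sqrt_ser (- (v1 * v1)) * (RtoC (leg_even n (cos t1 ^ 2)) * (v1 * v1) ^ n))%C S1 ->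
  S1 = S0.
Proof.
  intros H0 H1 E HS0 HS1.
  rewrite (is_cseries_eq _ _ _ HS0 (leg_norm_even v0 t0 H0)).
  rewrite (is_cseries_eq _ _ _ HS1 (leg_norm_even v1 t1 H1)).
  rewrite (leg_norm_homogeneous v0 v1 t0 t1 H0 H1 E).
  rewrite (leg_norm_homogeneous (- v0) (- v1) t0 t1); [reflexivity| | |].
  - now rewrite Cmod_opp.
  - now rewrite Cmod_opp.
  - replace (- v1 * RtoC (cos t1) * (1 + - v0 * - v0))%C with
      (- (v1 * RtoC (cos t1) * (1 + v0 * v0)))%C by ring.
    rewrite E. ring.
Qed.

(** * Averaging over arcsine laws *)

(** The polynomial P_2n(u) at u^2 = t, after [i] averages over t -> t sin^2. *)
Definition leg_avg (i n : nat) (t : R) : R :=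
  sum_f_R0 (fun j => leg_evenc n j * invsqrtc j ^ i * t ^ j) n.

Lemma is_RInt_sum (f : nat -> R -> R) (I : nat -> R) a b n :
  (forall j, is_RInt (f j) a b (I j)) ->
  is_RInt (fun x => sum_f_R0 (fun j => f j x) n) a b (sum_f_R0 I n).
Proof.
  intros H. induction n as [|n IH]; [apply H|].
  simpl. apply (is_RInt_plus (V := R_NormedModule)); [exact IH|apply H].
Qed.

(** The mean of sin^(2j) is [invsqrtc j]. *)
Lemma leg_avg_average i n t :
  is_RInt (fun th => leg_avg i n (t * sin th ^ 2)) 0 (PI / 2) (PI / 2 * leg_avg (S i) n t).
Proof.
  unfold leg_avg. rewrite <- sum_scal_l.
  apply (is_RInt_sum (fun j th => leg_evenc n j * invsqrtc j ^ i * (t * sin th ^ 2) ^ j)). intros j.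
  apply is_RInt_ext_R with (fun th => leg_evenc n j * invsqrtc j ^ i * t ^ j * sin th ^ (2 * j)).
  { intros th. rewrite Rpow_mult_distr, pow_mult. ring. }
  replace (PI / 2 * (leg_evenc n j * invsqrtc j ^ S i * t ^ j)) with
    (leg_evenc n j * invsqrtc j ^ i * t ^ j * (PI / 2 * invsqrtc j)) by (simpl; ring).
  apply (is_RInt_scal (V := R_NormedModule)), is_RInt_sin_pow.
Qed.

Lemma leg_avg_0 n t : leg_avg 0 n t = leg_even n t.
Proof. apply sum_eq. intros j _. simpl. ring. Qed.

Lemma sqrt_cos_acos t : 0 <= t <= 1 -> cos (acos (sqrt t)) = sqrt t.
Proof.
  intros Ht. apply cos_acos. generalize (sqrt_pos t). intros.
  assert (sqrt t <= 1) by (rewrite <- sqrt_1; apply sqrt_le_1_alt; lra). lra.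
Qed.

(** Averages of P_2n, which is bounded by 1. *)
Lemma leg_avg_bound i n t : 0 <= t <= 1 -> Rabs (leg_avg i n t) <= 1.
Proof.
  revert t. induction i as [|i IH]; intros t Ht.
  - rewrite leg_avg_0.
    assert (E : cos (acos (sqrt t)) ^ 2 = t).
    { rewrite sqrt_cos_acos by exact Ht. simpl. rewrite Rmult_1_r, sqrt_sqrt; lra. }
    generalize (leg_cos_bound (2 * n) (acos (sqrt t))).
    rewrite (proj1 (leg_cos_legendre n _)), E. auto.
  - assert (Hpi := PI_RGT_0).
    assert (Hb : forall th, 0 <= th <= PI / 2 -> Rabs (leg_avg i n (t * sin th ^ 2)) <= 1).
    { intros th _. apply IH. generalize (sin_sq_bound th). intros; nra. }
    assert (H := norm_RInt_le_const (V := R_NormedModule) _ 0 (PI / 2) _ 1 ltac:(lra)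
      Hb (leg_avg_average i n t)).
    change (Rabs (PI / 2 * leg_avg (S i) n t) <= (PI / 2 - 0) * 1) in H.
    rewrite Rabs_mult, (Rabs_pos_eq (PI / 2)) in H by lra. nra.
Qed.

Lemma leg_avg_2_1 n : leg_avg 2 n 1 = (-1) ^ n * invsqrtc n ^ 3.
Proof.
  rewrite <- leg_evenc_invsqrtc_sum. apply sum_eq. intros j _. rewrite pow1. ring.
Qed.

Lemma leg_avg_term_bound i n t (q y : C) : 0 <= t <= 1 ->
  Cmod (q * (RtoC (leg_avg i n t) * y ^ n))%C <= Cmod q * Cmod y ^ n.
Proof.
  intros Ht. rewrite !Cmod_mult, Cmod_R, Cmod_pow.
  generalize (leg_avg_bound i n t Ht) (Rabs_pos (leg_avg i n t)) (Cmod_ge_0 q) (pow_le (Cmod y) n (Cmod_ge_0 y)); intros.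
  apply Rmult_le_compat_l; nra.
Qed.

Lemma ex_series_geomC (q y : C) : Cmod y < 1 -> ex_series (fun n => Cmod q * Cmod y ^ n).
Proof.
  intros H. apply (ex_series_scal (V := R_NormedModule)), ex_series_geom.
  rewrite Rabs_pos_eq by apply Cmod_ge_0. exact H.
Qed.

Definition leg_avg_ser (q y : C) (i : nat) (t : R) : C :=
  CSeries (fun n => q * (RtoC (leg_avg i n t) * y ^ n))%C.

Lemma leg_avg_ser_correct q y i t : Cmod y < 1 -> 0 <= t <= 1 ->
  is_cseries (fun n => q * (RtoC (leg_avg i n t) * y ^ n))%C (leg_avg_ser q y i t).
Proof.
  intros Hy Ht. apply CSeries_correct.
  refine (ex_series_dom _ _ _ (ex_series_geomC q y Hy)). intros n.
  rewrite Rabs_pos_eq by apply Cmod_ge_0. now apply leg_avg_term_bound.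
Qed.

Lemma leg_avg_ser_average q y i t : Cmod y < 1 -> 0 <= t <= 1 ->
  is_RInt (V := C_R_NormedModule) (fun th => leg_avg_ser q y i (t * sin th ^ 2)) 0 (PI / 2)
    (RtoC (PI / 2) * leg_avg_ser q y (S i) t)%C.
Proof.
  intros Hy Ht. assert (Hpi := PI_RGT_0).
  assert (Hb : forall th, 0 <= t * sin th ^ 2 <= 1).
  { intros th. generalize (sin_sq_bound th); intros; nra. }
  destruct (is_RInt_cseries (fun n th => q * (RtoC (leg_avg i n (t * sin th ^ 2)) * y ^ n))%C
     (fun th => leg_avg_ser q y i (t * sin th ^ 2)) (fun n => Cmod q * Cmod y ^ n)
     (fun n => q * (RtoC (PI / 2 * leg_avg (S i) n t) * y ^ n))%C 0 (PI / 2)) as [S [HS1 HS2]].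
  - lra.
  - intros n th _. now apply leg_avg_term_bound.
  - now apply ex_series_geomC.
  - intros th _. now apply leg_avg_ser_correct.
  - intros n. apply is_RInt_cscal.
    rewrite Cmult_comm.
    apply is_RInt_ext with (fun th => y ^ n * RtoC (leg_avg i n (t * sin th ^ 2)))%C.
    { intros; apply Cmult_comm. }
    apply is_RInt_cscal, is_RInt_RtoC, leg_avg_average.
  - replace (RtoC (PI / 2) * leg_avg_ser q y (Datatypes.S i) t)%C with S; [exact HS1|].
    apply (is_cseries_eq _ _ _ HS2).
    eapply is_cseries_ext; [|exact (is_cseries_scal (RtoC (PI / 2)) _ _ (leg_avg_ser_correct q y (Datatypes.S i) t Hy Ht))].
    intros n. cbv beta. rewrite RtoC_mult. ring.
Qed.

(** The factor in front and the sum depend on w^2 u^2 only, and averaging in u preserves this.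
    The coordinate [v1] belongs to the argument scaled by [xi ^ 2]. *)
Lemma leg_avg_ser_homogeneous (v0 v1 : C) (xi : R) i u :
  Cmod v0 < 1 -> Cmod v1 < 1 -> 0 <= xi <= 1 -> 0 <= u <= 1 ->
  (v1 * (1 + v0 * v0) = v0 * RtoC xi * (1 + v1 * v1))%C ->
  leg_avg_ser (sqrt_ser (- (v1 * v1))) (v1 * v1) i u =
  leg_avg_ser (sqrt_ser (- (v0 * v0))) (v0 * v0) i (xi ^ 2 * u).
Proof.
  intros H0 H1 Hxi Hu E.
  assert (Hy0 : Cmod (v0 * v0) < 1) by (rewrite <- Cmod_opp; now apply Cmod_neg_sq).
  assert (Hy1 : Cmod (v1 * v1) < 1) by (rewrite <- Cmod_opp; now apply Cmod_neg_sq).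
  assert (Hx2 := pow_unit xi 2 Hxi).
  revert u Hu. induction i as [|i IH]; intros u Hu.
  - assert (Hsu : 0 <= sqrt u <= 1).
    { split; [apply sqrt_pos|]. rewrite <- sqrt_1. apply sqrt_le_1_alt. lra. }
    assert (Hxu : 0 <= xi ^ 2 * u <= 1) by nra.
    assert (Es : sqrt (xi ^ 2 * u) = xi * sqrt u).
    { rewrite sqrt_mult by lra. rewrite sqrt_pow2; lra. }
    refine (legendre_homogeneous v0 v1 (acos (sqrt (xi ^ 2 * u))) (acos (sqrt u)) _ _ H0 H1 _ _ _).
    + rewrite !sqrt_cos_acos, Es, RtoC_mult by assumption.
      transitivity (v1 * (1 + v0 * v0) * RtoC (sqrt u))%C; [ring|]. rewrite E. ring.
    + eapply is_cseries_ext; [|exact (leg_avg_ser_correct _ _ 0 _ Hy0 Hxu)].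
      intros n. cbv beta. rewrite leg_avg_0, sqrt_cos_acos, pow2_sqrt by lra. reflexivity.
    + eapply is_cseries_ext; [|exact (leg_avg_ser_correct _ _ 0 _ Hy1 Hu)].
      intros n. cbv beta. rewrite leg_avg_0, sqrt_cos_acos, pow2_sqrt by lra. reflexivity.
  - assert (Hpi := PI_RGT_0).
    assert (A1 := leg_avg_ser_average (sqrt_ser (- (v1 * v1))) (v1 * v1) i u Hy1 Hu).
    assert (A0 := leg_avg_ser_average (sqrt_ser (- (v0 * v0))) (v0 * v0) i (xi ^ 2 * u) Hy0 ltac:(nra)).
    assert (A2 : is_RInt (V := C_R_NormedModule) (fun th => leg_avg_ser (sqrt_ser (- (v1 * v1))) (v1 * v1) i (u * sin th ^ 2))
       0 (PI / 2) (RtoC (PI / 2) * leg_avg_ser (sqrt_ser (- (v0 * v0))) (v0 * v0) (S i) (xi ^ 2 * u))%C).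
    { eapply is_RInt_ext; [|exact A0]. intros th _. cbv beta.
      rewrite IH by (generalize (sin_sq_bound th); intros; nra). f_equal. ring. }
    apply RInt_C_unique in A1. apply RInt_C_unique in A2. rewrite A1 in A2.
    assert (Hn : RtoC (PI / 2) <> 0%C) by (apply RtoC_neq0; lra).
    transitivity (/ RtoC (PI / 2) * (RtoC (PI / 2) * leg_avg_ser (sqrt_ser (- (v1 * v1))) (v1 * v1) (S i) u))%C;
      [field; exact Hn|]. rewrite A2. field. exact Hn.
Qed.

(** At t = 1 the second average of P_2n is the coefficient in Clausen's formula. *)
Lemma leg_avg_ser_Ksq q y : Cmod y < 1 -> leg_avg_ser q y 2 1 = (q * Ksq (- y))%C.
Proof.
  intros Hy. apply (is_cseries_eq _ _ _ (leg_avg_ser_correct q y 2 1 Hy ltac:(lra))).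
  apply is_cseries_scal.
  eapply is_cseries_ext; [|apply (CPSeries_correct _ (- y)%C ex_series_invsqrtc3)].
  - intros n. cbv beta. rewrite leg_avg_2_1, RtoC_mult.
    replace (- y)%C with (RtoC (-1) * y)%C by ring. rewrite Cpow_mult_l, (RtoC_pow (-1)). ring.
  - rewrite Cmod_opp. lra.
Qed.

Lemma ellE_bounded : exists K, forall x, 0 <= x <= 1 -> Rabs (ellE x) <= K.
Proof.
  destruct ex_series_sqrtc_invsqrtc as [K HK]. exists K. intros x Hx.
  assert (H := ellE_series x Hx).
  assert (HB : forall n, Rabs (PI / 2 * (sqrtc n * invsqrtc n) * (1 - x) ^ n) <= Rabs (PI / 2 * (sqrtc n * invsqrtc n))).
  { intros n. rewrite Rabs_mult. destruct (pow_unit (1 - x) n ltac:(lra)).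
    rewrite (Rabs_pos_eq ((1 - x) ^ n)) by lra.
    generalize (Rabs_pos (PI / 2 * (sqrtc n * invsqrtc n))); intros; nra. }
  apply Rabs_le. split.
  - apply Ropp_le_cancel. rewrite Ropp_involutive.
    refine (is_series_le _ _ _ _ _ (is_series_opp _ _ H) HK). intros n.
    assert (Hn := HB n). apply Rabs_le_between in Hn.
    change (- (PI / 2 * (sqrtc n * invsqrtc n) * (1 - x) ^ n) <= Rabs (PI / 2 * (sqrtc n * invsqrtc n))). lra.
  - refine (is_series_le _ _ _ _ _ H HK). intros n.
    assert (Hn := HB n). apply Rabs_le_between in Hn. lra.
Qed.

(** The factor [invsqrtc j ^ 2] cancels against the moments of E. *)
Lemma ellE_leg_avg n : is_RInt (fun x => leg_avg 2 n x * ellE x) 0 1 (leg_moment n).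
Proof.
  rewrite <- leg_evenc_moment_sum.
  apply is_RInt_ext_R with (fun x => sum_f_R0 (fun j => leg_evenc n j * invsqrtc j ^ 2 * (x ^ j * ellE x)) n).
  { intros x. unfold leg_avg. rewrite Rmult_comm, <- sum_scal_l. apply sum_eq; intros; ring. }
  apply (is_RInt_sum (fun j x => leg_evenc n j * invsqrtc j ^ 2 * (x ^ j * ellE x))). intros j.
  assert (Hb := invsqrtc_gt0 j). assert (Hj := pos_INR j).
  replace (leg_evenc n j * (4 * (INR j + 1) / ((2 * INR j + 1) ^ 2 * (2 * INR j + 3)))) with
    (leg_evenc n j * invsqrtc j ^ 2 * (4 * (INR j + 1) / ((2 * INR j + 1) ^ 2 * (2 * INR j + 3)) / invsqrtc j ^ 2)).
  - apply (is_RInt_scal (V := R_NormedModule)), ellE_moment.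
  - field. repeat split; lra.
Qed.

(** * The elementary side *)

Definition wallis_odd_ser (y : C) : C := CSeries (fun n => RtoC (wallis_odd n) * (- y) ^ n)%C.

Lemma wallis_odd_bound n : 0 <= wallis_odd n <= 1.
Proof.
  induction n as [|n IH]; cbn [wallis_odd]; [lra|]. assert (Hn := pos_INR n).
  assert (0 <= (2 * INR n + 2) / (2 * INR n + 3) <= 1).
  { split; [apply Rlt_le, Rdiv_lt_0_compat; lra|].
    apply Rmult_le_reg_r with (2 * INR n + 3); [lra|]. field_simplify; lra. }
  nra.
Qed.

Lemma wallis_odd_ser_correct y : Cmod y < 1 ->
  is_cseries (fun n => RtoC (wallis_odd n) * (- y) ^ n)%C (wallis_odd_ser y).
Proof.
  intros H. apply CSeries_correct. apply ex_series_dom with (fun n => Cmod y ^ n).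
  - intros n. rewrite Rabs_pos_eq by apply Cmod_ge_0.
    rewrite Cmod_mult, Cmod_R, Cmod_pow, Cmod_opp. destruct (wallis_odd_bound n).
    rewrite Rabs_pos_eq by lra. generalize (pow_le (Cmod y) n (Cmod_ge_0 y)); intros; nra.
  - apply ex_series_geom. now rewrite Rabs_pos_eq by apply Cmod_ge_0.
Qed.

(** The difference of consecutive [wallis_odd] in [leg_moment] becomes the factor 1 + y. *)
Lemma leg_moment_series y : Cmod y < 1 ->
  is_cseries (fun n => RtoC (leg_moment n) * y ^ n)%C (7 / 3 - y / 15 - (1 + y) * wallis_odd_ser y)%C.
Proof.
  intros H. assert (HO := wallis_odd_ser_correct y H).
  set (f := fun n => match n with O => (7 / 3)%C | 1%nat => (- y / 15)%C | _ => RtoC 0 end).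
  set (g := fun n => match n with O => RtoC 0 | S m => (y * (RtoC (wallis_odd m) * (- y) ^ m))%C end).
  assert (Hf : is_cseries f (7 / 3 - y / 15)%C).
  { replace (7 / 3 - y / 15)%C with (f 0%nat + f 1%nat)%C by (simpl; field).
    apply is_cseries_two. reflexivity. }
  assert (Hg : is_cseries g (y * wallis_odd_ser y)%C).
  { replace (y * wallis_odd_ser y)%C with (g O + y * wallis_odd_ser y)%C by (simpl; ring).
    apply is_cseries_unshift. exact (is_cseries_scal y _ _ HO). }
  assert (H1 := is_cseries_plus _ _ _ _ Hf
     (is_cseries_scal (RtoC (-1)) _ _ (is_cseries_plus _ _ _ _ HO Hg))).
  replace (7 / 3 - y / 15 - (1 + y) * wallis_odd_ser y)%C with
    (7 / 3 - y / 15 + RtoC (-1) * (wallis_odd_ser y + y * wallis_odd_ser y))%C by ring.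
  eapply is_cseries_ext; [|exact H1]. intros n. cbv beta.
  destruct n as [|[|n]].
  - unfold f, g, leg_moment. simpl. replace (RtoC (4 / 3)) with (4 / 3)%C by (rewrite RtoC_div by lra; reflexivity). field.
  - unfold f, g, leg_moment. cbn [wallis_odd]. change (INR 0) with 0.
    replace (RtoC (- 2 / 5)) with (RtoC (- 2) / 5)%C by (rewrite RtoC_div by lra; reflexivity).
    replace (1 * ((2 * 0 + 2) / (2 * 0 + 3))) with (2 / 3) by field.
    replace (RtoC (2 / 3)) with (2 / 3)%C by (rewrite RtoC_div by lra; reflexivity).
    simpl. field.
  - unfold f, g, leg_moment. rewrite RtoC_mult, RtoC_minus.
    replace (- y)%C with (RtoC (-1) * y)%C by ring. rewrite !Cpow_mult_l, <- !RtoC_pow.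
    simpl pow. rewrite !Cpow_S, !RtoC_mult. ring.
Qed.

Lemma is_RInt_wallis_odd n : is_RInt (fun k => (1 - k ^ 2) ^ n) 0 1 (wallis_odd n).
Proof.
  induction n as [|n IH].
  - simpl. generalize (is_RInt_const (V := R_NormedModule) 0 1 1).
    change (scal (1 - 0) (1 : R_NormedModule)) with ((1 - 0) * 1).
    replace ((1 - 0) * 1) with 1 by ring. auto.
  - assert (Hn := pos_INR n).
    assert (HD : is_RInt (fun k => (2 * INR n + 3) * (1 - k ^ 2) ^ S n - (2 * INR n + 2) * (1 - k ^ 2) ^ n)
       0 1 (1 * (1 - 1 ^ 2) ^ S n - 0 * (1 - 0 ^ 2) ^ S n)).
    { apply (is_RInt_derive (V := R_CompleteNormedModule) (fun k => k * (1 - k ^ 2) ^ S n)).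
      - intros k _. auto_derive; [easy|].
        assert (E : forall m, match m with O => 1 | S _ => INR m + 1 end = INR m + 1) by exact S_INR.
        rewrite !E. replace (1 + - (k * (k * 1))) with (1 - k ^ 2) by ring. simpl. ring.
      - intros k _. apply (ex_derive_continuous (V := R_NormedModule)). auto_derive. easy. }
    eapply is_RInt_ext_R.
    2:{ replace (wallis_odd (S n)) with (/ (2 * INR n + 3) * ((1 * (1 - 1 ^ 2) ^ S n - 0 * (1 - 0 ^ 2) ^ S n)
             + (2 * INR n + 2) * wallis_odd n)).
        2:{ cbn [wallis_odd]. simpl. field. lra. }
        apply (is_RInt_scal (V := R_NormedModule)).
        apply (is_RInt_plus (V := R_NormedModule)); [exact HD|].
        apply (is_RInt_scal (V := R_NormedModule)). exact IH. }
    intros t. unfold scal, plus, mult; simpl. unfold mult; simpl. field. lra.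
Qed.

(** Termwise integration of a geometric series. *)
Lemma wallis_odd_ser_integral y : Cmod y < 1 ->
  is_RInt (V := C_R_NormedModule) (fun k => / (1 + RtoC (1 - k ^ 2) * y))%C 0 1 (wallis_odd_ser y).
Proof.
  intros H.
  destruct (is_RInt_cseries (fun n k => (- y) ^ n * RtoC ((1 - k ^ 2) ^ n))%C
     (fun k => / (1 + RtoC (1 - k ^ 2) * y))%C (fun n => Cmod y ^ n)
     (fun n => (- y) ^ n * RtoC (wallis_odd n))%C 0 1) as [S [HS1 HS2]].
  - lra.
  - intros n k Hk. rewrite Cmod_mult, Cmod_R, Cmod_pow, Cmod_opp.
    destruct (pow_unit (1 - k ^ 2) n ltac:(nra)). rewrite (Rabs_pos_eq (_ ^ n)) by lra.
    generalize (pow_le (Cmod y) n (Cmod_ge_0 y)); intros; nra.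
  - apply ex_series_geom. now rewrite Rabs_pos_eq by apply Cmod_ge_0.
  - intros k Hk.
    set (w := (RtoC (1 - k ^ 2) * - y)%C).
    assert (Hw : Cmod w < 1).
    { unfold w. rewrite Cmod_mult, Cmod_R, Cmod_opp, Rabs_pos_eq by nra.
      generalize (Cmod_ge_0 y); intros; nra. }
    assert (Hb := invsqrt_ser_correct w Hw). assert (Hbe := ex_series_invsqrt_ser w Hw).
    assert (HP := is_cseries_pmult _ _ _ _ _ Hb Hb Hbe Hbe).
    assert (E := invsqrt_ser_sqr w Hw).
    replace (/ (1 + RtoC (1 - k ^ 2) * y))%C with (invsqrt_ser w * invsqrt_ser w)%C.
    + eapply is_cseries_ext; [|exact HP]. intros n. cbv beta.
      rewrite invsqrtc_conv. unfold w. rewrite Cpow_mult_l, RtoC_pow. ring.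
    + assert (Hn : (1 - w)%C <> 0%C).
      { intros Z. rewrite Z, Cmult_0_r in E. apply (f_equal Re) in E. simpl in E. lra. }
      replace (1 + RtoC (1 - k ^ 2) * y)%C with (1 - w)%C by (unfold w; ring).
      transitivity (invsqrt_ser w * invsqrt_ser w * (1 - w) / (1 - w))%C; [field; exact Hn|].
      rewrite E. field. exact Hn.
  - intros n. apply is_RInt_cscal, is_RInt_RtoC, is_RInt_wallis_odd.
  - replace (wallis_odd_ser y) with S; [exact HS1|]. apply (is_cseries_eq _ _ _ HS2).
    eapply is_cseries_ext; [|exact (wallis_odd_ser_correct y H)]. intros n. apply Cmult_comm.
Qed.

(** * The integral inside the disc *)

(** The coordinate y with 1 - s^2 = 4y / (1 + y)^2; the half plane Re s > 0 corresponds to the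
    unit disc. *)
Definition cayley (s : C) : C := ((1 - s) / (1 + s))%C.

Lemma one_plus_neq0 s : 0 <= Re s -> (1 + s)%C <> 0%C.
Proof. intros H. apply C_neq0_Re. rewrite re_plus, re_RtoC. lra. Qed.

Lemma Cmod_le_sq (z w : C) : Re z * Re z + Im z * Im z <= Re w * Re w + Im w * Im w -> Cmod z <= Cmod w.
Proof.
  rewrite <- !Cmod_sq. intros. generalize (Cmod_ge_0 z) (Cmod_ge_0 w). intros; nra.
Qed.

Lemma cayley_le1 s : 0 <= Re s -> Cmod (cayley s) <= 1.
Proof.
  intros H. assert (Hn := one_plus_neq0 s H). unfold cayley. rewrite Cmod_div by exact Hn.
  assert (Hp := proj1 (Cmod_gt_0 _) Hn).
  apply Rmult_le_reg_r with (Cmod (1 + s)); [exact Hp|].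
  unfold Rdiv. rewrite Rmult_assoc, Rinv_l, Rmult_1_l, Rmult_1_r by lra.
  apply Cmod_le_sq. destruct s as [a b]. simpl in *. nra.
Qed.

Lemma cayley_lt1 s : 0 < Re s -> Cmod (cayley s) < 1.
Proof.
  intros H. assert (Hn := one_plus_neq0 s ltac:(lra)). unfold cayley. rewrite Cmod_div by exact Hn.
  assert (Hp := proj1 (Cmod_gt_0 _) Hn).
  apply Rmult_lt_reg_r with (Cmod (1 + s)); [exact Hp|].
  unfold Rdiv. rewrite Rmult_assoc, Rinv_l, Rmult_1_l, Rmult_1_r by lra.
  assert (E1 := Cmod_sq (1 - s)). assert (E2 := Cmod_sq (1 + s)).
  assert (Cmod (1 - s) * Cmod (1 - s) < Cmod (1 + s) * Cmod (1 + s)).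
  { rewrite E1, E2. destruct s as [a b]. simpl in *. nra. }
  generalize (Cmod_ge_0 (1 - s)); intros; nra.
Qed.

Lemma one_plus_cayley s : 0 <= Re s -> (1 + cayley s)%C = (2 / (1 + s))%C.
Proof. intros H. unfold cayley. field. now apply one_plus_neq0. Qed.

(** sqrt (1 - alpha x) when 1 - alpha = s0^2. *)
Definition root_at (s0 : C) (x : R) : C := Csqrt (RtoC (1 - x) + RtoC x * (s0 * s0)).

Lemma root_at_quadrant s0 x : 0 <= Re s0 -> 0 <= Im s0 -> 0 <= x ->
  0 <= Re (root_at s0 x) /\ 0 <= Im (root_at s0 x).
Proof.
  intros HR HI Hx. split; [apply Csqrt_Re|]. apply Csqrt_quadrant.
  rewrite im_plus, im_scal_l, im_mult, im_RtoC.
  assert (0 <= Re s0 * Im s0) by (apply Rmult_le_pos; assumption).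
  assert (0 <= x * (Re s0 * Im s0)) by (apply Rmult_le_pos; assumption). lra.
Qed.

Lemma root_at_Re_pos s0 x : 0 < Re s0 -> 0 <= Im s0 -> 0 <= x <= 1 -> 0 < Re (root_at s0 x).
Proof.
  intros HR HI Hx.
  destruct (Csqrt_Re (RtoC (1 - x) + RtoC x * (s0 * s0))) as [H|H]; [exact H|exfalso].
  assert (E := Csqrt_sqr (RtoC (1 - x) + RtoC x * (s0 * s0))).
  set (z := Csqrt (RtoC (1 - x) + RtoC x * (s0 * s0))) in *. clearbody z.
  assert (ER := f_equal Re E). assert (EI := f_equal Im E).
  rewrite re_mult, re_plus, re_scal_l, re_mult, re_RtoC in ER.
  rewrite im_mult, im_plus, im_scal_l, im_mult, im_RtoC in EI.
  rewrite <- H in ER, EI.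
  assert (EI' : x * (Re s0 * Im s0) = 0) by lra.
  assert (Hz := Rle_0_sqr (Im z)). unfold Rsqr in Hz.
  destruct (Rmult_integral _ _ EI') as [Z|Z]; [rewrite Z in ER; lra|].
  destruct (Rmult_integral _ _ Z) as [Z'|Z']; [lra|]. rewrite Z' in ER.
  assert (0 < Re s0 * Re s0) by nra.
  destruct (Req_dec x 0) as [Zx|Zx]; [rewrite Zx in ER; lra|].
  assert (0 < x * (Re s0 * Re s0)) by (apply Rmult_lt_0_compat; lra). lra.
Qed.

(** By [leg_avg_ser_homogeneous] the integrand is a power series in [cayley s0] whose
    coefficients are polynomials in x times E(sqrt (1 - x)); integration replaces them by
    [leg_moment]. *)
Lemma K2_kernel_integral_inner (s0 : C) : 0 < Re s0 -> 0 <= Im s0 ->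
  is_RInt (V := C_R_NormedModule)
    (fun x => RtoC (ellE x) * (sqrt_ser (- cayley (root_at s0 x)) * Ksq (- cayley (root_at s0 x))))%C 0 1
    (sqrt_ser (- cayley s0) * (7 / 3 - cayley s0 / 15 - (1 + cayley s0) * wallis_odd_ser (cayley s0)))%C.
Proof.
  intros HR HI. set (y0 := cayley s0). set (v0 := Csqrt y0).
  assert (Hv0 : (v0 * v0)%C = y0) by apply Csqrt_sqr.
  assert (Hy0 : Cmod y0 < 1) by now apply cayley_lt1.
  assert (Hsq : forall v y, (v * v)%C = y -> Cmod y < 1 -> Cmod v < 1).
  { intros v y <-. rewrite Cmod_mult. generalize (Cmod_ge_0 v); intros; nra. }
  assert (H0 := Hsq _ _ Hv0 Hy0).
  assert (Hn0 := one_plus_neq0 s0 ltac:(lra)).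
  destruct ellE_bounded as [K HK].
  destruct (is_RInt_cseries
    (fun n x => RtoC (ellE x) * (sqrt_ser (- y0) * (RtoC (leg_avg 2 n x) * y0 ^ n)))%C
    (fun x => RtoC (ellE x) * leg_avg_ser (sqrt_ser (- y0)) y0 2 x)%C
    (fun n => K * (Cmod (sqrt_ser (- y0)) * Cmod y0 ^ n))
    (fun n => sqrt_ser (- y0) * (RtoC (leg_moment n) * y0 ^ n))%C 0 1) as [S [HS1 HS2]].
  - lra.
  - intros n x Hx. rewrite Cmod_mult, Cmod_R.
    apply Rmult_le_compat; [apply Rabs_pos|apply Cmod_ge_0|now apply HK|now apply leg_avg_term_bound].
  - apply (ex_series_scal (V := R_NormedModule)). now apply ex_series_geomC.
  - intros x Hx. apply is_cseries_scal. now apply leg_avg_ser_correct.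
  - intros n.
    apply is_RInt_ext with (fun x => sqrt_ser (- y0) * y0 ^ n * RtoC (leg_avg 2 n x * ellE x))%C.
    { intros x _. rewrite RtoC_mult.
      match goal with |- ?a = ?b => change (@eq C a b) end. ring. }
    replace (sqrt_ser (- y0) * (RtoC (leg_moment n) * y0 ^ n))%C with
      (sqrt_ser (- y0) * y0 ^ n * RtoC (leg_moment n))%C by ring.
    apply is_RInt_cscal, is_RInt_RtoC, ellE_leg_avg.
  - replace (sqrt_ser (- y0) * (7 / 3 - y0 / 15 - (1 + y0) * wallis_odd_ser y0))%C with S.
    2:{ apply (is_cseries_eq _ _ _ HS2). apply is_cseries_scal. now apply leg_moment_series. }
    eapply is_RInt_ext; [|exact HS1].
    intros x. rewrite Rmin_left, Rmax_right by lra. intros Hx.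
    f_equal.
    set (s := root_at s0 x). set (y := cayley s).
    assert (Hs : 0 < Re s) by (apply root_at_Re_pos; lra).
    assert (Hy : Cmod y < 1) by now apply cayley_lt1.
    assert (Hns := one_plus_neq0 s ltac:(lra)).
    set (v1 := (RtoC (sqrt x) * v0 * (1 + y) / (1 + y0))%C).
    assert (Ey0 : (1 + y0)%C = (2 / (1 + s0))%C) by (apply one_plus_cayley; lra).
    assert (Ey : (1 + y)%C = (2 / (1 + s))%C) by (apply one_plus_cayley; lra).
    assert (Hss : (s * s)%C = (RtoC (1 - x) + RtoC x * (s0 * s0))%C) by apply Csqrt_sqr.
    assert (Hv1 : (v1 * v1)%C = y).
    { unfold v1. rewrite Ey, Ey0.
      transitivity (RtoC (sqrt x) * RtoC (sqrt x) * (v0 * v0) * (1 + s0) * (1 + s0) / ((1 + s) * (1 + s)))%C.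
      { field. split; assumption. }
      rewrite Hv0, <- RtoC_mult, sqrt_sqrt by lra.
      transitivity ((RtoC x - RtoC x * (s0 * s0)) / ((1 + s) * (1 + s)))%C.
      { unfold y0, cayley. field. split; assumption. }
      transitivity ((1 - s * s) / ((1 + s) * (1 + s)))%C.
      { f_equal. rewrite Hss, RtoC_minus. ring. }
      unfold y, cayley. field. exact Hns. }
    assert (H1 := Hsq _ _ Hv1 Hy).
    rewrite <- leg_avg_ser_Ksq by exact Hy.
    assert (HH := leg_avg_ser_homogeneous v0 v1 (sqrt x) 2 1 H0 H1).
    rewrite Hv0, Hv1 in HH. rewrite HH.
    + f_equal. rewrite pow2_sqrt; lra.
    + split; [apply sqrt_pos|]. rewrite <- sqrt_1. apply sqrt_le_1_alt. lra.
    + lra.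
    + unfold v1. rewrite Ey, Ey0. field. split; assumption.
Qed.

(** * The inverse hyperbolic cotangent as an integral *)

(** The half-angle formula, which makes the argument differentiable off the negative axis. *)
Lemma Carg_atan (a b : R) : ~ (b = 0 /\ a <= 0) ->
  Carg (a, b) = 2 * atan (b / (sqrt (a ^ 2 + b ^ 2) + a)).
Proof.
  intros H. set (r := sqrt (a ^ 2 + b ^ 2)).
  assert (Hr2 : r * r = a * a + b * b) by (unfold r; rewrite sqrt_sqrt; nra).
  assert (Hr0 : 0 <= r) by apply sqrt_pos.
  assert (Hr : 0 < r).
  { destruct Hr0 as [|E]; [assumption|]. rewrite <- E in Hr2. exfalso. apply H. nra. }
  assert (Hra : 0 < r + a).
  { destruct (Rlt_le_dec 0 (r + a)) as [|Hle]; [assumption|exfalso]. apply H. nra. }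
  set (u := b / (r + a)).
  assert (Hu1 : 0 < 1 + u ^ 2) by nra.
  assert (Hu : (1 + u ^ 2) * (r + a) = 2 * r).
  { apply Rmult_eq_reg_r with (r + a); [|lra]. unfold u.
    transitivity ((r + a) ^ 2 + b ^ 2); [field; lra|]. nra. }
  assert (Hs : sqrt (1 + u²) * sqrt (1 + u²) = 1 + u ^ 2) by (rewrite sqrt_sqrt; unfold Rsqr; nra).
  assert (Hs0 : 0 < sqrt (1 + u²)) by (apply sqrt_lt_R0; unfold Rsqr; nra).
  assert (Hnz : (1 + u ^ 2) * (r * (r + a)) <> 0) by (apply Rmult_integral_contrapositive_currified; nra).
  assert (Hc : cos (2 * atan u) = a / r).
  { rewrite cos_2a, cos_atan, sin_atan.
    transitivity ((1 - u ^ 2) / (sqrt (1 + u²) * sqrt (1 + u²))); [field; lra|].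
    rewrite Hs. apply Rmult_eq_reg_r with (2 := Hnz).
    transitivity (r * (2 * (r + a) - (1 + u ^ 2) * (r + a))); [field; lra|].
    transitivity (a * ((1 + u ^ 2) * (r + a))); [rewrite Hu; ring|field; lra]. }
  assert (Hsn : sin (2 * atan u) = b / r).
  { rewrite sin_2a, cos_atan, sin_atan.
    transitivity (2 * u / (sqrt (1 + u²) * sqrt (1 + u²))); [field; lra|].
    rewrite Hs. apply Rmult_eq_reg_r with (2 := Hnz).
    transitivity (2 * r * (u * (r + a))); [field; lra|].
    transitivity (b * ((1 + u ^ 2) * (r + a))); [rewrite Hu; unfold u; field; lra|field; lra]. }
  assert (Hat := atan_bound u).
  rewrite <- (Carg_polar r (2 * atan u)) by lra. f_equal.
  unfold Cpolar. rewrite Hc, Hsn. f_equal; field; lra.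
Qed.

Lemma sqrt_affine_pos (a b k : R) : ~ (k * b = 0 /\ 1 + k * a <= 0) ->
  0 < sqrt ((1 + k * a) ^ 2 + (k * b) ^ 2) /\
  0 < sqrt ((1 + k * a) ^ 2 + (k * b) ^ 2) + (1 + k * a).
Proof.
  set (p := 1 + k * a). set (q := k * b). intros H.
  set (r := sqrt (p ^ 2 + q ^ 2)).
  assert (Hr2 : r * r = p * p + q * q) by (unfold r; rewrite sqrt_sqrt; nra).
  assert (Hr0 : 0 <= r) by apply sqrt_pos.
  assert (Hr : 0 < r).
  { destruct Hr0 as [|E]; [assumption|]. rewrite <- E in Hr2. exfalso. apply H. nra. }
  split; [exact Hr|].
  destruct (Rlt_le_dec 0 (r + p)) as [|Hle]; [assumption|exfalso]. apply H. nra.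
Qed.

(** The logarithm along the segment from 1 to 1 + c, as long as the segment avoids the negative
    axis. *)
Lemma is_RInt_Cln (c : C) :
  (forall k, 0 <= k <= 1 -> ~ (k * Im c = 0 /\ 1 + k * Re c <= 0)) ->
  is_RInt (V := C_R_NormedModule) (fun k => c / (1 + RtoC k * c))%C 0 1 (Cln (1 + c)).
Proof.
  destruct c as [a b]. simpl Re. simpl Im. intros H.
  assert (Hpos : forall k, 0 <= k <= 1 -> 0 < (1 + k * a) ^ 2 + (k * b) ^ 2).
  { intros k Hk. destruct (sqrt_affine_pos a b k (H k Hk)) as [H1 _].
    destruct (Rlt_le_dec 0 ((1 + k * a) ^ 2 + (k * b) ^ 2)) as [|Hle]; [assumption|].
    rewrite sqrt_neg_0 in H1 by exact Hle. lra. }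
  set (dr := fun k => (a * (1 + k * a) + b * (k * b)) / ((1 + k * a) ^ 2 + (k * b) ^ 2)).
  set (di := fun k => (b * (1 + k * a) - a * (k * b)) / ((1 + k * a) ^ 2 + (k * b) ^ 2)).
  assert (Hcont : forall g : R -> R, (forall k, 0 <= k <= 1 -> ex_derive g k) ->
     forall k, Rmin 0 1 <= k <= Rmax 0 1 -> continuous g k).
  { intros g Hg k. rewrite Rmin_left, Rmax_right by lra. intros Hk.
    apply (ex_derive_continuous (V := R_NormedModule)). auto. }
  apply is_RInt_pair.
  - apply is_RInt_ext with dr.
    { intros k. rewrite Rmin_left, Rmax_right by lra. intros Hk.
      specialize (Hpos k ltac:(lra)). unfold dr. simpl. field. simpl in Hpos. nra. }
    replace (Re (Cln (1 + (a, b))%C)) with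
      (ln (sqrt ((1 + 1 * a) ^ 2 + (1 * b) ^ 2)) - ln (sqrt ((1 + 0 * a) ^ 2 + (0 * b) ^ 2))).
    2:{ unfold Cln, Cmod. cbn [fst snd Re Cplus RtoC].
        replace ((1 + 0 * a) ^ 2 + (0 * b) ^ 2) with 1 by ring. rewrite sqrt_1, ln_1.
        rewrite Rminus_0_r. f_equal. f_equal. ring. }
    apply (is_RInt_derive (V := R_CompleteNormedModule)
      (fun k => ln (sqrt ((1 + k * a) ^ 2 + (k * b) ^ 2)))).
    + intros k. rewrite Rmin_left, Rmax_right by lra. intros Hk. specialize (Hpos k Hk).
      assert (Hs : sqrt ((1 + k * a) ^ 2 + (k * b) ^ 2) * sqrt ((1 + k * a) ^ 2 + (k * b) ^ 2)
         = (1 + k * a) ^ 2 + (k * b) ^ 2) by (apply sqrt_sqrt; lra).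
      assert (Hs0 := sqrt_lt_R0 _ Hpos).
      auto_derive.
      * simpl in *. split; [lra|]. split; [lra|easy].
      * unfold dr. rewrite <- Hs.
        replace ((1 + k * a) * ((1 + k * a) * 1) + k * b * (k * b * 1)) with ((1 + k * a) ^ 2 + (k * b) ^ 2) by ring.
        field. lra.
    + apply Hcont. intros k Hk. specialize (Hpos k Hk). unfold dr. auto_derive. simpl in *. lra.
  - apply is_RInt_ext with di.
    { intros k. rewrite Rmin_left, Rmax_right by lra. intros Hk.
      specialize (Hpos k ltac:(lra)). unfold di. simpl. field. simpl in Hpos. nra. }
    replace (Im (Cln (1 + (a, b))%C)) with
      (2 * atan (1 * b / (sqrt ((1 + 1 * a) ^ 2 + (1 * b) ^ 2) + (1 + 1 * a)))
       - 2 * atan (0 * b / (sqrt ((1 + 0 * a) ^ 2 + (0 * b) ^ 2) + (1 + 0 * a)))).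
    2:{ rewrite Rmult_0_l. unfold Rdiv at 2. rewrite Rmult_0_l, atan_0.
        rewrite <- Carg_atan by (apply H; lra).
        cbn [Im snd Cln]. rewrite Rmult_0_r, Rminus_0_r. f_equal. apply C_ext; simpl; ring. }
    apply (is_RInt_derive (V := R_CompleteNormedModule)
      (fun k => 2 * atan (k * b / (sqrt ((1 + k * a) ^ 2 + (k * b) ^ 2) + (1 + k * a))))).
    + intros k. rewrite Rmin_left, Rmax_right by lra. intros Hk. specialize (Hpos k Hk).
      destruct (sqrt_affine_pos a b k (H k Hk)) as [Hs0 Hs1].
      assert (Hs : sqrt ((1 + k * a) ^ 2 + (k * b) ^ 2) * sqrt ((1 + k * a) ^ 2 + (k * b) ^ 2)
         = (1 + k * a) ^ 2 + (k * b) ^ 2) by (apply sqrt_sqrt; lra).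
      auto_derive.
      * simpl in *. split; [lra|]. split; [lra|easy].
      * replace ((1 + k * a) * ((1 + k * a) * 1) + k * b * (k * b * 1)) with ((1 + k * a) ^ 2 + (k * b) ^ 2) by ring.
        unfold di. rewrite <- Hs. set (r := sqrt ((1 + k * a) ^ 2 + (k * b) ^ 2)) in *.
        set (p := 1 + k * a) in *. set (q := k * b) in *.
        assert (Hd : r * (r + p) * 2 = (r + p) ^ 2 + q ^ 2) by nra.
        clearbody r. rewrite sqrt_square by lra.
        match goal with |- ?L = ?R => transitivity
          (2 * ((b * r * (r + p) - q * (a * p + b * q + a * r)) / (r * ((r + p) ^ 2 + q ^ 2)))) end.
        { field. repeat split; nra. }
        rewrite <- Hd. 
        transitivity ((b * (r * r - q * q) + b * r * p - q * a * p - q * a * r) / (r * r * (r + p)));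
          [field; lra|].
        replace (r * r - q * q) with (p * p) by nra. field. lra.
    + apply Hcont. intros k Hk. specialize (Hpos k Hk). unfold di. auto_derive. simpl in *. lra.
Qed.

(** The segments from 1 to 1 + z and 1 - z avoid the negative axis. *)
Lemma is_RInt_Cacoth (z : C) : 0 < Re z -> Im z <> 0 \/ Re z < 1 ->
  is_RInt (V := C_R_NormedModule) (fun k => z / (1 - RtoC (k ^ 2) * (z * z)))%C 0 1 (Cacoth (/ z)).
Proof.
  intros HR HI.
  assert (P1 : forall k, 0 <= k <= 1 -> ~ (k * Im z = 0 /\ 1 + k * Re z <= 0)).
  { intros k Hk [_ H]. nra. }
  assert (P2 : forall k, 0 <= k <= 1 -> ~ (k * Im (- z)%C = 0 /\ 1 + k * Re (- z)%C <= 0)).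
  { intros k Hk [H1 H2]. rewrite im_opp in H1. rewrite re_opp in H2.
    destruct HI as [HI|HI]; [|nra].
    assert (k = 0).
    { apply Rmult_eq_reg_r with (- Im z); [lra|]. intros E. apply HI. lra. }
    subst k. lra. }
  assert (I1 := is_RInt_Cln z P1). assert (I2 := is_RInt_Cln (- z) P2).
  assert (Hz : z <> 0%C) by (apply C_neq0_Re; lra).
  assert (N : forall c, (forall k, 0 <= k <= 1 -> ~ (k * Im c = 0 /\ 1 + k * Re c <= 0)) ->
     forall k, 0 <= k <= 1 -> (1 + RtoC k * c)%C <> 0%C).
  { intros c Hc k Hk E. apply (Hc k Hk).
    assert (E1 := f_equal Im E). assert (E2 := f_equal Re E).
    rewrite im_plus, im_scal_l in E1. rewrite re_plus, re_scal_l in E2. simpl in E1, E2. lra. }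
  assert (I3 := is_RInt_plus (V := C_R_NormedModule) _ _ _ _ _ _ I1 (is_RInt_cscal (RtoC (-1)) _ _ _ _ I2)).
  apply (is_RInt_cscal (RtoC (1 / 2))) in I3.
  replace (Cacoth (/ z)) with (RtoC (1 / 2) * plus (Cln (1 + z)) (RtoC (-1) * Cln (1 + - z)))%C.
  - eapply is_RInt_ext; [|exact I3]. intros k. rewrite Rmin_left, Rmax_right by lra. intros Hk.
    match goal with |- ?a = ?b => change (@eq C a b) end.
    change (RtoC (1 / 2) * (z / (1 + RtoC k * z) + RtoC (-1) * (- z / (1 + RtoC k * - z))) =
      z / (1 - RtoC (k ^ 2) * (z * z)))%C.
    assert (N1 := N z P1 k ltac:(lra)). assert (N2 := N (- z)%C P2 k ltac:(lra)).
    replace (1 - RtoC (k ^ 2) * (z * z))%C with ((1 + RtoC k * z) * (1 + RtoC k * - z))%C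
      by (rewrite RtoC_pow; simpl; ring).
    rewrite RtoC_div by lra. field. split; assumption.
  - unfold Cacoth.
    change (RtoC (1 / 2) * (Cln (1 + z) + RtoC (-1) * Cln (1 + - z)) = (Cln (1 + / / z) - Cln (1 - / / z)) / 2)%C.
    replace (/ / z)%C with z by (field; exact Hz).
    unfold Cminus at 2. rewrite RtoC_div by lra. field.
Qed.

(** * Passage to the unit circle *)

Definition Cconverges (u : nat -> C) (l : C) : Prop :=
  forall eps, 0 < eps -> exists N, forall n, (N <= n)%nat -> Cmod (u n - l) < eps.

Lemma Cconverges_const l : Cconverges (fun _ => l) l.
Proof.
  intros eps He. exists O. intros n _. replace (l - l)%C with (RtoC 0) by ring. now rewrite Cmod_0.
Qed.

Lemma Cconverges_minus u v l m : Cconverges u l -> Cconverges v m -> Cconverges (fun n => u n - v n)%C (l - m)%C.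
Proof.
  intros Hu Hv eps He.
  destruct (Hu (eps / 2) ltac:(lra)) as [N1 H1]. destruct (Hv (eps / 2) ltac:(lra)) as [N2 H2].
  exists (Nat.max N1 N2). intros n Hn. specialize (H1 n ltac:(lia)). specialize (H2 n ltac:(lia)).
  replace (u n - v n - (l - m))%C with ((u n - l) + - (v n - m))%C by ring.
  eapply Rle_lt_trans; [apply Cmod_triangle|]. rewrite Cmod_opp. lra.
Qed.

Lemma Cconverges_mult u v l m : Cconverges u l -> Cconverges v m -> Cconverges (fun n => u n * v n)%C (l * m)%C.
Proof.
  intros Hu Hv eps He. destruct (Cmult_close l m eps He) as (e & He' & H).
  destruct (Hu e He') as [N1 H1]. destruct (Hv e He') as [N2 H2].
  exists (Nat.max N1 N2). intros n Hn. apply H; [apply H1|apply H2]; lia.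
Qed.

Lemma is_RInt_uniform_limit_R (F : nat -> R -> R) (G : R -> R) (I : nat -> R) (L a b : R) :
  a <= b ->
  (forall n, is_RInt (F n) a b (I n)) ->
  (forall eps, 0 < eps -> exists N, forall n x, (N <= n)%nat -> a <= x <= b -> Rabs (F n x - G x) < eps) ->
  is_lim_seq I L -> is_RInt G a b L.
Proof.
  intros Hab HF HU HL.
  set (cl := fun (h : R -> R) x => if Rle_dec a x then if Rle_dec x b then h x else 0 else 0).
  destruct (filterlim_RInt (V := R_CompleteNormedModule) (fun n => cl (F n)) a b eventually _ (cl G) I)
    as [S [HS1 HS2]].
  - intros n. now apply is_RInt_clamp.
  - apply filterlim_locally. intros eps. destruct (HU eps (cond_pos eps)) as [N HN].
    exists N. intros n Hn x. unfold cl.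
    destruct (Rle_dec a x) as [Ha|]; [|apply ball_center].
    destruct (Rle_dec x b) as [Hb|]; [|apply ball_center].
    apply HN; [exact Hn|lra].
  - change (is_lim_seq I S) in HS1. apply is_lim_seq_unique in HS1. apply is_lim_seq_unique in HL.
    rewrite HL in HS1. injection HS1 as E. rewrite E.
    eapply is_RInt_ext; [|exact HS2]. intros x. rewrite Rmin_left, Rmax_right by lra. intros Hx.
    unfold cl. destruct (Rle_dec a x); [|lra]. destruct (Rle_dec x b); [reflexivity|lra].
Qed.

Lemma Cconverges_Re u l : Cconverges u l -> is_lim_seq (fun n => Re (u n)) (Re l).
Proof.
  intros H. apply is_lim_seq_spec. intros eps. destruct (H eps (cond_pos eps)) as [N HN].
  exists N. intros n Hn. eapply Rle_lt_trans; [|exact (HN n Hn)].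
  replace (Re (u n) - Re l) with (Re (u n - l)%C) by apply re_minus.
  apply re_le_Cmod.
Qed.
Lemma Cconverges_Im u l : Cconverges u l -> is_lim_seq (fun n => Im (u n)) (Im l).
Proof.
  intros H. apply is_lim_seq_spec. intros eps. destruct (H eps (cond_pos eps)) as [N HN].
  exists N. intros n Hn. eapply Rle_lt_trans; [|exact (HN n Hn)].
  replace (Im (u n) - Im l) with (Im (u n - l)%C) by apply im_minus.
  apply Rabs_le, Im_le_Cmod.
Qed.

Lemma is_RInt_uniform_limit (F : nat -> R -> C) (G : R -> C) (I : nat -> C) (L : C) (a b : R) :
  a <= b ->
  (forall n, is_RInt (V := C_R_NormedModule) (F n) a b (I n)) ->
  (forall eps, 0 < eps -> exists N, forall n x, (N <= n)%nat -> a <= x <= b -> Cmod (F n x - G x) < eps) ->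
  Cconverges I L -> is_RInt (V := C_R_NormedModule) G a b L.
Proof.
  intros Hab HF HU HL. apply is_RInt_pair.
  - apply (is_RInt_uniform_limit_R (fun n x => Re (F n x)) _ (fun n => Re (I n))); try assumption.
    + intros n. now apply is_RInt_Re.
    + intros eps He. destruct (HU eps He) as [N HN]. exists N. intros n x Hn Hx.
      eapply Rle_lt_trans; [|exact (HN n x Hn Hx)].
      replace (Re (F n x) - Re (G x)) with (Re (F n x - G x)%C) by apply re_minus.
      apply re_le_Cmod.
    + now apply Cconverges_Re.
  - apply (is_RInt_uniform_limit_R (fun n x => Im (F n x)) _ (fun n => Im (I n))); try assumption.
    + intros n. now apply is_RInt_Im.
    + intros eps He. destruct (HU eps He) as [N HN]. exists N. intros n x Hn Hx.
      eapply Rle_lt_trans; [|exact (HN n x Hn Hx)].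
      replace (Im (F n x) - Im (G x)) with (Im (F n x - G x)%C) by apply im_minus.
      apply Rabs_le, Im_le_Cmod.
    + now apply Cconverges_Im.
Qed.

Lemma CPSeries_bounded a : ex_series (fun n => Cmod (a n)) ->
  exists M, 0 <= M /\ forall y, Cmod y <= 1 -> Cmod (CPSeries a y) <= M.
Proof.
  intros [M HM]. exists M. split; [refine (series_nonneg _ M _ HM); intros; apply Cmod_ge_0|].
  intros y Hy. refine (is_cseries_Cmod_le _ _ _ _ (CPSeries_correct a y (ex_intro _ M HM) Hy) _ HM).
  intros n. rewrite Cmod_mult. generalize (Cmod_pow_le1 y n Hy) (Cmod_ge_0 (a n)); intros; nra.
Qed.

(** Up to the constant pi^2 / (4 sqrt 2), the integrand without its factor E; it is continuous
    up to the unit circle. *)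
Definition K2_kernel (y : C) : C := (sqrt_ser (- y) * Ksq (- y))%C.

Lemma K2_kernel_unif_cont eps : 0 < eps -> exists delta, 0 < delta /\
  forall y z, Cmod y <= 1 -> Cmod z <= 1 -> Cmod (y - z) < delta -> Cmod (K2_kernel y - K2_kernel z) < eps.
Proof.
  intros He.
  destruct (CPSeries_bounded _ ex_series_sqrtcC) as (A & HA0 & HA).
  destruct (CPSeries_bounded _ ex_series_invsqrtc3) as (B & HB0 & HB).
  set (e := eps / (A + B + 1)).
  assert (He' : 0 < e) by (apply Rdiv_lt_0_compat; lra).
  assert (Ee : e * (A + B + 1) = eps) by (unfold e; field; lra).
  destruct (CPSeries_unif_cont _ e ex_series_sqrtcC He') as (d1 & Hd1 & H1).
  destruct (CPSeries_unif_cont _ e ex_series_invsqrtc3 He') as (d2 & Hd2 & H2).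
  exists (Rmin d1 d2). split; [now apply Rmin_glb_lt|].
  intros y z Hy Hz Hyz.
  assert (Hy' : Cmod (- y) <= 1) by now rewrite Cmod_opp.
  assert (Hz' : Cmod (- z) <= 1) by now rewrite Cmod_opp.
  assert (Hyz' : Cmod (- y - - z) < Rmin d1 d2).
  { replace (- y - - z)%C with (- (y - z))%C by ring. now rewrite Cmod_opp. }
  specialize (H1 _ _ Hy' Hz' (Rlt_le_trans _ _ _ Hyz' (Rmin_l _ _))).
  specialize (H2 _ _ Hy' Hz' (Rlt_le_trans _ _ _ Hyz' (Rmin_r _ _))).
  unfold K2_kernel. change (CPSeries (fun n => RtoC (sqrtc n))) with sqrt_ser in *.
  change (CPSeries (fun n => RtoC (invsqrtc n ^ 3))) with Ksq in *.
  replace (sqrt_ser (- y) * Ksq (- y) - sqrt_ser (- z) * Ksq (- z))%C with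
    ((sqrt_ser (- y) - sqrt_ser (- z)) * Ksq (- y) + sqrt_ser (- z) * (Ksq (- y) - Ksq (- z)))%C by ring.
  eapply Rle_lt_trans; [apply Cmod_triangle|]. rewrite !Cmod_mult.
  specialize (HA _ Hz'). specialize (HB _ Hy').
  generalize (Cmod_ge_0 (sqrt_ser (- y) - sqrt_ser (- z))) (Cmod_ge_0 (Ksq (- y) - Ksq (- z)))
    (Cmod_ge_0 (sqrt_ser (- z))) (Cmod_ge_0 (Ksq (- y))); intros.
  assert (Cmod (sqrt_ser (- y) - sqrt_ser (- z)) * Cmod (Ksq (- y)) <= e * B) by (apply Rmult_le_compat; lra).
  assert (Cmod (sqrt_ser (- z)) * Cmod (Ksq (- y) - Ksq (- z)) <= A * e) by (apply Rmult_le_compat; lra).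
  nra.
Qed.

Lemma Cmod_one_plus s : 0 <= Re s -> 1 <= Cmod (1 + s).
Proof.
  intros H. generalize (Re_le_Cmod (1 + s)). rewrite re_plus, re_RtoC. lra.
Qed.

Lemma cayley_lipschitz s t : 0 <= Re s -> 0 <= Re t -> Cmod (cayley s - cayley t) <= 2 * Cmod (s - t).
Proof.
  intros Hs Ht. assert (Ns := one_plus_neq0 s Hs). assert (Nt := one_plus_neq0 t Ht).
  replace (cayley s - cayley t)%C with (- (2 * (s - t)) / ((1 + s) * (1 + t)))%C
    by (unfold cayley; field; split; assumption).
  rewrite Cmod_div by (now apply Cmult_neq_0). rewrite Cmod_opp, !Cmod_mult, Cmod_R, Rabs_pos_eq by lra.
  assert (H1 := Cmod_one_plus s Hs). assert (H2 := Cmod_one_plus t Ht).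
  apply Rmult_le_reg_r with (Cmod (1 + s) * Cmod (1 + t)); [nra|].
  unfold Rdiv. rewrite Rmult_assoc, Rinv_l, Rmult_1_r by nra.
  assert (1 <= Cmod (1 + s) * Cmod (1 + t)) by nra.
  generalize (Cmod_ge_0 (s - t)); intros; nra.
Qed.

(** (1 + y) [wallis_odd_ser y] as an integral in terms of s: the denominators stay away from 0
    when Re s >= 0, so that the limit on the imaginary axis is harmless. *)
Definition acoth_integrand (s : C) : R -> C := fun k => (/ (1 - RtoC (k ^ 2) * ((1 - s) / 2)))%C.

Lemma acoth_integrand_den s k : 0 <= Re s -> 0 <= k <= 1 ->
  1 / 2 <= Cmod (1 - RtoC (k ^ 2) * ((1 - s) / 2)).
Proof.
  intros Hs Hk. apply Rle_trans with (Re (1 - RtoC (k ^ 2) * ((1 - s) / 2))%C); [|apply Re_le_Cmod].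
  rewrite re_minus, re_scal_l, re_RtoC.
  replace ((1 - s) / 2)%C with (RtoC (/ 2) * (1 + - s))%C by (rewrite RtoC_inv by lra; field).
  rewrite re_scal_l, re_plus, re_opp, re_RtoC. assert (0 <= k ^ 2 <= 1) by (now apply pow_unit). nra.
Qed.

Lemma acoth_integrand_wallis_odd_ser s : 0 < Re s ->
  is_RInt (V := C_R_NormedModule) (acoth_integrand s) 0 1 ((1 + cayley s) * wallis_odd_ser (cayley s))%C.
Proof.
  intros Hs. assert (Hn := one_plus_neq0 s ltac:(lra)).
  assert (H := is_RInt_cscal (1 + cayley s)%C _ _ _ _ (wallis_odd_ser_integral (cayley s) (cayley_lt1 s Hs))).
  eapply is_RInt_ext; [|exact H]. intros k. rewrite Rmin_left, Rmax_right by lra. intros Hk.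
  match goal with |- ?a = ?b => change (@eq C a b) end. unfold acoth_integrand.
  assert (Hd : (1 - RtoC (k ^ 2) * ((1 - s) / 2))%C <> 0%C).
  { apply Cmod_gt_0. generalize (acoth_integrand_den s k ltac:(lra) ltac:(lra)). lra. }
  rewrite one_plus_cayley by lra.
  replace (1 + RtoC (1 - k ^ 2) * cayley s)%C with (2 * (1 - RtoC (k ^ 2) * ((1 - s) / 2)) / (1 + s))%C.
  - field. split; [|exact Hn]. intros E. apply Hd.
    transitivity ((2 - RtoC (k ^ 2) * (1 - s)) / 2)%C; [field|]. rewrite E. field.
  - unfold cayley. rewrite RtoC_minus. field. exact Hn.
Qed.

Lemma acoth_integrand_lipschitz s t I J : 0 <= Re s -> 0 <= Re t ->
  is_RInt (V := C_R_NormedModule) (acoth_integrand s) 0 1 I ->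
  is_RInt (V := C_R_NormedModule) (acoth_integrand t) 0 1 J ->
  Cmod (I - J) <= 2 * Cmod (s - t).
Proof.
  intros Hs Ht HI HJ.
  assert (HD := is_RInt_minus (V := C_R_NormedModule) _ _ _ _ _ _ HI HJ).
  assert (Hb : forall k, 0 <= k <= 1 -> norm (minus (acoth_integrand s k) (acoth_integrand t k) : C_R_NormedModule) <= 2 * Cmod (s - t)).
  { intros k Hk. rewrite <- Cmod_norm. change (Cmod (acoth_integrand s k - acoth_integrand t k) <= 2 * Cmod (s - t)).
    unfold acoth_integrand.
    assert (D1 := acoth_integrand_den s k Hs Hk). assert (D2 := acoth_integrand_den t k Ht Hk).
    set (p := (1 - RtoC (k ^ 2) * ((1 - s) / 2))%C) in *. set (q := (1 - RtoC (k ^ 2) * ((1 - t) / 2))%C) in *.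
    assert (Np : p <> 0%C) by (apply Cmod_gt_0; lra). assert (Nq : q <> 0%C) by (apply Cmod_gt_0; lra).
    assert (E : (q - p)%C = (RtoC (- k ^ 2 / 2) * (s - t))%C).
    { unfold p, q. rewrite RtoC_div, RtoC_opp by lra. field. }
    replace (/ p - / q)%C with ((q - p) / (p * q))%C by (field; split; assumption).
    rewrite Cmod_div by (now apply Cmult_neq_0). rewrite E, !Cmod_mult, Cmod_R.
    assert (0 <= k ^ 2 <= 1) by (now apply pow_unit).
    rewrite Rabs_left1 by lra.
    assert (1 / 4 <= Cmod p * Cmod q) by nra.
    apply Rmult_le_reg_r with (Cmod p * Cmod q); [lra|].
    unfold Rdiv at 1. rewrite Rmult_assoc, Rinv_l, Rmult_1_r by lra.
    generalize (Cmod_ge_0 (s - t)); intros; nra. }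
  assert (H := norm_RInt_le_const (V := C_R_NormedModule) _ 0 1 _ (2 * Cmod (s - t)) ltac:(lra) Hb HD).
  rewrite <- Cmod_norm in H. change (Cmod (I - J) <= (1 - 0) * (2 * Cmod (s - t))) in H. lra.
Qed.

(** Shifting [s0] to the right by a small positive number gives the open half plane; the
    integrands converge uniformly. *)
Lemma K2_kernel_integral (s0 : C) (A : C) : 0 <= Re s0 -> 0 <= Im s0 ->
  is_RInt (V := C_R_NormedModule) (acoth_integrand s0) 0 1 A ->
  is_RInt (V := C_R_NormedModule) (fun x => RtoC (ellE x) * K2_kernel (cayley (root_at s0 x)))%C 0 1
    (sqrt_ser (- cayley s0) * (7 / 3 - cayley s0 / 15 - A))%C.
Proof.
  intros HR HI HA.
  set (e := fun n => / (INR n + 1)).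
  assert (He : forall n, 0 < e n <= 1).
  { intros n. unfold e. assert (Hn := pos_INR n). split; [apply Rinv_0_lt_compat; lra|].
    rewrite <- Rinv_1. apply Rinv_le_contravar; lra. }
  assert (Hsmall : forall d, 0 < d -> exists N, forall n, (N <= n)%nat -> e n < d).
  { intros d Hd. destruct (nfloor_ex (/ d) ltac:(apply Rlt_le, Rinv_0_lt_compat; lra)) as [N HN].
    exists N. intros n Hn. apply le_INR in Hn. unfold e. rewrite <- (Rinv_inv d).
    apply Rinv_lt_contravar; [|lra]. apply Rmult_lt_0_compat; [now apply Rinv_0_lt_compat|].
    assert (Hn' := pos_INR n). lra. }
  set (t := fun n => (s0 + RtoC (e n))%C).
  assert (HtR : forall n, 0 < Re (t n)).
  { intros n. unfold t. rewrite re_plus, re_RtoC. destruct (He n). lra. }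
  assert (HtI : forall n, 0 <= Im (t n)).
  { intros n. unfold t. rewrite im_plus, im_RtoC. lra. }
  assert (Ht0 : forall n, Cmod (t n - s0) = e n).
  { intros n. unfold t. replace (s0 + RtoC (e n) - s0)%C with (RtoC (e n)) by ring.
    rewrite Cmod_R, Rabs_pos_eq; [easy|]. destruct (He n). lra. }
  apply (is_RInt_uniform_limit
    (fun n x => RtoC (ellE x) * (sqrt_ser (- cayley (root_at (t n) x)) * Ksq (- cayley (root_at (t n) x))))%C _
    (fun n => sqrt_ser (- cayley (t n)) * (7 / 3 - cayley (t n) / 15 - (1 + cayley (t n)) * wallis_odd_ser (cayley (t n))))%C);
    [lra| | |].
  - intros n. now apply K2_kernel_integral_inner.
  - intros eps Heps. destruct ellE_bounded as [K HK].
    assert (HK0 : 0 <= K) by (generalize (HK 0 ltac:(lra)) (Rabs_pos (ellE 0)); lra).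
    destruct (K2_kernel_unif_cont (eps / (K + 1)) ltac:(apply Rdiv_lt_0_compat; lra)) as (d & Hd & Hk).
    assert (HM := Cmod_ge_0 s0).
    destruct (Hsmall ((d / 2) ^ 2 / (2 * Cmod s0 + 1))) as [N HN].
    { apply Rdiv_lt_0_compat; [|lra]. apply pow_lt. lra. }
    exists N. intros n x Hn Hx. specialize (HN n Hn). destruct (He n) as [He0 He1].
    destruct (root_at_quadrant s0 x HR HI ltac:(lra)) as [Q1 Q2].
    destruct (root_at_quadrant (t n) x (Rlt_le _ _ (HtR n)) (HtI n) ltac:(lra)) as [Q3 Q4].
    assert (Hd2 : Cmod (root_at (t n) x - root_at s0 x) * Cmod (root_at (t n) x - root_at s0 x) <= e n * (2 * Cmod s0 + 1)).
    { eapply Rle_trans; [now apply quadrant_diff|]. unfold root_at. rewrite !Csqrt_sqr.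
      replace (RtoC (1 - x) + RtoC x * (t n * t n) - (RtoC (1 - x) + RtoC x * (s0 * s0)))%C with
        (RtoC x * ((t n - s0) * (2 * s0 + RtoC (e n))))%C by (unfold t; ring).
      rewrite !Cmod_mult, Ht0, Cmod_R, Rabs_pos_eq by lra.
      assert (H2 := Cmod_triangle (2 * s0) (RtoC (e n))).
      rewrite Cmod_mult, !Cmod_R, !Rabs_pos_eq in H2 by lra.
      assert (H3 := Cmod_ge_0 (2 * s0 + RtoC (e n))).
      assert (e n * Cmod (2 * s0 + RtoC (e n)) <= e n * (2 * Cmod s0 + 1)) by (apply Rmult_le_compat_l; lra).
      assert (0 <= e n * Cmod (2 * s0 + RtoC (e n))) by (apply Rmult_le_pos; lra). nra. }
    assert (Hd3 : e n * (2 * Cmod s0 + 1) < (d / 2) ^ 2).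
    { apply Rmult_lt_reg_r with (/ (2 * Cmod s0 + 1)); [apply Rinv_0_lt_compat; lra|].
      rewrite Rmult_assoc, Rinv_r, Rmult_1_r by lra. exact HN. }
    assert (Hd4 : Cmod (root_at (t n) x - root_at s0 x) < d / 2).
    { generalize (Cmod_ge_0 (root_at (t n) x - root_at s0 x)); intros; nra. }
    assert (Hd5 := cayley_lipschitz _ _ Q3 Q1).
    specialize (Hk _ _ (cayley_le1 _ Q3) (cayley_le1 _ Q1) ltac:(lra)). unfold K2_kernel in Hk |- *.
    set (P := (sqrt_ser (- cayley (root_at (t n) x)) * Ksq (- cayley (root_at (t n) x)))%C) in *.
    set (Q := (sqrt_ser (- cayley (root_at s0 x)) * Ksq (- cayley (root_at s0 x)))%C) in *.
    replace (RtoC (ellE x) * P - RtoC (ellE x) * Q)%C with (RtoC (ellE x) * (P - Q))%C by ring.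
    rewrite Cmod_mult, Cmod_R. specialize (HK x Hx).
    assert (E : eps / (K + 1) * (K + 1) = eps) by (field; lra).
    generalize (Cmod_ge_0 (P - Q)) (Rabs_pos (ellE x)); intros.
    assert (Rabs (ellE x) * Cmod (P - Q) <= K * Cmod (P - Q)) by (apply Rmult_le_compat_r; lra).
    assert (K * Cmod (P - Q) <= K * (eps / (K + 1))) by (apply Rmult_le_compat_l; lra).
    assert (0 < eps / (K + 1)) by (apply Rdiv_lt_0_compat; lra). nra.
  - assert (Cy : Cconverges (fun n => cayley (t n)) (cayley s0)).
    { intros eps Heps. destruct (Hsmall (eps / 2) ltac:(lra)) as [N HN]. exists N. intros n Hn.
      eapply Rle_lt_trans; [apply cayley_lipschitz; [apply Rlt_le, HtR|exact HR]|].
      rewrite Ht0. specialize (HN n Hn). lra. }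
    apply Cconverges_mult.
    + intros eps Heps.
      destruct (CPSeries_unif_cont _ eps ex_series_sqrtcC Heps) as (d & Hd & H).
      destruct (Cy d Hd) as [N HN]. exists N. intros n Hn. apply H.
      * rewrite Cmod_opp. apply cayley_le1, Rlt_le, HtR.
      * rewrite Cmod_opp. now apply cayley_le1.
      * replace (- cayley (t n) - - cayley s0)%C with (- (cayley (t n) - cayley s0))%C by ring.
        rewrite Cmod_opp. now apply HN.
    + apply Cconverges_minus; [apply Cconverges_minus; [apply Cconverges_const|apply Cconverges_mult; [exact Cy|apply Cconverges_const]]|].
      intros eps Heps. destruct (Hsmall (eps / 2) ltac:(lra)) as [N HN]. exists N. intros n Hn.
      eapply Rle_lt_trans.
      * apply (acoth_integrand_lipschitz (t n) s0); [apply Rlt_le, HtR|exact HR|now apply acoth_integrand_wallis_odd_ser|exact HA].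
      * rewrite Ht0. specialize (HN n Hn). lra.
Qed.

(** * The closed form *)

Lemma Re_Cinv_pos z : 0 < Re z -> 0 < Re (/ z)%C.
Proof.
  intros H. change (0 < Re z / (Re z ^ 2 + Im z ^ 2)). apply Rdiv_lt_0_compat; [exact H|]. nra.
Qed.

Lemma Csqrt_one_plus_Re s : 0 <= Re s -> 0 < Re (Csqrt (1 + s)).
Proof.
  intros H. destruct (Csqrt_Re (1 + s)) as [H1|H1]; [exact H1|exfalso].
  assert (E := f_equal Re (Csqrt_sqr (1 + s))). rewrite re_mult, <- H1, re_plus, re_RtoC in E.
  generalize (Rle_0_sqr (Im (Csqrt (1 + s)))). unfold Rsqr. intros; nra.
Qed.

Theorem corollary3 (alpha : R) (alpha_gt0 : 0 < alpha) :
  is_RInt (V := C_R_NormedModule)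
    (fun x : R =>
       (EllipticE (RtoC (sqrt (1 - x)))
        * (EllipticK
             (Csqrt (RtoC (1 / 2)
                     - RtoC (1 / sqrt 2)
                       * Csqrt ((1 - Csqrt (RtoC (1 - alpha * x)))
                                / RtoC (alpha * x))))) ^ 2
        / Croot4 (2 * Csqrt (RtoC (1 - alpha * x)) - RtoC (alpha * x) + 2))%C)
    0 1
    (RtoC (PI ^ 2)
     * (36 * RtoC alpha
        + 2 * Csqrt (RtoC (1 - alpha))
        - 15 * RtoC (sqrt 2)
          * Csqrt ((Csqrt (RtoC (1 - alpha)) + 1) / RtoC alpha)
          * RtoC alpha
          * Cacoth (RtoC (sqrt 2) * Csqrt (Csqrt (RtoC (1 - alpha)) + 1)
                    / RtoC (sqrt alpha))
        - 2)
     / (60 * RtoC alpha * Csqrt (Csqrt (RtoC (1 - alpha)) + 1)))%C.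
Proof.
  set (s0 := Csqrt (RtoC (1 - alpha))).
  assert (HR0 : 0 <= Re s0) by apply Csqrt_Re.
  assert (HI0 : 0 <= Im s0) by (apply Csqrt_quadrant; simpl; lra).
  assert (Hs0 : (s0 * s0)%C = RtoC (1 - alpha)) by apply Csqrt_sqr.
  rewrite (Cplus_comm s0 1).
  set (g0 := Csqrt (1 + s0)).
  assert (Hg0 : (g0 * g0)%C = (1 + s0)%C) by apply Csqrt_sqr.
  assert (Rg0 : 0 < Re g0) by now apply Csqrt_one_plus_Re.
  assert (Ng0 : g0 <> 0%C) by (apply C_neq0_Re; lra).
  assert (N0 := one_plus_neq0 s0 HR0).
  assert (H2 : 0 < sqrt 2) by (apply sqrt_lt_R0; lra).
  assert (H22 : (RtoC (sqrt 2) * RtoC (sqrt 2))%C = 2%C) by (rewrite <- RtoC_mult, sqrt_sqrt; [easy|lra]).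
  assert (N2 : RtoC (sqrt 2) <> 0%C) by (apply RtoC_neq0; lra).
  set (ra := sqrt alpha) in *.
  assert (Hra : 0 < ra) by now apply sqrt_lt_R0.
  assert (Hraa : (RtoC ra * RtoC ra)%C = RtoC alpha) by (rewrite <- RtoC_mult; unfold ra; rewrite sqrt_sqrt; [easy|lra]).
  assert (Nra : RtoC ra <> 0%C) by (apply RtoC_neq0; lra).
  assert (Na : RtoC alpha <> 0%C) by (apply RtoC_neq0; lra).
  assert (Ealpha : RtoC alpha = ((1 - s0) * (1 + s0))%C).
  { transitivity (1 - s0 * s0)%C; [|ring]. rewrite Hs0, RtoC_minus. ring. }
  assert (Hroot : forall s, 0 <= Re s -> sqrt_ser (- cayley s) = (RtoC (sqrt 2) / Csqrt (1 + s))%C).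
  { intros s Hs. assert (Hp := Csqrt_one_plus_Re s Hs).
    assert (Np : Csqrt (1 + s) <> 0%C) by (apply C_neq0_Re; lra).
    rewrite sqrt_ser_Csqrt by (rewrite Cmod_opp; now apply cayley_le1).
    replace (1 - - cayley s)%C with (1 + cayley s)%C by ring. rewrite one_plus_cayley by exact Hs.
    apply Csqrt_unique.
    - transitivity (RtoC (sqrt 2) * RtoC (sqrt 2) / (Csqrt (1 + s) * Csqrt (1 + s)))%C; [field; exact Np|].
      now rewrite H22, Csqrt_sqr.
    - left. unfold Cdiv. rewrite re_scal_l. apply Rmult_lt_0_compat; [exact H2|now apply Re_Cinv_pos]. }
  (* The argument of the inverse cotangent is 1/z, with z^2 = (1 - s0)/2. *)
  set (z := (RtoC ra / (RtoC (sqrt 2) * g0))%C).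
  assert (Hz2 : (z * z)%C = ((1 - s0) / 2)%C).
  { unfold z. transitivity (RtoC ra * RtoC ra / (RtoC (sqrt 2) * RtoC (sqrt 2) * (g0 * g0)))%C;
      [field; split; assumption|].
    rewrite Hraa, H22, Hg0, Ealpha. field. exact N0. }
  assert (HzR : 0 < Re z).
  { replace z with (RtoC (ra / sqrt 2) * / g0)%C
      by (unfold z; rewrite RtoC_div by lra; field; split; assumption).
    rewrite re_scal_l. apply Rmult_lt_0_compat; [now apply Rdiv_lt_0_compat|now apply Re_Cinv_pos]. }
  assert (HzI : Im z <> 0 \/ Re z < 1).
  { destruct (Req_dec (Im z) 0) as [Ez|Ez]; [right|now left].
    assert (E := f_equal Re Hz2). rewrite re_mult, Ez in E.
    replace ((1 - s0) / 2)%C with (RtoC (/ 2) * (1 + - s0))%C in E by (rewrite RtoC_inv by lra; field).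
    rewrite re_scal_l, re_plus, re_opp, re_RtoC in E. nra. }
  assert (Nz : z <> 0%C) by (apply C_neq0_Re; lra).
  assert (Ew : (RtoC (sqrt 2) * g0 / RtoC ra)%C = (/ z)%C).
  { unfold z. field. repeat split; assumption. }
  rewrite Ew.
  assert (HA : is_RInt (V := C_R_NormedModule) (acoth_integrand s0) 0 1 (/ z * Cacoth (/ z))%C).
  { eapply is_RInt_ext; [|exact (is_RInt_cscal (/ z)%C _ _ _ _ (is_RInt_Cacoth z HzR HzI))].
    intros k. rewrite Rmin_left, Rmax_right by lra. intros Hk.
    match goal with |- ?a = ?b => change (@eq C a b) end. unfold acoth_integrand. rewrite Hz2.
    assert (Hd : (1 - RtoC (k ^ 2) * ((1 - s0) / 2))%C <> 0%C).
    { apply Cmod_gt_0. generalize (acoth_integrand_den s0 k HR0 ltac:(lra)). lra. }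
    set (D := (1 - RtoC (k ^ 2) * ((1 - s0) / 2))%C) in *. field. split; assumption. }
  assert (HM := K2_kernel_integral s0 _ HR0 HI0 HA).
  apply (is_RInt_cscal (RtoC (PI ^ 2 / 4) / RtoC (sqrt 2))%C) in HM.
  assert (Eq : Csqrt ((1 + s0) / RtoC alpha) = (g0 / RtoC ra)%C).
  { apply Csqrt_unique.
    - transitivity (g0 * g0 / (RtoC ra * RtoC ra))%C; [field; exact Nra|]. now rewrite Hg0, Hraa.
    - left. replace (g0 / RtoC ra)%C with (RtoC (/ ra) * g0)%C by (rewrite RtoC_inv by lra; field; exact Nra).
      rewrite re_scal_l. apply Rmult_lt_0_compat; [now apply Rinv_0_lt_compat|exact Rg0]. }
  rewrite Eq.
  match goal with |- is_RInt _ _ _ ?v => replace v with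
    (RtoC (PI ^ 2 / 4) / RtoC (sqrt 2) * (sqrt_ser (- cayley s0) *
        (7 / 3 - cayley s0 / 15 - / z * Cacoth (/ z))))%C end.
  - eapply is_RInt_ext; [|exact HM].
    intros x. rewrite Rmin_left, Rmax_right by lra. intros Hx.
    match goal with |- ?a = ?b => change (@eq C a b) end.
    assert (Esx : Csqrt (RtoC (1 - alpha * x)) = root_at s0 x).
    { unfold root_at. f_equal. rewrite Hs0, <- RtoC_mult, <- RtoC_plus. f_equal. ring. }
    rewrite Esx. set (s := root_at s0 x).
    destruct (root_at_quadrant s0 x HR0 HI0 ltac:(lra)) as [HRs HIs]. fold s in HRs, HIs.
    assert (Hss : (s * s)%C = RtoC (1 - alpha * x)) by (unfold s; rewrite <- Esx; apply Csqrt_sqr).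
    assert (Eax : RtoC (alpha * x) = ((1 - s) * (1 + s))%C).
    { transitivity (1 - s * s)%C; [|ring]. rewrite Hss, RtoC_minus. ring. }
    assert (Nax : RtoC (alpha * x) <> 0%C) by (apply RtoC_neq0; nra).
    assert (Ns := one_plus_neq0 s HRs).
    assert (Ns1 : (1 - s)%C <> 0%C).
    { intros E. apply Nax. rewrite Eax, E. ring. }
    set (g := Csqrt (1 + s)).
    assert (Rg : 0 < Re g) by now apply Csqrt_one_plus_Re.
    assert (Ng : g <> 0%C) by (apply C_neq0_Re; lra).
    assert (Hg : (g * g)%C = (1 + s)%C) by apply Csqrt_sqr.
    assert (Hrs := Hroot s HRs). fold g in Hrs.
    assert (E1 : Csqrt ((1 - s) / RtoC (alpha * x)) = (/ g)%C).
    { rewrite Eax. replace ((1 - s) / ((1 - s) * (1 + s)))%C with (/ (1 + s))%C by (field; split; assumption).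
      apply Csqrt_unique; [|left; now apply Re_Cinv_pos].
      rewrite <- Hg. field. exact Ng. }
    assert (E2 : (RtoC (1 / 2) - RtoC (1 / sqrt 2) * Csqrt ((1 - s) / RtoC (alpha * x)))%C = halfroot (- cayley s)).
    { rewrite E1. unfold halfroot. rewrite Hrs. rewrite !RtoC_div by lra.
      transitivity ((1 - 2 / RtoC (sqrt 2) * / g) / 2)%C; [field; split; assumption|].
      rewrite <- H22 at 1. field. split; assumption. }
    rewrite E2.
    rewrite (EllipticK_sqr _ (- cayley s)); [|rewrite Cmod_opp; now apply cayley_le1|apply Csqrt_sqr].
    rewrite EllipticE_ellE by lra.
    assert (E3 : Croot4 (2 * s - RtoC (alpha * x) + 2) = g).
    { replace (2 * s - RtoC (alpha * x) + 2)%C with ((1 + s) * (1 + s))%C by (rewrite Eax; ring).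
      rewrite Croot4_Csqrt by (now apply Cmult_neq_0). unfold g. f_equal.
      apply Csqrt_unique; [reflexivity|]. left. rewrite re_plus, re_RtoC. lra. }
    rewrite E3. unfold K2_kernel. rewrite Hrs. field. split; assumption.
  - rewrite (Hroot s0 HR0). fold g0.
    replace (15 * RtoC (sqrt 2) * (g0 / RtoC ra) * RtoC alpha * Cacoth (/ z))%C with
      (15 * RtoC alpha * (/ z * Cacoth (/ z)))%C.
    2:{ rewrite <- Ew. field. exact Nra. }
    set (X := (/ z * Cacoth (/ z))%C).
    rewrite RtoC_div by lra. 
    transitivity (RtoC (PI ^ 2) * (36 - 2 * (1 - s0) / RtoC alpha - 15 * X) / (60 * g0))%C.
    + replace (2 * (1 - s0) / RtoC alpha)%C with (2 / (1 + s0))%C.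
      * unfold cayley. field. repeat split; assumption.
      * rewrite Ealpha. field. split; [exact N0|].
        intros E. apply Na. rewrite Ealpha, E. ring.
    + field. split; assumption.
Qed.
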